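(* For any real $\lambda>\nu\ge0$, $$\left\lfloor\frac1\pi\underline{\phi}_\nu(\lambda)+\frac12\right\rfloor\le\mathcal{N}_{J'_\nu}(\lambda)\le\left\lfloor\frac1\pi\widetilde{\widetilde{\phi}}_\nu(\lambda)+\frac12\right\rfloor.$$
   Context: $\lfloor\cdot\rfloor$ denotes the integer part (floor). $J_\nu$ is the standard Bessel function of the first kind of order $\nu\ge0$; $j'_{\nu,k}$ ($k\in\mathbb{N}=\{1,2,\dots\}$) is the $k$th positive zero of $J'_\nu$ in increasing order, except that for $\nu=0$ one sets $j'_{0,1}:=0$ (so that $j'_{0,k}$, $k\ge2$, is the $(k-1)$st positive zero of $J_0'$). The counting function is $\mathcal{N}_{J'_\nu}(\lambda):=\#\{k\in\mathbb{N}:j'_{\nu,k}\le\lambda\}$. For $x>\nu\ge0$ define $$\underline{\phi}_\nu(x):=\sqrt{x^2-\nu^2}-\nu\arccos\frac{\nu}{x}+\frac{\pi}{4},\qquad \widetilde{\phi}_\nu(x):=\underline{\phi}_\nu(x)+\frac{9x^2-2\nu^2}{24(x^2-\nu^2)^{3/2}}.$$ The polynomial $p_\nu(x):=8x^6-3(8\nu^2+1)x^4+4\nu^2(6\nu^2-1)x^2-8\nu^6$ has exactly one root in $(\nu,+\infty)$, denoted $x^\star_\nu$. Set $z^\star_\nu:=\widetilde{\phi}_\nu(x^\star_\nu)$ and $$\widetilde{\widetilde{\phi}}_\nu(x):=\begin{cases}z^\star_\nu&\text{if }\nu<x<x^\star_\nu,\\ \widetilde{\phi}_\nu(x)&\text{if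 }x\ge x^\star_\nu.\end{cases}$$ *)

(* Defs.v *)
From Stdlib Require Import Reals ClassicalEpsilon Finite_sets ZArith.
From Coquelicot Require Import Coquelicot.
Open Scope R_scope.

Definition Gamma (s : R) : R :=
  RInt_gen (fun t => Rpower t (s - 1) * exp (- t))
           (at_right 0) (Rbar_locally p_infty).

(* J_nu(x) = (x/2)^nu * sum_k (-1)^k (x^2/4)^k / (k! Gamma(nu+k+1)); only
   meaningful for x > 0, because [Rpower] needs a positive base. *)
Definition bessel_J (nu x : R) : R :=
  Rpower (x / 2) nu *
  PSeries (fun k => (-1) ^ k / (INR (fact k) * Gamma (nu + INR k + 1)))
          (x ^ 2 / 4).

Definition dbessel_J (nu x : R) : R := Derive (bessel_J nu) x.

(* Numbering starts at k = 1: x is the k-th positive zero when it is a zero and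
   exactly k zeros, x included, lie in (0, x]. *)
Definition is_kth_positive_zero (f : R -> R) (k : nat) (x : R) : Prop :=
  0 < x /\ f x = 0 /\ cardinal R (fun y => 0 < y <= x /\ f y = 0) k.

Definition kth_positive_zero (f : R -> R) (k : nat) : R :=
  epsilon (inhabits 0) (is_kth_positive_zero f k).

(* j'_{nu,k} for k >= 1; the value at k = 0 is never used. *)
Definition jprime (nu : R) (k : nat) : R :=
  if Req_EM_T nu 0 then
    match k with
    | S (S m) => kth_positive_zero (dbessel_J nu) (S m)
    | _ => 0
    end
  else kth_positive_zero (dbessel_J nu) k.

(* The counting function, as a relation: N is the number of k >= 1 with
   j'_{nu,k} <= lam. [cardinal] entails that there are finitely many such k. *)
Definition is_counting_jprime (nu lam : R) (N : nat) : Prop :=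
  cardinal nat (fun k => (1 <= k)%nat /\ jprime nu k <= lam) N.

Definition phi_low (nu x : R) : R :=
  sqrt (x ^ 2 - nu ^ 2) - nu * acos (nu / x) + PI / 4.

Definition phi_tilde (nu x : R) : R :=
  phi_low nu x +
  (9 * x ^ 2 - 2 * nu ^ 2) / (24 * Rpower (x ^ 2 - nu ^ 2) (3 / 2)).

Definition p_poly (nu x : R) : R :=
  8 * x ^ 6 - 3 * (8 * nu ^ 2 + 1) * x ^ 4
  + 4 * nu ^ 2 * (6 * nu ^ 2 - 1) * x ^ 2 - 8 * nu ^ 6.

Definition x_star (nu : R) : R :=
  epsilon (inhabits 0) (fun x => nu < x /\ p_poly nu x = 0).

Definition z_star (nu : R) : R := phi_tilde nu (x_star nu).

Definition phi_tilde_tilde (nu x : R) : R :=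
  if Rlt_dec x (x_star nu) then z_star nu else phi_tilde nu x.

(* Main.v *)
Require Import Defs.
From Stdlib Require Import Reals Lra Lia Psatz ZArith ClassicalEpsilon.
From Stdlib Require Import Ensembles Finite_sets Finite_sets_facts.
From Coquelicot Require Import Coquelicot.
Open Scope R_scope.

(** The proof compares polar angles of plane curves built from [J_nu] and
    [x J_nu'], without using the second solution of the Bessel equation.

    Counting.  Put [u = x J'].  The curve [(u, J)] never vanishes and, for
    [x > nu], turns counterclockwise; [J'] has a zero each time the angle [th] of
    the curve passes a point of [PI / 2 + PI Z].  So [N] is
    [floor (th / PI + 1 / 2)], where [th] is normalized by its value near [nu]
    ([bessel_angle], [counting_function]).  The convention [j'_(0,1) = 0] agrees
    with this because for [nu = 0] the curve starts at the angle [PI / 2].  A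
    shear of the curve with positive diagonal entries does not change which
    points of [PI / 2 + PI Z] its angle has passed ([sheared_angles]), so that
    angles with a simpler velocity may be used instead.

    Comparison.  Let [S = sqrt (x^2 - nu^2)] and, in this paragraph, let a prime be
    the derivation [(x / S) d/dx], for which [phi_low' = 1].  The function [c = S^(-1/2) u]
    satisfies [c'' + (1 - h) c = 0] with
    [h = (3 x^4 + 4 nu^2 x^2) / (4 S^6) > 0], and [phi_tilde' = 1 - h / 2].  The
    angle of [(c, - c')] has the velocity [1 - h cos^2 <= 1], so it is above
    [phi_low] if it is asymptotic to [phi_low] at infinity
    ([phase_above_phi_low]).  Beyond the zero [x_star] of [1 - h / 2], one can
    shear [(c, - c')] so that the velocity becomes [1 - h / 2] plus a multiple of
    [cos^2] that is nonnegative since [h'' >= h^2] ([defect_convex]); this angle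
    is below [phi_tilde] if it is asymptotic to it ([phase_below_phi_tilde]).
    Before [x_star] the monotonicity of the counting function suffices.

    Asymptotics.  What remains is the phase at infinity, that [(J, J')] points
    asymptotically in the direction [(cos a, - sin a)] with
    [a = x - nu PI / 2 - PI / 4], up to a positive factor ([ray_connection]).
    For this the solution [w = sqrt z J_nu z] is followed along the arc
    [z = r exp (i b)], [0 <= b <= PI / 2].  The amplitude
    [(w + i w') exp (i z)] of its component in [exp (- i z)] changes along
    the arc by a relative amount [O(1 / r)] only.  At the end [z = i r] all
    terms of the power series have the same argument [om = (nu + 1 / 2) PI / 2];
    hence so has the amplitude there and, asymptotically, at the end [z = r], and
    [a = r - om].

    The asymptotics determine the angles up to a multiple of [2 PI] only.  The
    right multiple is found by evaluation near [nu], where [phi_low >= PI / 4],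
    and at a point where [phi_tilde < 3 PI / 2] ([bessel_angle_enclosure]). *)

(** * The Gamma integral *)

(** The integrals over [[a, b]] increase when the interval grows, so they
    converge to their supremum. *)
Lemma is_RInt_gen_nonneg_bounded (f : R -> R) (M : R) :
  (forall x, 0 < x -> continuous f x) ->
  (forall x, 0 < x -> 0 <= f x) ->
  (forall a b, 0 < a < b -> RInt f a b <= M) ->
  exists L, is_RInt_gen f (at_right 0) (Rbar_locally p_infty) L /\
    forall a b, 0 < a < b -> RInt f a b <= L.
Proof.
intros Hc Hp HM.
assert (Hex : forall a b, 0 < a -> 0 < b -> ex_RInt f a b).
{ intros a b Ha Hb. apply (ex_RInt_continuous f a b).
  intros z Hz. apply Hc. revert Hz. unfold Rmin. destruct (Rle_dec a b); lra. }
set (E := fun y => exists a b, 0 < a < b /\ y = RInt f a b).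
destruct (completeness E) as [L [HL1 HL2]].
- exists M. intros y (a & b & Hab & ->). now apply HM.
- exists (RInt f 1 2), 1, 2. split; [lra | reflexivity].
- exists L. split.
  + intros P [eps HP].
    assert (Hex0 : exists a b, 0 < a < b /\ L - eps < RInt f a b).
    { destruct (Classical_Prop.classic
        (exists a b, 0 < a < b /\ L - eps < RInt f a b)) as [H | H]; [exact H |].
      exfalso. assert (L <= L - eps).
      { apply HL2. intros y (a & b & Hab & ->).
        apply Rnot_lt_le. intros Hlt. apply H. now exists a, b. }
      destruct eps; simpl in *; lra. }
    destruct Hex0 as (a0 & b0 & Hab0 & Hlt).
    exists (fun a => 0 < a < a0) (fun b => b0 < b).
    * apply (filter_imp (F := locally 0) (fun y => y < a0)); [now split |].
      exact (open_lt a0 0 (proj1 Hab0)).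
    * exists b0. auto.
    * intros a b Ha Hb. simpl. exists (RInt f a b). split.
      -- apply (RInt_correct f). apply Hex; lra.
      -- apply HP.
         assert (RInt f a b <= L) by (apply HL1; exists a, b; split; [lra | reflexivity]).
         assert (RInt f a0 b0 <= RInt f a b).
         { rewrite <- (RInt_Chasles f a a0 b) by (apply Hex; lra).
           rewrite <- (RInt_Chasles f a0 b0 b) by (apply Hex; lra).
           assert (0 <= RInt f a a0).
           { apply RInt_ge_0; [lra | apply Hex; lra | intros; apply Hp; lra]. }
           assert (0 <= RInt f b0 b).
           { apply RInt_ge_0; [lra | apply Hex; lra | intros; apply Hp; lra]. }
           unfold plus; simpl. lra. }
         unfold ball; simpl; unfold AbsRing_ball, abs, minus, plus, opp; simpl.
         apply Rabs_def1; destruct eps; simpl in *; lra.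
  + intros a b Hab. apply HL1. exists a, b. auto.
Qed.

Lemma exp_le (x y : R) : x <= y -> exp x <= exp y.
Proof. intros [H | ->]; [left; now apply exp_increasing | apply Rle_refl]. Qed.

Definition gamma_integrand (s t : R) : R := Rpower t (s - 1) * exp (- t).

Lemma is_derive_Rpower_l (c t : R) : 0 < t ->
  is_derive (fun x => Rpower x c) t (c / t * Rpower t c).
Proof.
intros Ht. unfold Rpower. auto_derive; [exact Ht | field; lra].
Qed.

Lemma continuous_gamma_integrand (s t : R) : 0 < t -> continuous (gamma_integrand s) t.
Proof.
intros Ht. apply (ex_derive_continuous (gamma_integrand s)).
unfold gamma_integrand, Rpower. auto_derive. exact Ht.
Qed.

Lemma gamma_integrand_pos (s t : R) : 0 < gamma_integrand s t.
Proof. apply Rmult_lt_0_compat; apply exp_pos. Qed.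

Lemma gamma_integrand_le (s : R) : 1 <= s ->
  exists K, forall t, 0 < t -> gamma_integrand s t <= exp (K - t / 2).
Proof.
intros Hs. destruct (Req_dec s 1) as [-> | Hn].
- exists 0. intros t Ht. unfold gamma_integrand, Rpower.
  rewrite <- exp_plus. apply exp_le.
  replace (1 - 1) with 0 by ring. lra.
- exists ((s - 1) * ln (2 * (s - 1)) - (s - 1)). intros t Ht.
  unfold gamma_integrand, Rpower. rewrite <- exp_plus. apply exp_le.
  assert (Hq : 0 < s - 1) by lra.
  set (q := s - 1) in *. clearbody q.
  assert (Hln : ln t = ln (t / (2 * q)) + ln (2 * q)).
  { rewrite <- ln_mult; [f_equal; field; lra | apply Rdiv_lt_0_compat; lra | lra]. }
  assert (Hle : ln (t / (2 * q)) <= t / (2 * q) - 1).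
  { assert (H := exp_ineq1_le (ln (t / (2 * q)))).
    rewrite exp_ln in H by (apply Rdiv_lt_0_compat; lra). lra. }
  rewrite Hln.
  assert (q * ln (t / (2 * q)) <= q * (t / (2 * q) - 1)) by (apply Rmult_le_compat_l; lra).
  replace (q * (t / (2 * q) - 1)) with (t / 2 - q) in H by (field; lra). lra.
Qed.

Lemma is_RInt_gen_gamma (s : R) : 1 <= s ->
  is_RInt_gen (gamma_integrand s) (at_right 0) (Rbar_locally p_infty) (Gamma s) /\
  0 < Gamma s.
Proof.
intros Hs.
destruct (gamma_integrand_le s Hs) as [K HK].
destruct (is_RInt_gen_nonneg_bounded (gamma_integrand s) (2 * exp K)) as (L & HL & Hle).
- apply continuous_gamma_integrand.
- intros; apply Rlt_le, gamma_integrand_pos.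
- intros a b Hab.
  assert (Hi : is_RInt (fun t => exp (K - t / 2)) a b
                 (minus (- 2 * exp (K - b / 2)) (- 2 * exp (K - a / 2)))).
  { apply (is_RInt_derive (fun t => - 2 * exp (K - t / 2))).
    - intros x _. auto_derive; [easy |]. unfold Rminus, Rdiv. field.
    - intros x _. apply (ex_derive_continuous (fun t => exp (K - t / 2))).
      auto_derive; easy. }
  apply Rle_trans with (RInt (fun t => exp (K - t / 2)) a b).
  + apply RInt_le; [lra | | eexists; apply Hi | intros x Hx; apply HK; lra].
    apply (ex_RInt_continuous (gamma_integrand s)). intros z Hz.
    apply continuous_gamma_integrand.
    rewrite Rmin_left in Hz by lra. lra.
  + rewrite (is_RInt_unique _ _ _ _ Hi). unfold minus, plus, opp; simpl.
    assert (exp (K - a / 2) <= exp K) by (apply exp_le; lra).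
    assert (0 < exp (K - b / 2)) by apply exp_pos. lra.
- assert (HG : Gamma s = L).
  { unfold Gamma. apply (is_RInt_gen_unique (gamma_integrand s) L HL). }
  rewrite HG. split; [exact HL |].
  apply Rlt_le_trans with (RInt (gamma_integrand s) 1 2); [| apply Hle; lra].
  apply RInt_gt_0; [lra | intros; apply gamma_integrand_pos |].
  intros; apply continuous_gamma_integrand; lra.
Qed.

Lemma Gamma_pos (s : R) : 1 <= s -> 0 < Gamma s.
Proof. intros Hs. now apply is_RInt_gen_gamma. Qed.

(** Integration by parts: [s g_s - g_(s+1)] is the derivative of [g_(s+1)], which
    vanishes at both ends. *)
Lemma Gamma_succ (s : R) : 1 <= s -> Gamma (s + 1) = s * Gamma s.
Proof.
intros Hs.
destruct (is_RInt_gen_gamma s Hs) as [H1 _].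
destruct (is_RInt_gen_gamma (s + 1)) as [H2 _]; [lra |].
set (G := gamma_integrand (s + 1)).
assert (HdG : forall t, 0 < t ->
  is_derive G t (s * gamma_integrand s t - gamma_integrand (s + 1) t)).
{ intros t Ht. unfold G, gamma_integrand.
  replace (s + 1 - 1) with s by ring.
  unfold Rpower. auto_derive; [exact Ht |].
  replace ((s - 1) * ln t) with (s * ln t + - ln t) by ring.
  rewrite exp_plus, (exp_Ropp (ln t)), exp_ln by exact Ht. field. lra. }
assert (Hpos : filter_prod (at_right 0) (Rbar_locally p_infty)
  (fun ab => forall x, Rmin (fst ab) (snd ab) <= x <= Rmax (fst ab) (snd ab) -> 0 < x)).
{ exists (fun a => 0 < a) (fun b => 0 < b).
  - exists (mkposreal 1 Rlt_0_1). auto.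
  - exists 0. auto.
  - intros a b Ha Hb x Hx. simpl in Hx. revert Hx. unfold Rmin.
    destruct (Rle_dec a b); lra. }
assert (H3 : is_RInt_gen (Derive G) (at_right 0) (Rbar_locally p_infty) (0 - 0)).
{ apply (is_RInt_gen_Derive G 0 0).
  - refine (filter_imp _ _ _ Hpos). intros ab H x Hx. eexists. apply HdG. now apply H.
  - refine (filter_imp _ _ _ Hpos). intros ab H x Hx. specialize (H x Hx).
    apply (continuous_ext_loc (Derive G)
      (fun t => s * gamma_integrand s t - gamma_integrand (s + 1) t)).
    + apply (filter_imp (fun y => 0 < y)); [| exact (open_gt 0 x H)].
      intros y Hy. symmetry. now apply is_derive_unique, HdG.
    + apply (continuous_minus (fun t => s * gamma_integrand s t)
               (fun t => gamma_integrand (s + 1) t)).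
      * apply (continuous_scal_r s (gamma_integrand s)).
        now apply continuous_gamma_integrand.
      * now apply continuous_gamma_integrand.
  - assert (Hid : filterlim (fun t : R => t) (at_right 0) (locally 0)).
    { intros P [e He]. exists e. intros y Hy _. now apply He. }
    apply (filterlim_le_le (fun _ => 0) G (fun t => t) 0); [| | exact Hid].
    + apply (filter_imp (F := locally 0) (fun y => y < 1)); [| exact (open_lt 1 0 Rlt_0_1)].
      intros y Hy Hy0. split; [apply Rlt_le, gamma_integrand_pos |].
      unfold G, gamma_integrand, Rpower. rewrite <- exp_plus.
      rewrite <- (exp_ln y) at 3 by exact Hy0. apply exp_le.
      assert (ln y < 0) by (rewrite <- ln_1; apply ln_increasing; lra). nra.
    + apply filterlim_const.
  - destruct (gamma_integrand_le (s + 1)) as [K HK]; [lra |].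
    apply (filterlim_le_le (fun _ => 0) G (fun t => exp (K - t / 2)) 0).
    + exists 0. intros t Ht. split; [apply Rlt_le, gamma_integrand_pos | now apply HK].
    + apply filterlim_const.
    + apply (filterlim_comp _ _ _ (fun t => K - t / 2) exp _ (Rbar_locally m_infty)).
      * intros P [M HM]. exists (2 * (K - M)). intros x Hx. apply HM. lra.
      * apply is_lim_exp_m. }
assert (H4 : is_RInt_gen (gamma_integrand (s + 1)) (at_right 0) (Rbar_locally p_infty)
   (minus (scal s (Gamma s)) (0 - 0))).
{ apply (is_RInt_gen_ext
     (fun t => minus (scal s (gamma_integrand s t)) (Derive G t))).
  - refine (filter_imp _ _ _ Hpos). intros ab H x Hx.
    assert (Hd : Derive G x = s * gamma_integrand s x - gamma_integrand (s + 1) x).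
    { apply is_derive_unique, HdG, H. lra. }
    rewrite Hd. unfold minus, plus, opp, scal; simpl. unfold mult; simpl. ring.
  - apply (is_RInt_gen_minus _ _ _ _ (is_RInt_gen_scal _ s _ H1) H3). }
transitivity (minus (scal s (Gamma s)) (0 - 0)).
- apply (is_RInt_gen_unique (gamma_integrand (s + 1)) _ H4).
- unfold minus, plus, opp, scal; simpl. unfold mult; simpl. ring.
Qed.

(** * The Bessel equation *)

Definition bessel_coef (nu : R) (k : nat) : R :=
  (-1) ^ k / (INR (fact k) * Gamma (nu + INR k + 1)).

Definition bessel_entire (nu : R) : R -> R := PSeries (bessel_coef nu).
Definition bessel_entire' (nu : R) : R -> R := PSeries (PS_derive (bessel_coef nu)).

Lemma Gamma_bessel_pos (nu : R) (k : nat) : 0 <= nu -> 0 < Gamma (nu + INR k + 1).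
Proof. intros H. apply Gamma_pos. assert (H1 := pos_INR k). lra. Qed.

Lemma bessel_coef_succ (nu : R) (k : nat) : 0 <= nu ->
  (INR k + 1) * (nu + INR k + 1) * bessel_coef nu (S k) = - bessel_coef nu k.
Proof.
intros H. unfold bessel_coef.
rewrite fact_simpl, mult_INR, S_INR.
replace (nu + (INR k + 1) + 1) with (nu + INR k + 1 + 1) by ring.
assert (H1 := pos_INR k). assert (H2 := Gamma_bessel_pos nu k H).
rewrite Gamma_succ by lra.
assert (H3 := INR_fact_neq_0 k). simpl. field. repeat split; lra.
Qed.

Lemma Rabs_bessel_coef (nu : R) (k : nat) : 0 <= nu ->
  Rabs (bessel_coef nu k) = (-1) ^ k * bessel_coef nu k /\ 0 < Rabs (bessel_coef nu k).
Proof.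
intros H. unfold bessel_coef.
assert (H2 := Gamma_bessel_pos nu k H). assert (H3 := INR_fact_lt_0 k).
assert (H4 : 0 < INR (fact k) * Gamma (nu + INR k + 1)) by now apply Rmult_lt_0_compat.
unfold Rdiv. rewrite Rabs_mult, pow_1_abs, (Rabs_pos_eq (/ _)) by now apply Rlt_le, Rinv_0_lt_compat.
split; [| rewrite Rmult_1_l; now apply Rinv_0_lt_compat].
rewrite <- Rmult_assoc, <- Rpow_mult_distr.
replace (-1 * -1) with 1 by ring. now rewrite pow1.
Qed.

Lemma CV_radius_bessel_coef (nu : R) : 0 <= nu -> CV_radius (bessel_coef nu) = p_infty.
Proof.
intros H. apply CV_radius_infinite_DAlembert.
- intros n Hn. destruct (Rabs_bessel_coef nu n H) as [_ H1].
  rewrite Hn, Rabs_R0 in H1. lra.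
- apply (is_lim_seq_le_le (fun _ => 0) _ (fun n => / (INR n + 1))).
  + intros n. split; [apply Rabs_pos |].
    destruct (Rabs_bessel_coef nu n H) as [_ H1].
    assert (Hs := bessel_coef_succ nu n H). assert (Hn := pos_INR n).
    assert (Hnz : bessel_coef nu n <> 0) by (intros Hz; rewrite Hz, Rabs_R0 in H1; lra).
    replace (bessel_coef nu (S n) / bessel_coef nu n)
      with (- / ((INR n + 1) * (nu + INR n + 1))).
    * assert (0 < (INR n + 1) * (nu + INR n + 1)) by nra.
      rewrite Rabs_Ropp, Rabs_pos_eq by now apply Rlt_le, Rinv_0_lt_compat.
      apply Rinv_le_contravar; nra.
    * apply (Rmult_eq_reg_r (bessel_coef nu n * ((INR n + 1) * (nu + INR n + 1)))).
      -- field_simplify; [| lra | split; lra]. nra.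
      -- apply Rmult_integral_contrapositive_currified; [exact Hnz | nra].
  + apply is_lim_seq_const.
  + apply is_lim_seq_spec. intros [e He]. simpl.
    destruct (archimed_cor1 e He) as (N & HN & HN0). exists N. intros n Hn.
    assert (0 < INR N) by now apply lt_0_INR.
    assert (INR N <= INR n) by now apply le_INR.
    rewrite Rminus_0_r, Rabs_pos_eq by (apply Rlt_le, Rinv_0_lt_compat; lra).
    apply Rle_lt_trans with (2 := HN). apply Rinv_le_contravar; lra.
Qed.

Lemma is_derive_bessel_entire (nu x : R) : 0 <= nu ->
  is_derive (bessel_entire nu) x (bessel_entire' nu x).
Proof.
intros H. apply is_derive_PSeries. now rewrite CV_radius_bessel_coef.
Qed.

(** With [J_nu x = (x / 2)^nu f (x^2 / 4)], this is the form that the Bessel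
    equation takes for [f]. *)
Lemma bessel_entire_ode (nu w : R) : 0 <= nu ->
  exists d, is_derive (bessel_entire' nu) w d /\
    w * d + (nu + 1) * bessel_entire' nu w + bessel_entire nu w = 0.
Proof.
intros H.
assert (Hr : forall a, CV_radius a = p_infty -> ex_series (fun n => a n * w ^ n)).
{ intros a Ha. apply ex_series_Rabs, CV_disk_inside. now rewrite Ha. }
set (a := bessel_coef nu).
assert (Ha : CV_radius a = p_infty) by now apply CV_radius_bessel_coef.
set (a1 := PS_derive a).
assert (Ha1 : CV_radius a1 = p_infty) by (unfold a1; now rewrite CV_radius_derive).
set (a2 := PS_derive a1).
assert (Ha2 : CV_radius a2 = p_infty) by (unfold a2; now rewrite CV_radius_derive).
exists (PSeries a2 w). split.
- apply is_derive_PSeries. fold a. fold a1. now rewrite Ha1.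
- unfold bessel_entire, bessel_entire'. fold a. fold a1.
  rewrite <- (PSeries_incr_1 a2 w), <- (PSeries_scal (nu + 1) a1 w).
  assert (E : forall b, CV_radius b = p_infty -> ex_pseries b w).
  { intros b Hb. apply CV_disk_correct, CV_disk_inside. now rewrite Hb. }
  assert (E2 : ex_pseries (PS_incr_1 a2) w) by now apply ex_pseries_incr_1, E.
  assert (E1 : ex_pseries (PS_scal (nu + 1) a1) w).
  { apply ex_pseries_scal; [apply Rmult_comm | now apply E]. }
  rewrite <- PSeries_plus by assumption.
  rewrite <- PSeries_plus; [| now apply ex_pseries_plus | now apply E].
  rewrite (PSeries_ext _ (fun _ => 0)); [apply PSeries_const_0 |].
  intros n. unfold PS_plus, PS_scal, PS_incr_1, plus, scal; simpl. unfold mult; simpl.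
  unfold a2, a1, PS_derive. rewrite ?S_INR.
  destruct n as [| n].
  + assert (Hs := bessel_coef_succ nu 0 H). fold a in Hs.
    simpl in Hs. unfold zero; simpl. simpl. lra.
  + assert (Hs := bessel_coef_succ nu (S n) H). fold a in Hs.
    rewrite S_INR in Hs.
    rewrite ?S_INR. lra.
Qed.

(** This is [x J_nu' x].  With it the Bessel equation is the first-order system
    [x J' = theta], [x theta' = - (x^2 - nu^2) J]. *)
Definition bessel_theta (nu x : R) : R :=
  Rpower (x / 2) nu *
  (nu * bessel_entire nu (x ^ 2 / 4) + x ^ 2 / 2 * bessel_entire' nu (x ^ 2 / 4)).

Lemma is_derive_bessel_J (nu x : R) : 0 <= nu -> 0 < x ->
  is_derive (bessel_J nu) x (bessel_theta nu x / x).
Proof.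
intros Hnu Hx.
apply (is_derive_ext (fun x => Rpower (x / 2) nu * bessel_entire nu (x ^ 2 / 4)));
  [reflexivity |].
assert (H1 := is_derive_Rpower_l nu (x / 2) ltac:(lra)).
assert (H2 := is_derive_bessel_entire nu (x ^ 2 / 4) Hnu).
assert (E1 : Derive (fun y : R => Rpower y nu) (x * / 2) = nu / (x / 2) * Rpower (x / 2) nu)
  by (apply is_derive_unique, is_derive_Rpower_l; lra).
assert (E2 : Derive (fun y : R => bessel_entire nu y) (x * (x * 1) * / 4) =
  bessel_entire' nu (x ^ 2 / 4)) by exact (is_derive_unique _ _ _ H2).
auto_derive.
- repeat split; eexists; eassumption.
- rewrite E1, E2. unfold bessel_theta.
  change (x * (x * 1) * / 4) with (x ^ 2 / 4). change (x * / 2) with (x / 2).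
  set (f := bessel_entire nu (x ^ 2 / 4)) in *.
  set (f' := bessel_entire' nu (x ^ 2 / 4)) in *.
  set (P := Rpower (x / 2) nu). field. lra.
Qed.

Lemma is_derive_bessel_theta (nu x : R) : 0 <= nu -> 0 < x ->
  is_derive (bessel_theta nu) x (- ((x ^ 2 - nu ^ 2) / x) * bessel_J nu x).
Proof.
intros Hnu Hx. unfold bessel_theta.
assert (H1 := is_derive_Rpower_l nu (x / 2) ltac:(lra)).
assert (H2 := is_derive_bessel_entire nu (x ^ 2 / 4) Hnu).
destruct (bessel_entire_ode nu (x ^ 2 / 4) Hnu) as (d & H3 & Hode).
assert (E1 : Derive (fun y : R => Rpower y nu) (x * / 2) = nu / (x / 2) * Rpower (x / 2) nu)
  by (apply is_derive_unique, is_derive_Rpower_l; lra).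
assert (E2 : Derive (fun y : R => bessel_entire nu y) (x * (x * 1) * / 4) =
  bessel_entire' nu (x ^ 2 / 4)) by exact (is_derive_unique _ _ _ H2).
assert (E3 : Derive (fun y : R => bessel_entire' nu y) (x * (x * 1) * / 4) = d)
  by exact (is_derive_unique _ _ _ H3).
auto_derive.
- repeat split; eexists; eassumption.
- rewrite E1, E2, E3.
  change (bessel_J nu x) with (Rpower (x / 2) nu * bessel_entire nu (x ^ 2 / 4)).
  change (x * (x * 1) * / 4) with (x ^ 2 / 4). change (x * / 2) with (x / 2).
  set (f := bessel_entire nu (x ^ 2 / 4)) in *.
  set (f' := bessel_entire' nu (x ^ 2 / 4)) in *.
  set (P := Rpower (x / 2) nu).
  replace f with (- (x ^ 2 / 4 * d + (nu + 1) * f')) by lra.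
  field. lra.
Qed.

Lemma dbessel_J_theta (nu x : R) : 0 <= nu -> 0 < x ->
  dbessel_J nu x = bessel_theta nu x / x.
Proof. intros H1 H2. now apply is_derive_unique, is_derive_bessel_J. Qed.

(** * Rotation along an arc of the complex plane *)

Lemma is_derive_continuity_pt (f : R -> R) (x l : R) : is_derive f x l -> continuity_pt f x.
Proof.
intros H. apply derivable_continuous_pt. exists l. now apply is_derive_Reals.
Qed.

Lemma mean_value (f df : R -> R) (a b : R) : a <= b ->
  (forall x, a <= x <= b -> is_derive f x (df x)) ->
  exists c, a <= c <= b /\ f b - f a = df c * (b - a).
Proof.
intros Hab Hd. destruct (MVT_gen f a b df) as (c & Hc & E).
- intros x. rewrite Rmin_left, Rmax_right by exact Hab. intros Hx. apply Hd. lra.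
- intros x. rewrite Rmin_left, Rmax_right by exact Hab. intros Hx.
  now apply (is_derive_continuity_pt f x (df x)), Hd.
- rewrite Rmin_left, Rmax_right in Hc by exact Hab. now exists c.
Qed.

Lemma le_of_derive_nonneg (f df : R -> R) (a b : R) : a <= b ->
  (forall x, a <= x <= b -> is_derive f x (df x)) ->
  (forall x, a <= x <= b -> 0 <= df x) -> f a <= f b.
Proof.
intros Hab Hd Hp. destruct (mean_value f df a b Hab Hd) as (c & Hc & E).
specialize (Hp c Hc). nra.
Qed.

Lemma gronwall (f df : R -> R) (c T : R) : 0 <= T ->
  (forall x, 0 <= x <= T -> is_derive f x (df x)) ->
  (forall x, 0 <= x <= T -> df x <= c * f x) -> f T <= f 0 * exp (c * T).
Proof.
intros HT Hd Hle.
assert (H : - (f 0 * exp (- c * 0)) <= - (f T * exp (- c * T))).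
{ apply (le_of_derive_nonneg (fun x => - (f x * exp (- c * x)))
     (fun x => (c * f x - df x) * exp (- c * x))); [exact HT | |].
  - intros x Hx. assert (H := Hd x Hx).
    assert (E : Derive (fun y : R => f y) x = df x) by exact (is_derive_unique _ _ _ H).
    auto_derive; [eexists; apply H |]. rewrite E. ring.
  - intros x Hx. specialize (Hle x Hx). assert (H := exp_pos (- c * x)). nra. }
rewrite Rmult_0_r, exp_0 in H.
replace (f T) with (f T * exp (- c * T) * exp (c * T)).
- apply Rmult_le_compat_r; [apply Rlt_le, exp_pos | lra].
- rewrite Rmult_assoc, <- exp_plus. replace (- c * T + c * T) with 0 by ring.
  rewrite exp_0. ring.
Qed.

Lemma Rabs_le_of_sqr (x y : R) : 0 <= y -> x ^ 2 <= y ^ 2 -> Rabs x <= y.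
Proof. intros Hy H. apply Rabs_le. nra. Qed.

(** With [W = W1 + i W2], [V = V1 + i V2] and [z = r exp (i b)], the four equations
    say that [dW = V dz] and [dV = - (1 - m / z^2) W dz], that is, that [W] is a
    solution of [W'' + (1 - m / z^2) W = 0] and [V] its derivative.  [E] is
    [exp (- 2 Im z) (|W|^2 + |V|^2)], and [B eta] is the real part of
    [(W + i V) exp (i (z - eta))]. *)
Section Arc.
Variables (m r : R) (W1 W2 V1 V2 : R -> R).
Hypothesis (Hr : 1 <= r).
Hypothesis (HW1 : forall b, is_derive W1 b (- (r * sin b * V1 b + r * cos b * V2 b))).
Hypothesis (HW2 : forall b, is_derive W2 b (r * cos b * V1 b - r * sin b * V2 b)).
Hypothesis (HV1 : forall b, is_derive V1 b
  (r * sin b * W1 b + r * cos b * W2 b + m / r * (sin b * W1 b - cos b * W2 b))).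
Hypothesis (HV2 : forall b, is_derive V2 b
  (r * sin b * W2 b - r * cos b * W1 b + m / r * (cos b * W1 b + sin b * W2 b))).

Let E (b : R) := exp (- 2 * (r * sin b)) * (W1 b ^ 2 + W2 b ^ 2 + V1 b ^ 2 + V2 b ^ 2).
Let B (eta b : R) := exp (- (r * sin b)) *
  ((W1 b - V2 b) * cos (r * cos b - eta) - (W2 b + V1 b) * sin (r * cos b - eta)).

Lemma arc_derives (b : R) :
  (forall b, ex_derive (fun x : R => W1 x) b /\ ex_derive (fun x : R => W2 x) b /\
  ex_derive (fun x : R => V1 x) b /\ ex_derive (fun x : R => V2 x) b) /\
  Derive (fun x : R => W1 x) b = - (r * sin b * V1 b + r * cos b * V2 b) /\
  Derive (fun x : R => W2 x) b = r * cos b * V1 b - r * sin b * V2 b /\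
  Derive (fun x : R => V1 x) b =
    r * sin b * W1 b + r * cos b * W2 b + m / r * (sin b * W1 b - cos b * W2 b) /\
  Derive (fun x : R => V2 x) b =
    r * sin b * W2 b - r * cos b * W1 b + m / r * (cos b * W1 b + sin b * W2 b).
Proof.
split.
- intros c. repeat split; eexists; [apply HW1 | apply HW2 | apply HV1 | apply HV2].
- repeat split; apply is_derive_unique; [apply HW1 | apply HW2 | apply HV1 | apply HV2].
Qed.

Lemma arc_energy_derive (b : R) : is_derive E b
  (- 2 * r * cos b * E b + exp (- 2 * (r * sin b)) * 2 *
   (r * cos b * (2 * (V1 b * W2 b - W1 b * V2 b)) +
    m / r * (V1 b * (sin b * W1 b - cos b * W2 b) + V2 b * (cos b * W1 b + sin b * W2 b)))).
Proof.
destruct (arc_derives b) as (Hex & E1 & E2 & E3 & E4).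
unfold E. auto_derive.
- repeat split; apply Hex.
- rewrite E1, E2, E3, E4. simpl. ring.
Qed.

(** The weight [exp (- 2 Im z)] compensates the growth of [exp (- i z)], the fastest
    growing solution for [m = 0]; only the terms with [m] remain. *)
Lemma arc_energy_derive_le (b : R) : 0 <= cos b ->
  - 2 * r * cos b * E b + exp (- 2 * (r * sin b)) * 2 *
   (r * cos b * (2 * (V1 b * W2 b - W1 b * V2 b)) +
    m / r * (V1 b * (sin b * W1 b - cos b * W2 b) + V2 b * (cos b * W1 b + sin b * W2 b)))
  <= Rabs m / r * E b.
Proof.
intros Hc. unfold E. set (e := exp (- 2 * (r * sin b))).
assert (He : 0 < e) by apply exp_pos.
set (w1 := W1 b). set (w2 := W2 b). set (v1 := V1 b). set (v2 := V2 b).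
set (S := w1 ^ 2 + w2 ^ 2 + v1 ^ 2 + v2 ^ 2).
assert (Hsc : sin b ^ 2 + cos b ^ 2 = 1) by (generalize (sin2_cos2 b); unfold Rsqr; lra).
set (X := v1 * (sin b * w1 - cos b * w2) + v2 * (cos b * w1 + sin b * w2)).
assert (HX : Rabs (2 * X) <= S).
{ assert (Hid : (sin b * w1 - cos b * w2) ^ 2 + (cos b * w1 + sin b * w2) ^ 2 = w1 ^ 2 + w2 ^ 2).
  { replace (w1 ^ 2 + w2 ^ 2) with ((sin b ^ 2 + cos b ^ 2) * (w1 ^ 2 + w2 ^ 2)) by (rewrite Hsc; ring). ring. }
  unfold X, S. set (p := sin b * w1 - cos b * w2) in *. set (q := cos b * w1 + sin b * w2) in *.
  apply Rabs_le.
  assert (G1 := pow2_ge_0 (v1 - p)). assert (G2 := pow2_ge_0 (v2 - q)).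
  assert (G3 := pow2_ge_0 (v1 + p)). assert (G4 := pow2_ge_0 (v2 + q)).
  split; lra. }
assert (H1 : r * cos b * (2 * (2 * (v1 * w2 - w1 * v2))) <= 2 * (r * cos b) * S).
{ assert (G0 : 0 <= r * cos b) by (apply Rmult_le_pos; lra).
  assert (G1 : 2 * (v1 * w2 - w1 * v2) <= S).
  { unfold S. assert (G2 := pow2_ge_0 (v1 - w2)). assert (G3 := pow2_ge_0 (w1 + v2)). lra. }
  assert (G4 := Rmult_le_compat_l _ _ _ G0 G1). lra. }
assert (H2 : m / r * (2 * X) <= Rabs m / r * S).
{ apply Rle_trans with (Rabs (m / r * (2 * X))); [apply Rle_abs |].
  rewrite Rabs_mult. unfold Rdiv at 1. rewrite Rabs_mult, (Rabs_pos_eq (/ r)).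
  - apply Rmult_le_compat_l; [| exact HX].
    apply Rmult_le_pos; [apply Rabs_pos | apply Rlt_le, Rinv_0_lt_compat; lra].
  - apply Rlt_le, Rinv_0_lt_compat; lra. }
replace (- 2 * r * cos b * (e * S) + e * 2 * (r * cos b * (2 * (v1 * w2 - w1 * v2)) + m / r * X))
  with (e * (- (2 * (r * cos b) * S) + r * cos b * (2 * (2 * (v1 * w2 - w1 * v2))) + m / r * (2 * X)))
  by ring.
replace (Rabs m / r * (e * S)) with (e * (Rabs m / r * S)) by ring.
apply Rmult_le_compat_l; lra.
Qed.

(** For [m = 0] the amplitude would be constant: [(W + i V) exp (i z)] has the
    derivative [i (m / z^2) W exp (i z)] with respect to [z]. *)
Lemma arc_amplitude_derive (eta b : R) : is_derive (B eta) b
  (- (m / r) * exp (- (r * sin b)) *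
   (cos b * (W1 b * cos (r * cos b - eta) - W2 b * sin (r * cos b - eta)) +
    sin b * (W1 b * sin (r * cos b - eta) + W2 b * cos (r * cos b - eta)))).
Proof.
destruct (arc_derives b) as (Hex & E1 & E2 & E3 & E4).
unfold B. auto_derive.
- repeat split; apply Hex.
- rewrite E1, E2, E3, E4.
  replace (r * cos b + - eta) with (r * cos b - eta) by ring. ring.
Qed.

Lemma arc_amplitude_variation (eta : R) :
  Rabs (B eta (PI / 2) - B eta 0) <=
  2 * Rabs m * exp (Rabs m) / r * sqrt (W1 0 ^ 2 + W2 0 ^ 2 + V1 0 ^ 2 + V2 0 ^ 2).
Proof.
assert (HPI := PI_RGT_0). assert (HPI4 := PI_4).
set (rho := sqrt _).
assert (Hrho : rho ^ 2 = E 0).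
{ unfold rho. rewrite pow2_sqrt by nra. unfold E.
  rewrite sin_0. replace (-2 * (r * 0)) with 0 by ring. rewrite exp_0. ring. }
assert (Hrho0 : 0 <= rho) by apply sqrt_pos.
assert (Hm := Rabs_pos m).
assert (HmR : 0 <= Rabs m / r <= Rabs m).
{ split; [apply Rmult_le_pos; [lra | apply Rlt_le, Rinv_0_lt_compat; lra] |].
  apply (Rmult_le_reg_r r); [lra |]. unfold Rdiv. rewrite Rmult_assoc, Rinv_l by lra. nra. }
assert (HE : forall b, 0 <= b <= PI / 2 -> E b <= rho ^ 2 * exp (2 * Rabs m)).
{ intros b Hb. rewrite Hrho.
  apply Rle_trans with (E 0 * exp (Rabs m / r * b)).
  - eapply (gronwall E).
    + lra.
    + intros x Hx. apply arc_energy_derive.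
    + intros x Hx. apply arc_energy_derive_le, cos_ge_0; lra.
  - apply Rmult_le_compat_l; [rewrite <- Hrho; nra |]. apply exp_le. nra. }
edestruct (mean_value (B eta)) as (c & Hc & Ec);
  [| intros x _; apply arc_amplitude_derive |]; [apply (Rlt_le 0 (PI / 2)); lra |].
cbv beta in Ec.
rewrite Ec, Rabs_mult, (Rabs_pos_eq (PI / 2 - 0)) by lra.
set (D := - (m / r) * exp (- (r * sin c)) * _).
assert (HD : Rabs D <= Rabs m / r * exp (Rabs m) * rho).
{ apply Rabs_le_of_sqr.
  - assert (He := exp_pos (Rabs m)). apply Rmult_le_pos; [apply Rmult_le_pos |]; lra.
  - apply Rle_trans with ((m / r) ^ 2 * E c).
    + unfold D, E. set (p := r * cos c - eta).
      replace (-2 * (r * sin c)) with (- (r * sin c) + - (r * sin c)) by ring.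
      rewrite exp_plus. set (e := exp (- (r * sin c))).
      set (w1 := W1 c). set (w2 := W2 c). set (v1 := V1 c). set (v2 := V2 c).
      set (Z := cos c * (w1 * cos p - w2 * sin p) + sin c * (w1 * sin p + w2 * cos p)).
      assert (HZ : Z ^ 2 <= w1 ^ 2 + w2 ^ 2 + v1 ^ 2 + v2 ^ 2).
      { assert (Hp : sin p ^ 2 + cos p ^ 2 = 1) by (generalize (sin2_cos2 p); unfold Rsqr; lra).
        assert (Hcc : sin c ^ 2 + cos c ^ 2 = 1) by (generalize (sin2_cos2 c); unfold Rsqr; lra).
        set (s := w1 * cos p - w2 * sin p) in *. set (t := w1 * sin p + w2 * cos p) in *.
        assert (Hst : s ^ 2 + t ^ 2 = w1 ^ 2 + w2 ^ 2).
        { replace (w1 ^ 2 + w2 ^ 2) with ((sin p ^ 2 + cos p ^ 2) * (w1 ^ 2 + w2 ^ 2)) by (rewrite Hp; ring).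
          unfold s, t. ring. }
        assert (Hz : Z ^ 2 + (cos c * t - sin c * s) ^ 2 = s ^ 2 + t ^ 2).
        { replace (s ^ 2 + t ^ 2) with ((sin c ^ 2 + cos c ^ 2) * (s ^ 2 + t ^ 2)) by (rewrite Hcc; ring).
          unfold Z. ring. }
        assert (G := pow2_ge_0 (cos c * t - sin c * s)).
        assert (G1 := pow2_ge_0 v1). assert (G2 := pow2_ge_0 v2). lra. }
      replace ((- (m / r) * e * Z) ^ 2) with ((m / r) ^ 2 * (e * e) * Z ^ 2) by ring.
      replace ((m / r) ^ 2 * (e * e * (w1 ^ 2 + w2 ^ 2 + v1 ^ 2 + v2 ^ 2))) with
        ((m / r) ^ 2 * (e * e) * (w1 ^ 2 + w2 ^ 2 + v1 ^ 2 + v2 ^ 2)) by ring.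
      apply Rmult_le_compat_l; [| exact HZ].
      apply Rmult_le_pos; [apply pow2_ge_0 | apply Rle_0_sqr].
    + replace ((Rabs m / r * exp (Rabs m) * rho) ^ 2)
        with ((Rabs m / r) ^ 2 * (rho ^ 2 * exp (2 * Rabs m))).
      * replace ((Rabs m / r) ^ 2) with ((m / r) ^ 2).
        -- apply Rmult_le_compat_l; [apply pow2_ge_0 | now apply HE].
        -- unfold Rdiv. rewrite !Rpow_mult_distr, pow2_abs. reflexivity.
      * replace (2 * Rabs m) with (Rabs m + Rabs m) by ring. rewrite exp_plus. ring. }
apply Rle_trans with (Rabs m / r * exp (Rabs m) * rho * 2).
- apply Rmult_le_compat; [apply Rabs_pos | lra | exact HD | lra].
- right. unfold Rdiv. ring.
Qed.

(** At the imaginary end the amplitude is [exp (- r) (Wp + Vp) exp (i om)], so it has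
    no component along [i exp (i om)] and a nonnegative one along [exp (i om)]. *)
Lemma arc_connection (om Wp Vp : R) :
  W2 0 = 0 -> V2 0 = 0 -> 0 <= Wp -> 0 <= Vp ->
  W1 (PI / 2) = Wp * cos om -> W2 (PI / 2) = Wp * sin om ->
  V1 (PI / 2) = Vp * sin om -> V2 (PI / 2) = - Vp * cos om ->
  let K := 2 * Rabs m * exp (Rabs m) in
  let rho := sqrt (W1 0 ^ 2 + V1 0 ^ 2) in
  Rabs (W1 0 * sin (r - om) + V1 0 * cos (r - om)) <= K / r * rho /\
  - (K / r * rho) <= W1 0 * cos (r - om) - V1 0 * sin (r - om).
Proof.
intros HW0 HV0 HWp HVp EW1 EW2 EV1 EV2 K rho.
assert (Hrho : sqrt (W1 0 ^ 2 + W2 0 ^ 2 + V1 0 ^ 2 + V2 0 ^ 2) = rho).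
{ unfold rho. f_equal. rewrite HW0, HV0. ring. }
assert (HB0 : forall eta, B eta 0 = W1 0 * cos (r - eta) - V1 0 * sin (r - eta)).
{ intros eta. unfold B. rewrite HW0, HV0, sin_0, cos_0.
  replace (- (r * 0)) with 0 by ring. rewrite exp_0, Rmult_1_r. ring. }
assert (HBP : forall eta, B eta (PI / 2) = exp (- r) * (Wp + Vp) * cos (om - eta)).
{ intros eta. unfold B. rewrite sin_PI2, cos_PI2, EW1, EW2, EV1, EV2, Rmult_1_r.
  replace (r * 0 - eta) with (- eta) by ring. rewrite cos_neg, sin_neg, cos_minus. ring. }
split.
- assert (H := arc_amplitude_variation (om + PI / 2)).
  rewrite Hrho, HB0, HBP in H. fold K in H.
  replace (om - (om + PI / 2)) with (- (PI / 2)) in H by ring.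
  rewrite cos_neg, cos_PI2 in H.
  replace (r - (om + PI / 2)) with (- (PI / 2 - (r - om))) in H by ring.
  rewrite cos_neg, sin_neg, cos_shift, sin_shift in H.
  rewrite <- Rabs_Ropp. eapply Rle_trans; [| exact H]. right. f_equal. ring.
- assert (H := arc_amplitude_variation om).
  rewrite Hrho, HB0, HBP in H. fold K in H.
  replace (om - om) with 0 in H by ring. rewrite cos_0 in H.
  apply Rabs_le_between in H.
  assert (0 <= exp (- r) * (Wp + Vp)) by (apply Rmult_le_pos; [apply Rlt_le, exp_pos | lra]).
  lra.
Qed.
End Arc.

(** * Trigonometric series with rapidly decreasing coefficients *)

(** Decrease faster than every geometric sequence: this is stable under
    multiplication by the frequencies and makes termwise differentiation harmless. *)
Definition rapid (A : nat -> R) : Prop :=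
  forall D, 0 <= D -> ex_series (fun k => Rabs (A k) * D ^ k).

Definition exp_bounded (mu : nat -> R) : Prop :=
  exists c, 0 <= c /\ forall k, Rabs (mu k) <= c * 2 ^ k.

Definition trig_series (A mu : nat -> R) (d b : R) : R :=
  Series (fun k => A k * cos (mu k * b + d)).

Lemma ex_series_dom (a b : nat -> R) :
  (forall k, Rabs (a k) <= b k) -> ex_series b -> ex_series a.
Proof. intros H. now apply (ex_series_le a b). Qed.

Lemma rapid_mult (A mu : nat -> R) : rapid A -> exp_bounded mu -> rapid (fun k => mu k * A k).
Proof.
intros HA (c & Hc & Hmu) D HD.
apply ex_series_dom with (fun k => scal c (Rabs (A k) * (2 * D) ^ k)).
- intros k. unfold scal; simpl; unfold mult; simpl.
  rewrite Rabs_mult, Rabs_Rabsolu, Rabs_mult, Rpow_mult_distr.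
  assert (HDk : 0 <= D ^ k) by now apply pow_le.
  rewrite (Rabs_pos_eq (D ^ k)) by exact HDk.
  replace (c * (Rabs (A k) * (2 ^ k * D ^ k))) with (c * 2 ^ k * (Rabs (A k) * D ^ k)) by ring.
  rewrite Rmult_assoc. apply Rmult_le_compat_r; [| apply Hmu].
  apply Rmult_le_pos; [apply Rabs_pos | exact HDk].
- apply (ex_series_scal c (fun k => Rabs (A k) * (2 * D) ^ k)). apply HA. lra.
Qed.

Lemma rapid_ex_series (A t : nat -> R) : rapid A -> (forall k, Rabs (t k) <= 1) ->
  ex_series (fun k => A k * t k).
Proof.
intros HA Ht. apply ex_series_dom with (fun k => Rabs (A k) * 1 ^ k).
- intros k. rewrite Rabs_mult, pow1. apply Rmult_le_compat_l; [apply Rabs_pos | apply Ht].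
- apply HA. lra.
Qed.

Lemma rapid_ex_trig (A mu : nat -> R) (d b : R) : rapid A ->
  ex_series (fun k => A k * cos (mu k * b + d)).
Proof.
intros HA. apply (rapid_ex_series A (fun k => cos (mu k * b + d)) HA).
intros k. apply Rabs_le, COS_bound.
Qed.

Lemma cos_taylor1 (x t : R) : Rabs (cos (x + t) - cos x + t * sin x) <= t ^ 2.
Proof.
destruct (MVT_gen (fun s => cos (x + s) + s * sin x) 0 t (fun s => sin x - sin (x + s)))
  as (c & Hc & E).
- intros s _. auto_derive; [easy | ring].
- intros s _. eapply is_derive_continuity_pt. auto_derive; [easy | reflexivity].
- replace (cos (x + t) - cos x + t * sin x) with ((sin x - sin (x + c)) * (t - 0)).
  2: { rewrite <- E. rewrite Rplus_0_r. ring. }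
  assert (Hct : Rabs c <= Rabs t).
  { unfold Rmin, Rmax, Rabs in *. destruct (Rle_dec 0 t), (Rcase_abs c), (Rcase_abs t); lra. }
  destruct (MVT_gen sin (x + c) x cos) as (e & _ & E').
  + intros s _. auto_derive; [easy | ring].
  + intros s _. apply continuity_sin.
  + rewrite E', !Rabs_mult, Rminus_0_r, <- pow2_abs.
    replace (x - (x + c)) with (- c) by ring. rewrite Rabs_Ropp.
    assert (Rabs (cos e) <= 1) by apply Rabs_le, COS_bound.
    assert (H0 := Rabs_pos c). assert (H1 := Rabs_pos t). assert (H2 := Rabs_pos (cos e)).
    replace (Rabs t ^ 2) with (1 * Rabs t * Rabs t) by ring.
    apply Rmult_le_compat_r; [exact H1 |]. now apply Rmult_le_compat.
Qed.

(** The remainder of the first-order expansion of each term is at most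
    [h^2 mu_k^2 |A_k|]. *)
Lemma is_derive_trig_series (A mu : nat -> R) (d b : R) : rapid A -> exp_bounded mu ->
  is_derive (trig_series A mu d) b (trig_series (fun k => mu k * A k) mu (d + PI / 2) b).
Proof.
intros HA Hmu.
assert (HA1 := rapid_mult A mu HA Hmu).
assert (HA2 := rapid_mult _ mu HA1 Hmu).
set (M := Series (fun k => Rabs (mu k * (mu k * A k)) * 1 ^ k)).
assert (HM : ex_series (fun k => Rabs (mu k * (mu k * A k)) * 1 ^ k)) by (apply HA2; lra).
assert (Hkey : forall h, Rabs (trig_series A mu d (b + h) - trig_series A mu d b -
   h * trig_series (fun k => mu k * A k) mu (d + PI / 2) b) <= h ^ 2 * M).
{ intros h. unfold trig_series.
  rewrite <- Series_scal_l, <- !Series_minus.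
  - unfold M. rewrite <- Series_scal_l.
    assert (Hb : forall k, Rabs (A k * cos (mu k * (b + h) + d) - A k * cos (mu k * b + d) -
       h * (mu k * A k * cos (mu k * b + (d + PI / 2)))) <=
       h ^ 2 * (Rabs (mu k * (mu k * A k)) * 1 ^ k)).
    { intros k.
      replace (mu k * b + (d + PI / 2)) with (PI / 2 - (- (mu k * b + d))) by ring.
      rewrite cos_shift, sin_neg.
      replace (mu k * (b + h) + d) with (mu k * b + d + mu k * h) by ring.
      set (x := mu k * b + d).
      replace (_ - _ - _) with (A k * (cos (x + mu k * h) - cos x + mu k * h * sin x)) by ring.
      rewrite pow1, !Rabs_mult.
      replace (h ^ 2 * (Rabs (mu k) * (Rabs (mu k) * Rabs (A k)) * 1))
        with (Rabs (A k) * (h ^ 2 * Rabs (mu k) ^ 2)) by ring.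
      apply Rmult_le_compat_l; [apply Rabs_pos |]. rewrite pow2_abs.
      eapply Rle_trans; [apply cos_taylor1 |]. right. ring. }
    assert (Hex : ex_series (fun k => h ^ 2 * (Rabs (mu k * (mu k * A k)) * 1 ^ k)))
      by now apply (ex_series_scal (h ^ 2) (fun k => Rabs (mu k * (mu k * A k)) * 1 ^ k)).
    eapply Rle_trans; [apply Series_Rabs |].
    + eapply ex_series_dom; [| exact Hex]. intros k. rewrite Rabs_Rabsolu. apply Hb.
    + apply Series_le; [| exact Hex]. intros k. split; [apply Rabs_pos | apply Hb].
  - apply (ex_series_minus (fun k => A k * cos (mu k * (b + h) + d))); now apply rapid_ex_trig.
  - apply (ex_series_scal h (fun k => mu k * A k * cos (mu k * b + (d + PI / 2)))).
    now apply (rapid_ex_trig (fun k => mu k * A k)).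
  - now apply rapid_ex_trig.
  - now apply rapid_ex_trig. }
assert (HM0 : 0 <= M).
{ specialize (Hkey 1). rewrite pow1, (Rmult_1_l M) in Hkey.
  eapply Rle_trans; [apply Rabs_pos | exact Hkey]. }
apply is_derive_Reals. intros eps Heps.
assert (Hd : 0 < eps / (M + 1)) by (apply Rdiv_lt_0_compat; lra).
exists (mkposreal _ Hd). intros h Hh Hlt. simpl in Hlt.
specialize (Hkey h).
set (l := trig_series (fun k => mu k * A k) mu (d + PI / 2) b) in *.
set (Dl := trig_series A mu d (b + h) - trig_series A mu d b) in *.
replace (Dl / h - l) with ((Dl - h * l) / h) by (field; exact Hh).
unfold Rdiv. rewrite Rabs_mult, Rabs_inv.
assert (Hh0 := Rabs_pos_lt h Hh).
apply (Rmult_lt_reg_r (Rabs h)); [exact Hh0 |].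
rewrite Rmult_assoc, Rinv_l, Rmult_1_r by lra.
apply Rle_lt_trans with (1 := Hkey). rewrite <- pow2_abs.
assert (Rabs h * (M + 1) < eps).
{ apply (Rmult_lt_compat_r (M + 1)) in Hlt; [| lra].
  unfold Rdiv in Hlt. rewrite Rmult_assoc, Rinv_l, Rmult_1_r in Hlt by lra. exact Hlt. }
simpl. nra.
Qed.

(** * The connection between the origin and infinity *)

Lemma exp_bounded_affine (c : R) : exp_bounded (fun k => 2 * INR k + c).
Proof.
exists (2 + Rabs c). split; [assert (H := Rabs_pos c); lra |].
intros k.
assert (Hk : INR k <= 2 ^ k /\ 1 <= 2 ^ k).
{ induction k as [| k IH]; [simpl; lra |]. rewrite S_INR. simpl. lra. }
assert (Hp := pos_INR k). assert (Hc := Rabs_pos c).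
eapply Rle_trans; [apply Rabs_triang |]. rewrite Rabs_pos_eq by lra. nra.
Qed.

Lemma cos_half_turns (k : nat) (x : R) : cos (INR k * PI + x) = (-1) ^ k * cos x.
Proof.
induction k as [| k IH]; [simpl; rewrite Rmult_0_l, Rplus_0_l; ring |].
rewrite S_INR. replace ((INR k + 1) * PI + x) with (INR k * PI + x + PI) by ring.
rewrite neg_cos, IH. simpl. ring.
Qed.

(** The function [w z = sqrt z J_nu z] on the arc [z = r exp (i b)], up to the constant
    factor [2^(- nu) r^(nu + 1/2)]: its power series becomes a series of exponentials
    [A_k exp (i lam_k b)], and that of its derivative has the frequencies
    [lam_k - 1].  [rayW d] and [rayV d] are the real parts of [w exp (i d)] and
    [w' exp (i d)], so that [d = - PI / 2] gives the imaginary parts. *)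
Section Ray.
Variables (nu r : R).
Hypotheses (Hnu : 0 <= nu) (Hr : 1 <= r).

Let A (k : nat) : R := bessel_coef nu k * (r ^ 2 / 4) ^ k.
Let lam (k : nat) : R := 2 * INR k + (nu + / 2).
Let lam' (k : nat) : R := 2 * INR k + (nu - / 2).
Let m : R := nu ^ 2 - / 4.

Lemma rapid_ray : rapid A.
Proof.
intros D HD.
apply (ex_series_ext (fun k => Rabs (bessel_coef nu k * (r ^ 2 / 4 * D) ^ k))).
- intros k. unfold A. rewrite Rpow_mult_distr, !Rabs_mult, (Rabs_pos_eq (D ^ k)).
  + symmetry. apply Rmult_assoc.
  + now apply pow_le.
- apply CV_disk_inside. now rewrite CV_radius_bessel_coef.
Qed.

Definition rayW (d b : R) : R := trig_series A lam d b.
Definition rayV (d b : R) : R := / r * trig_series (fun k => lam k * A k) lam' d b.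

Lemma rapid_ray1 : rapid (fun k => lam k * A k).
Proof. apply rapid_mult; [apply rapid_ray | apply exp_bounded_affine]. Qed.

Lemma is_derive_rayW (d b : R) :
  is_derive (rayW d) b (- (r * sin b * rayV d b + r * cos b * rayV (d - PI / 2) b)).
Proof.
assert (H := is_derive_trig_series A lam d b rapid_ray (exp_bounded_affine _)).
replace (- _) with (trig_series (fun k => lam k * A k) lam (d + PI / 2) b); [exact H |].
unfold rayV, trig_series.
replace (- _) with (- sin b * Series (fun k => lam k * A k * cos (lam' k * b + d)) +
  - cos b * Series (fun k => lam k * A k * cos (lam' k * b + (d - PI / 2)))) by (field; lra).
rewrite <- !Series_scal_l, <- Series_plus.
- apply Series_ext. intros k.
  replace (lam k * b + (d + PI / 2)) with (PI / 2 - (- (lam' k * b + d + b))) by (unfold lam, lam'; field).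
  replace (lam' k * b + (d - PI / 2)) with (- (PI / 2 - (lam' k * b + d))) by ring.
  rewrite cos_shift, cos_neg, cos_shift, sin_neg, sin_plus. ring.
- apply (ex_series_scal (- sin b) (fun k => lam k * A k * cos (lam' k * b + d))).
  apply (rapid_ex_trig (fun k => lam k * A k)), rapid_ray1.
- apply (ex_series_scal (- cos b) (fun k => lam k * A k * cos (lam' k * b + (d - PI / 2)))).
  apply (rapid_ex_trig (fun k => lam k * A k)), rapid_ray1.
Qed.

(** The equation [w'' = - w + (m / z^2) w], coefficient by coefficient. *)
Lemma ray_coef_succ (k : nat) :
  lam' (S k) * (lam (S k) * A (S k)) = m * A (S k) - r ^ 2 * A k.
Proof.
assert (H := bessel_coef_succ nu k Hnu).
unfold A, lam, lam', m. rewrite S_INR.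
change ((r ^ 2 / 4) ^ S k) with (r ^ 2 / 4 * (r ^ 2 / 4) ^ k).
set (q := (r ^ 2 / 4) ^ k). set (a1 := bessel_coef nu (S k)) in *.
replace (r ^ 2 * (bessel_coef nu k * q)) with (r ^ 2 * q * bessel_coef nu k) by ring.
replace (bessel_coef nu k) with (- ((INR k + 1) * (nu + INR k + 1) * a1)) by lra.
field.
Qed.

Lemma is_derive_rayV (d b : R) :
  is_derive (rayV d) b (r * sin b * rayW d b + r * cos b * rayW (d - PI / 2) b +
    m / r * (sin b * rayW d b - cos b * rayW (d - PI / 2) b)).
Proof.
assert (HA := rapid_ray).
assert (H1 := is_derive_trig_series _ lam' d b rapid_ray1 (exp_bounded_affine _)).
set (T := trig_series (fun k => lam' k * (lam k * A k)) lam' (d + PI / 2) b) in *.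
assert (H2 : is_derive (rayV d) b (/ r * T)).
{ apply (is_derive_scal (trig_series (fun k => lam k * A k) lam' d) b (/ r) T H1). }
replace (_ + m / r * _) with (/ r * T); [exact H2 |].
(* Both sides are series of sines of [lam' k * b + d]; the factor [z] of the last
   equation shifts the index by one. *)
assert (HT : T = - Series (fun k => lam' k * (lam k * A k) * sin (lam' k * b + d))).
{ unfold T, trig_series. rewrite <- Series_opp. apply Series_ext. intros k.
  replace (lam' k * b + (d + PI / 2)) with (PI / 2 - (- (lam' k * b + d))) by ring.
  rewrite cos_shift, sin_neg. ring. }
assert (Hs : forall B, rapid B -> ex_series (fun k => B k * sin (lam' k * b + d))).
{ intros B HB. apply (rapid_ex_series B (fun k => sin (lam' k * b + d)) HB).
  intros k. apply Rabs_le, SIN_bound. }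
assert (Hs' : ex_series (fun k => A k * sin (lam k * b + b + d))).
{ apply (rapid_ex_series A (fun k => sin (lam k * b + b + d)) HA).
  intros k. apply Rabs_le, SIN_bound. }
assert (HW1 : sin b * rayW d b - cos b * rayW (d - PI / 2) b =
  - Series (fun k => A k * sin (lam' k * b + d))).
{ unfold rayW, trig_series. rewrite <- !Series_scal_l, <- Series_minus, <- Series_opp.
  - apply Series_ext. intros k.
    replace (lam k * b + (d - PI / 2)) with (- (PI / 2 - (lam k * b + d))) by ring.
    replace (lam' k * b + d) with (lam k * b + d - b) by (unfold lam, lam'; field).
    rewrite cos_neg, cos_shift, sin_minus. ring.
  - apply (ex_series_scal (sin b) (fun k => A k * cos (lam k * b + d))).
    now apply rapid_ex_trig.
  - apply (ex_series_scal (cos b) (fun k => A k * cos (lam k * b + (d - PI / 2)))).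
    now apply rapid_ex_trig. }
assert (HW2 : sin b * rayW d b + cos b * rayW (d - PI / 2) b =
  Series (fun k => A k * sin (lam k * b + b + d))).
{ unfold rayW, trig_series. rewrite <- !Series_scal_l, <- Series_plus.
  - apply Series_ext. intros k.
    replace (lam k * b + (d - PI / 2)) with (- (PI / 2 - (lam k * b + d))) by ring.
    replace (lam k * b + b + d) with (lam k * b + d + b) by ring.
    rewrite cos_neg, cos_shift, (sin_plus (lam k * b + d) b). ring.
  - apply (ex_series_scal (sin b) (fun k => A k * cos (lam k * b + d))).
    now apply rapid_ex_trig.
  - apply (ex_series_scal (cos b) (fun k => A k * cos (lam k * b + (d - PI / 2)))).
    now apply rapid_ex_trig. }
assert (Hsum : Series (fun k => lam' k * (lam k * A k) * sin (lam' k * b + d)) -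
  m * Series (fun k => A k * sin (lam' k * b + d)) =
  - r ^ 2 * Series (fun k => A k * sin (lam k * b + b + d))).
{ assert (Hr2 : rapid (fun k => lam' k * (lam k * A k))).
  { apply (rapid_mult (fun k => lam k * A k)); [apply rapid_ray1 | apply exp_bounded_affine]. }
  assert (Hm : ex_series (fun k => m * (A k * sin (lam' k * b + d)))).
  { apply (ex_series_scal m (fun k => A k * sin (lam' k * b + d))). now apply Hs. }
  rewrite <- !Series_scal_l, <- Series_minus; [| now apply (Hs _ Hr2) | exact Hm].
  rewrite Series_incr_1.
  - replace (lam' 0%nat * (lam 0%nat * A 0%nat) * sin (lam' 0%nat * b + d) -
      m * (A 0%nat * sin (lam' 0%nat * b + d))) with 0 by (unfold lam, lam', m; simpl; field).
    rewrite Rplus_0_l. apply Series_ext. intros k. rewrite ray_coef_succ.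
    replace (lam' (S k) * b + d) with (lam k * b + b + d)
      by (unfold lam, lam'; rewrite S_INR; field). ring.
  - apply (ex_series_minus (fun k => lam' k * (lam k * A k) * sin (lam' k * b + d)));
      [now apply (Hs _ Hr2) | exact Hm]. }
replace (r * sin b * rayW d b + r * cos b * rayW (d - PI / 2) b)
  with (r * (sin b * rayW d b + cos b * rayW (d - PI / 2) b)) by ring.
rewrite HW1, HW2, HT.
replace (Series (fun k => lam' k * (lam k * A k) * sin (lam' k * b + d))) with
 (m * Series (fun k => A k * sin (lam' k * b + d)) +
  - r ^ 2 * Series (fun k => A k * sin (lam k * b + b + d))) by lra.
field. lra.
Qed.

Lemma rayW_0 (d : R) : rayW d 0 = cos d * bessel_entire nu (r ^ 2 / 4).
Proof.
unfold rayW, trig_series, bessel_entire, PSeries. rewrite <- Series_scal_l.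
apply Series_ext. intros k. unfold A. rewrite Rmult_0_r, Rplus_0_l. ring.
Qed.

Lemma rayV_0 (d : R) : rayV d 0 = cos d * (/ r * ((nu + / 2) * bessel_entire nu (r ^ 2 / 4) +
  r ^ 2 / 2 * bessel_entire' nu (r ^ 2 / 4))).
Proof.
assert (HA := rapid_ray).
unfold rayV, trig_series, bessel_entire, bessel_entire', PSeries.
rewrite <- !Rmult_assoc, (Rmult_comm (cos d)), !Rmult_assoc. f_equal.
assert (H0 : ex_series A).
{ apply (ex_series_ext (fun k => A k * 1)); [intros; apply Rmult_1_r |].
  apply (rapid_ex_series A (fun _ => 1) HA). intros. rewrite Rabs_R1. lra. }
assert (H1 : ex_series (fun k => 2 * INR k * A k)).
{ apply (ex_series_ext (fun k => (2 * INR k + 0) * A k * 1)).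
  - intros k. simpl. now rewrite Rplus_0_r, Rmult_1_r.
  - apply (rapid_ex_series _ (fun _ => 1) (rapid_mult A _ HA (exp_bounded_affine 0))).
    intros. rewrite Rabs_R1. lra. }
replace (r ^ 2 / 2 * Series (fun k => PS_derive (bessel_coef nu) k * (r ^ 2 / 4) ^ k))
  with (Series (fun k => 2 * INR k * A k)).
- rewrite <- (Series_scal_l (nu + / 2)), <- Series_plus, <- Series_scal_l.
  + apply Series_ext. intros k. unfold lam, A. rewrite Rmult_0_r, Rplus_0_l. ring.
  + now apply (ex_series_scal (nu + / 2) A).
  + exact H1.
- rewrite Series_incr_1 by exact H1. rewrite <- Series_scal_l. simpl INR at 1.
  rewrite Rmult_0_r, Rmult_0_l, Rplus_0_l. apply Series_ext. intros k.
  unfold A, PS_derive. simpl pow. field.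
Qed.

Let om : R := (nu + / 2) * (PI / 2).

(** The coefficients alternate in sign, and so do the exponentials at [b = PI / 2]. *)
Lemma rayW_PI2 : exists Wp, 0 <= Wp /\ forall d, rayW d (PI / 2) = Wp * cos (om + d).
Proof.
exists (Series (fun k => Rabs (A k) * 1 ^ k)). split.
- apply Rle_trans with (Series (fun k : nat => 0 * 0)).
  + rewrite Series_scal_l. lra.
  + apply Series_le; [| apply rapid_ray; lra]. intros k. rewrite pow1.
    assert (H := Rabs_pos (A k)). lra.
- intros d. unfold rayW, trig_series. rewrite <- Series_scal_r.
  apply Series_ext. intros k.
  replace (lam k * (PI / 2) + d) with (INR k * PI + (om + d)) by (unfold lam, om; field).
  rewrite cos_half_turns, pow1. unfold A. rewrite Rabs_mult, (Rabs_pos_eq ((r ^ 2 / 4) ^ k)).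
  + rewrite (proj1 (Rabs_bessel_coef nu k Hnu)). ring.
  + apply pow_le. nra.
Qed.

Lemma rayV_PI2 : exists Vp, 0 <= Vp /\ forall d, rayV d (PI / 2) = Vp * cos (om + d - PI / 2).
Proof.
assert (H1 := rapid_ray1 1 Rle_0_1).
exists (/ r * Series (fun k => Rabs (lam k * A k) * 1 ^ k)). split.
- apply Rmult_le_pos; [apply Rlt_le, Rinv_0_lt_compat; lra |].
  apply Rle_trans with (Series (fun k : nat => 0 * 0)).
  + rewrite Series_scal_l. lra.
  + apply Series_le; [| exact H1]. intros k. rewrite pow1.
    assert (H := Rabs_pos (lam k * A k)). lra.
- intros d. unfold rayV, trig_series. rewrite Rmult_assoc. f_equal. rewrite <- Series_scal_r.
  apply Series_ext. intros k.
  replace (lam' k * (PI / 2) + d) with (INR k * PI + (om + d - PI / 2)) by (unfold lam', om; field).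
  rewrite cos_half_turns, pow1. unfold A.
  assert (Hl : 0 <= lam k) by (unfold lam; assert (H := pos_INR k); lra).
  rewrite !Rabs_mult, (Rabs_pos_eq ((r ^ 2 / 4) ^ k)), (Rabs_pos_eq (lam k)) by
    (exact Hl || (apply pow_le; nra)).
  rewrite (proj1 (Rabs_bessel_coef nu k Hnu)). ring.
Qed.

(** This is [arc_connection] for [w z = sqrt z J_nu z]: the [w] and [v] below are
    proportional to this function and its derivative at [z = r]. *)
Lemma ray_connection :
  let K := 2 * Rabs m * exp (Rabs m) in
  let w := bessel_entire nu (r ^ 2 / 4) in
  let v := / r * ((nu + / 2) * bessel_entire nu (r ^ 2 / 4) +
     r ^ 2 / 2 * bessel_entire' nu (r ^ 2 / 4)) in
  let rho := sqrt (w ^ 2 + v ^ 2) in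
  Rabs (w * sin (r - om) + v * cos (r - om)) <= K / r * rho /\
  - (K / r * rho) <= w * cos (r - om) - v * sin (r - om).
Proof.
intros K w v rho.
assert (Ew : rayW 0 0 = w) by (rewrite rayW_0, cos_0; apply Rmult_1_l).
assert (Ev : rayV 0 0 = v) by (rewrite rayV_0, cos_0; apply Rmult_1_l).
assert (Ec : cos (- (PI / 2)) = 0) by (rewrite cos_neg; apply cos_PI2).
destruct rayW_PI2 as (Wp & HWp & EW). destruct rayV_PI2 as (Vp & HVp & EV).
unfold rho. rewrite <- Ew, <- Ev.
assert (H : - PI / 2 = 0 - PI / 2) by field.
assert (Hpi : forall x, cos (x - PI) = - cos x).
{ intros x. replace (cos x) with (cos (x - PI + PI)) by (f_equal; ring).
  rewrite neg_cos. ring. }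
assert (EWpi : forall b, rayW (0 - PI / 2 - PI / 2) b = - rayW 0 b).
{ intros b. unfold rayW, trig_series. rewrite <- Series_opp. apply Series_ext. intros k.
  replace (lam k * b + (0 - PI / 2 - PI / 2)) with (lam k * b + 0 - PI) by field.
  rewrite Hpi. ring. }
assert (EVpi : forall b, rayV (0 - PI / 2 - PI / 2) b = - rayV 0 b).
{ intros b. unfold rayV, trig_series. rewrite Ropp_mult_distr_r, <- Series_opp. f_equal.
  apply Series_ext. intros k.
  replace (lam' k * b + (0 - PI / 2 - PI / 2)) with (lam' k * b + 0 - PI) by field.
  rewrite Hpi. ring. }
apply (arc_connection m r (rayW 0) (rayW (0 - PI / 2)) (rayV 0) (rayV (0 - PI / 2)) Hr)
  with (Wp := Wp) (Vp := Vp); trivial.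
- intros b. apply is_derive_rayW.
- intros b. assert (Hd := is_derive_rayW (0 - PI / 2) b). rewrite EVpi in Hd.
  replace (r * cos b * rayV 0 b - _) with
   (- (r * sin b * rayV (0 - PI / 2) b + r * cos b * - rayV 0 b)) by ring. exact Hd.
- intros b. apply is_derive_rayV.
- intros b. assert (Hd := is_derive_rayV (0 - PI / 2) b). rewrite EWpi in Hd.
  replace (r * sin b * rayW (0 - PI / 2) b - _ + _) with
   (r * sin b * rayW (0 - PI / 2) b + r * cos b * - rayW 0 b +
    m / r * (sin b * rayW (0 - PI / 2) b - cos b * - rayW 0 b)) by ring. exact Hd.
- rewrite rayW_0. replace (0 - PI / 2) with (- (PI / 2)) by ring. rewrite Ec. ring.
- rewrite rayV_0. replace (0 - PI / 2) with (- (PI / 2)) by ring. rewrite Ec. ring.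
- rewrite EW. now rewrite Rplus_0_r.
- rewrite EW. replace (om + (0 - PI / 2)) with (- (PI / 2 - om)) by ring.
  now rewrite cos_neg, cos_shift.
- rewrite EV. replace (om + 0 - PI / 2) with (- (PI / 2 - om)) by ring.
  now rewrite cos_neg, cos_shift.
- rewrite EV. replace (om + (0 - PI / 2) - PI / 2) with (om - PI) by field.
  rewrite Hpi. ring.
Qed.
End Ray.

(** * Polar angles of plane curves *)

Lemma sign_constant (f : R -> R) (I : R -> Prop) (x y : R) :
  (forall s t z, I s -> I t -> s <= z <= t -> I z) ->
  (forall z, I z -> continuity_pt f z) -> (forall z, I z -> f z <> 0) ->
  I x -> I y -> f x < 0 -> f y < 0.
Proof.
intros HI Hc Hz Hx Hy Hfx.
destruct (Rlt_le_dec (f y) 0) as [H | [H | H]]; [exact H | exfalso | exfalso; now apply (Hz y)].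
destruct (Rtotal_order x y) as [Hl | [-> | Hl]]; [| lra |].
- destruct (Ranalysis5.IVT_interv f x y) as (z & Hzz & E); auto.
  + intros a Ha. apply Hc. now apply (HI x y).
  + apply (Hz z); [now apply (HI x y) | exact E].
- destruct (Ranalysis5.IVT_interv (- f)%F y x) as (z & Hzz & E); auto.
  + intros a Ha. apply continuity_pt_opp, Hc. now apply (HI y x).
  + unfold opp_fct. lra.
  + unfold opp_fct. lra.
  + unfold opp_fct in E. apply (Hz z); [now apply (HI y x) | lra].
Qed.

Lemma half_line_convex (a : R) : forall s t z, a < s -> a < t -> s <= z <= t -> a < z.
Proof. intros. lra. Qed.

Lemma constant_of_derive_0 (f : R -> R) (a x y : R) :
  (forall z, a < z -> is_derive f z 0) -> a < x -> a < y -> f x = f y.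
Proof.
intros Hd.
assert (H : forall s t, a < s -> s <= t -> f s = f t).
{ intros s t Hs Hst. destruct (mean_value f (fun _ => 0) s t Hst) as (c & _ & E).
  - intros z Hz. apply Hd. lra.
  - lra. }
intros Hx Hy. destruct (Rle_dec x y); [now apply H | symmetry; apply H; lra].
Qed.

Lemma polar_unit (a b : R) : a ^ 2 + b ^ 2 = 1 ->
  exists t, Rabs t <= PI /\ a = cos t /\ b = sin t.
Proof.
intros H. assert (Ha : -1 <= a <= 1) by nra.
assert (Hac := acos_bound a).
destruct (Rle_dec 0 b) as [Hb | Hb].
- exists (acos a). split; [rewrite Rabs_pos_eq; lra |].
  rewrite cos_acos, sin_acos by exact Ha. split; [reflexivity |].
  replace (1 - a²) with (b²) by (unfold Rsqr; lra). now rewrite sqrt_Rsqr.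
- exists (- acos a). split; [rewrite Rabs_Ropp, Rabs_pos_eq; lra |].
  rewrite cos_neg, sin_neg, cos_acos, sin_acos by exact Ha. split; [reflexivity |].
  replace (1 - a²) with ((- b)²) by (unfold Rsqr; lra). rewrite sqrt_Rsqr; lra.
Qed.

Definition is_angle (p q t : R) : Prop :=
  p = sqrt (p ^ 2 + q ^ 2) * cos t /\ q = sqrt (p ^ 2 + q ^ 2) * sin t.

Lemma ex_angle_near (p q t0 : R) : 0 < p ^ 2 + q ^ 2 ->
  exists t, is_angle p q t /\ Rabs (t - t0) <= PI.
Proof.
intros H. set (rho := sqrt (p ^ 2 + q ^ 2)).
assert (Hrho : 0 < rho) by now apply sqrt_lt_R0.
assert (Hrho2 : rho ^ 2 = p ^ 2 + q ^ 2) by (apply pow2_sqrt; lra).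
assert (Hsc : sin t0 ^ 2 + cos t0 ^ 2 = 1) by (generalize (sin2_cos2 t0); unfold Rsqr; lra).
destruct (polar_unit ((p * cos t0 + q * sin t0) / rho) ((q * cos t0 - p * sin t0) / rho))
  as (d & Hd & Ec & Es).
- replace (_ + _) with ((sin t0 ^ 2 + cos t0 ^ 2) * (p ^ 2 + q ^ 2) / rho ^ 2) by (field; lra).
  rewrite Hsc, Hrho2. field. lra.
- exists (t0 + d). split; [| now replace (t0 + d - t0) with d by ring].
  unfold is_angle. fold rho. rewrite cos_plus, sin_plus, <- Ec, <- Es. split.
  + replace (rho * _) with (p * (sin t0 ^ 2 + cos t0 ^ 2)) by (field; lra). rewrite Hsc. ring.
  + replace (rho * _) with (q * (sin t0 ^ 2 + cos t0 ^ 2)) by (field; lra). rewrite Hsc. ring.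
Qed.

(** The angle is the integral [th] of the angular velocity: the cosine [Z] of the
    difference between [th] and the direction of the curve has zero derivative. *)
Lemma polar_lift (p q p' q' w : R -> R) (a x0 t0 : R) : a < x0 ->
  (forall x, a < x -> is_derive p x (p' x)) ->
  (forall x, a < x -> is_derive q x (q' x)) ->
  (forall x, a < x -> 0 < p x ^ 2 + q x ^ 2) ->
  (forall x, a < x -> p x * q' x - q x * p' x = w x * (p x ^ 2 + q x ^ 2)) ->
  (forall x, a < x -> continuous w x) ->
  exists th, (forall x, a < x -> is_derive th x (w x)) /\
    (forall x, a < x -> is_angle (p x) (q x) (th x)) /\ Rabs (th x0 - t0) <= PI.
Proof.
intros Hx0 Hp Hq Hpos Hw Hc.
destruct (ex_angle_near (p x0) (q x0) t0 (Hpos x0 Hx0)) as (t & [Ht1 Ht2] & Htt).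
set (th := fun x => t + RInt w x0 x).
assert (Hth : forall x, a < x -> is_derive th x (w x)).
{ intros x Hx. unfold th.
  replace (w x) with (0 + w x) by ring. apply (is_derive_plus (fun _ => t) (RInt w x0)).
  - apply @is_derive_const.
  - apply (is_derive_RInt w (RInt w x0) x0 x); [| now apply Hc].
    apply (filter_imp (fun y => a < y)); [| exact (open_gt a x Hx)]. intros y Hy.
    apply (RInt_correct w), (ex_RInt_continuous w). intros z Hz. apply Hc.
    revert Hz. unfold Rmin. destruct (Rle_dec x0 y); lra. }
set (rho := fun x => sqrt (p x ^ 2 + q x ^ 2)).
assert (Hrho : forall x, a < x -> 0 < rho x /\ rho x ^ 2 = p x ^ 2 + q x ^ 2).
{ intros x Hx. specialize (Hpos x Hx). split; [now apply sqrt_lt_R0 |].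
  unfold rho. apply pow2_sqrt. lra. }
set (Z := fun x => (p x * cos (th x) + q x * sin (th x)) / rho x).
assert (HZ : forall x, a < x -> is_derive Z x 0).
{ intros x Hx. destruct (Hrho x Hx) as [Hr Hr2]. specialize (Hw x Hx).
  assert (E1 : Derive (fun y : R => p y) x = p' x) by exact (is_derive_unique _ _ _ (Hp x Hx)).
  assert (E2 : Derive (fun y : R => q y) x = q' x) by exact (is_derive_unique _ _ _ (Hq x Hx)).
  assert (E3 : Derive (fun y : R => th y) x = w x) by exact (is_derive_unique _ _ _ (Hth x Hx)).
  assert (G1 : ex_derive (fun y : R => p y) x) by (eexists; apply Hp, Hx).
  assert (G2 : ex_derive (fun y : R => q y) x) by (eexists; apply Hq, Hx).
  assert (G3 : ex_derive (fun y : R => th y) x) by (eexists; apply Hth, Hx).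
  unfold Z, rho. auto_derive.
  - specialize (Hpos x Hx). simpl in Hpos. fold (rho x) in *.
    repeat split; try assumption.
    simpl in Hr. unfold rho in Hr. simpl in Hr. lra.
  - rewrite E1, E2, E3.
    change (p x * (p x * 1) + q x * (q x * 1)) with (p x ^ 2 + q x ^ 2). fold (rho x).
    set (r := rho x) in *. set (c := cos (th x)). set (s := sin (th x)).
    apply (Rmult_eq_reg_r (r ^ 3)); [| apply pow_nonzero; lra].
    rewrite Rmult_0_l.
    transitivity ((p' x * c + q' x * s + w x * (q x * c - p x * s)) * r ^ 2
      - (p x * c + q x * s) * (p x * p' x + q x * q' x)); [field; lra |].
    rewrite Hr2. replace (w x * (q x * c - p x * s) ) with ((q x * c - p x * s) * w x) by ring.
    rewrite Rmult_plus_distr_r, Rmult_assoc, <- Hw. ring. }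
assert (HZ1 : forall x, a < x -> Z x = 1).
{ intros x Hx. rewrite (constant_of_derive_0 Z a x x0 HZ Hx Hx0).
  destruct (Hrho x0 Hx0) as [Hr Hr2].
  assert (Eth : th x0 = t) by (unfold th; rewrite RInt_point; unfold zero; simpl; ring).
  unfold Z. rewrite Eth. fold (rho x0) in Ht1, Ht2.
  rewrite Ht1, Ht2 at 1.
  generalize (sin2_cos2 t). unfold Rsqr. intros Hs.
  replace (rho x0 * cos t * cos t + rho x0 * sin t * sin t)
    with (rho x0 * (sin t * sin t + cos t * cos t)) by ring.
  rewrite Hs. field. lra. }
exists th. split; [exact Hth |]. split.
- intros x Hx. destruct (Hrho x Hx) as [Hr Hr2]. specialize (HZ1 x Hx). unfold Z in HZ1.
  unfold is_angle. fold (rho x).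
  set (r := rho x) in *. set (c := cos (th x)) in *. set (s := sin (th x)) in *.
  assert (Hsc : s ^ 2 + c ^ 2 = 1)
    by (generalize (sin2_cos2 (th x)); unfold s, c, Rsqr; lra).
  assert (E : p x * c + q x * s = r).
  { apply (Rmult_eq_reg_r (/ r)); [| apply Rinv_neq_0_compat; lra].
    rewrite Rinv_r by lra. exact HZ1. }
  assert (F : (p x - r * c) ^ 2 + (q x - r * s) ^ 2 = 0).
  { replace (_ + _) with ((p x ^ 2 + q x ^ 2) - 2 * r * (p x * c + q x * s) +
      r ^ 2 * (s ^ 2 + c ^ 2)) by ring. rewrite E, Hsc, <- Hr2. ring. }
  assert (F1 := pow2_ge_0 (p x - r * c)). assert (F2 := pow2_ge_0 (q x - r * s)).
  split.
  + assert (p x - r * c = 0); [| lra]. apply Rsqr_0_uniq. unfold Rsqr. lra.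
  + assert (q x - r * s = 0); [| lra]. apply Rsqr_0_uniq. unfold Rsqr. lra.
- unfold th. rewrite RInt_point. unfold zero; simpl. now rewrite Rplus_0_r.
Qed.

Lemma cos_2Z_period (x : R) (k : Z) : cos (x + 2 * PI * IZR k) = cos x.
Proof.
destruct (Z_le_gt_dec 0 k) as [H | H].
- rewrite <- (Z2Nat.id k H), <- INR_IZR_INZ.
  replace (x + 2 * PI * INR (Z.to_nat k)) with (x + 2 * INR (Z.to_nat k) * PI) by ring.
  apply cos_period.
- replace k with (- Z.of_nat (Z.to_nat (- k)))%Z by lia.
  rewrite opp_IZR, <- INR_IZR_INZ.
  set (y := x + _). rewrite <- (cos_period y (Z.to_nat (- k))). f_equal. unfold y. ring.
Qed.

Lemma sin_2Z_period (x : R) (k : Z) : sin (x + 2 * PI * IZR k) = sin x.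
Proof.
rewrite <- !cos_shift.
replace (PI / 2 - (x + 2 * PI * IZR k)) with (PI / 2 - x + 2 * PI * IZR (- k)).
- apply cos_2Z_period.
- rewrite opp_IZR. ring.
Qed.

(** The zeros of the cosine are numbered so that [floor (t / PI + 1 / 2)] is the
    largest [k] that [t] has passed. *)
Definition passed (k : Z) (t : R) : Prop := PI * (IZR k - / 2) <= t.

Lemma passed_same_sign (k : Z) (s t : R) : Rabs (s - t) < PI ->
  (cos s = 0 <-> cos t = 0) -> 0 <= cos s * cos t -> passed k s -> passed k t.
Proof.
unfold passed. intros Hst Hz Hp Hs. apply Rabs_def2 in Hst.
destruct (Rle_lt_dec (PI * (IZR k - / 2)) t) as [H | H]; [exact H | exfalso].
assert (HPI := PI_RGT_0).
set (s1 := s - PI * IZR k). set (t1 := t - PI * IZR k).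
assert (Hs1 : 0 <= cos s1) by (apply cos_ge_0; unfold s1; lra).
assert (Ht1 : cos t1 < 0).
{ rewrite <- (cos_neg t1). apply cos_lt_0; unfold t1; lra. }
assert (E : cos s * cos t = cos s1 * cos t1).
{ assert (G : forall u v, cos u * cos v = (cos (u - v) + cos (u + v)) / 2).
  { intros u v. rewrite cos_plus, cos_minus. field. }
  rewrite !G. f_equal. f_equal.
  - f_equal. unfold s1, t1. ring.
  - rewrite <- (cos_2Z_period (s1 + t1) k). f_equal. unfold s1, t1. ring. }
assert (Et : cos t * cos t = cos t1 * cos t1).
{ assert (G : forall u, cos u * cos u = (1 + cos (2 * u)) / 2).
  { intros u. rewrite cos_2a_cos. field. }
  rewrite !G. f_equal. f_equal. rewrite <- (cos_2Z_period (2 * t1) k). f_equal. unfold t1. ring. }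
assert (Ht : cos t <> 0).
{ intros Hc. rewrite Hc in Et. nra. }
assert (Hcs : cos s <> 0) by tauto.
assert (Hne : cos s * cos t <> 0) by now apply Rmult_integral_contrapositive_currified.
nra.
Qed.

(** A vector is never mapped to a negative multiple of itself by a triangular matrix
    with positive diagonal, so by continuity the difference of the two angles cannot
    reach [PI].  As their cosines have the same sign, they have passed the same zeros. *)
Lemma sheared_angles (p q al c ga s t : R -> R) (a x0 : R) : a < x0 ->
  (forall x, a < x -> 0 < p x ^ 2 + q x ^ 2) ->
  (forall x, a < x -> 0 < al x) -> (forall x, a < x -> 0 < c x) ->
  (forall x, a < x -> is_angle (p x) (q x) (s x)) ->
  (forall x, a < x -> is_angle (al x * p x) (c x * q x + ga x * p x) (t x)) ->
  (forall x, a < x -> continuity_pt s x) -> (forall x, a < x -> continuity_pt t x) ->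
  Rabs (t x0 - s x0) <= PI ->
  forall x, a < x -> Rabs (t x - s x) < PI /\ forall k, passed k (t x) <-> passed k (s x).
Proof.
intros Hx0 Hpos Hal Hc Hs Ht Hcs Hct H0.
assert (HPI := PI_RGT_0).
assert (Hne : forall x, a < x -> (t x - s x) ^ 2 - PI ^ 2 <> 0).
{ intros x Hx E.
  assert (E' : cos (t x) = - cos (s x) /\ sin (t x) = - sin (s x)).
  { assert (Hd : t x = s x + PI \/ t x = s x - PI).
    { assert (F : (t x - s x - PI) * (t x - s x + PI) = 0) by (rewrite <- E; ring).
      apply Rmult_integral in F. destruct F; [left | right]; lra. }
    destruct Hd as [-> | ->].
    - rewrite neg_cos, neg_sin. auto.
    - set (u := s x - PI). replace (s x) with (u + PI) by (unfold u; ring).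
      rewrite neg_cos, neg_sin. split; ring. }
  destruct E' as [Ec Es]. destruct (Hs x Hx) as [S1 S2]. destruct (Ht x Hx) as [T1 T2].
  rewrite Ec in T1. rewrite Es in T2. specialize (Hal x Hx). specialize (Hc x Hx).
  specialize (Hpos x Hx).
  set (r := sqrt (p x ^ 2 + q x ^ 2)) in *.
  set (r' := sqrt ((al x * p x) ^ 2 + (c x * q x + ga x * p x) ^ 2)) in *.
  assert (Hr : 0 < r) by (apply sqrt_lt_R0; lra).
  assert (Hr' : 0 <= r') by apply sqrt_pos.
  assert (P0 : p x = 0).
  { assert (F : (al x * r + r') * p x = 0).
    { transitivity (r * (al x * p x) + r' * p x); [ring |].
      rewrite T1, S1. ring. }
    apply Rmult_integral in F. destruct F; [nra | assumption]. }
  assert (Q0 : q x = 0).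
  { assert (F : (c x * r + r') * q x = 0).
    { transitivity (r * (c x * q x + ga x * p x) + r' * q x); [rewrite P0; ring |].
      rewrite T2, S2. ring. }
    apply Rmult_integral in F. destruct F; [nra | assumption]. }
  rewrite P0, Q0 in Hpos. lra. }
assert (Hlt : forall x, a < x -> (t x - s x) ^ 2 - PI ^ 2 < 0).
{ intros x Hx.
  apply (sign_constant (fun x => (t x - s x) ^ 2 - PI ^ 2) (fun z => a < z) x0 x); trivial.
  - apply half_line_convex.
  - intros z Hz. apply (continuity_pt_minus (fun x => (t x - s x) ^ 2) (fun _ => PI ^ 2)).
    + apply (continuity_pt_comp (fun x => t x - s x) (fun y => y ^ 2)).
      * apply continuity_pt_minus; [now apply Hct | now apply Hcs].
      * apply derivable_continuous_pt, derivable_pt_pow.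
    + now apply continuity_pt_const.
  - destruct (Rtotal_order ((t x0 - s x0) ^ 2 - PI ^ 2) 0) as [G | [G | G]]; trivial.
    + now apply Hne in G.
    + exfalso. apply Rabs_le_between in H0. nra. }
intros x Hx. specialize (Hlt x Hx).
assert (Habs : Rabs (t x - s x) < PI) by (apply Rabs_def1; nra).
split; [exact Habs |].
destruct (Hs x Hx) as [S1 S2]. destruct (Ht x Hx) as [T1 T2].
specialize (Hal x Hx). specialize (Hc x Hx). specialize (Hpos x Hx).
set (r := sqrt (p x ^ 2 + q x ^ 2)) in *.
set (r' := sqrt ((al x * p x) ^ 2 + (c x * q x + ga x * p x) ^ 2)) in *.
assert (Hr : 0 < r) by (apply sqrt_lt_R0; lra).
assert (Hr' : 0 < r').
{ apply sqrt_lt_R0.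
  destruct (Req_dec (p x) 0) as [P0 | P0].
  - assert (Q0 : q x <> 0) by (intros Q0; rewrite P0, Q0 in Hpos; lra).
    assert (0 < (c x * q x + ga x * p x) ^ 2); [| assert (G := pow2_ge_0 (al x * p x)); lra].
    apply pow2_gt_0. rewrite P0. intros F. apply Q0. nra.
  - assert (0 < (al x * p x) ^ 2);
      [| assert (G := pow2_ge_0 (c x * q x + ga x * p x)); lra].
    apply pow2_gt_0. apply Rmult_integral_contrapositive_currified; lra. }
assert (Ecos : cos (t x) = al x * r / r' * cos (s x)).
{ apply (Rmult_eq_reg_l r'); [| lra]. rewrite <- T1. rewrite S1 at 1. fold r. field. lra. }
assert (Hl : 0 < al x * r / r').
{ apply Rdiv_lt_0_compat; [now apply Rmult_lt_0_compat | exact Hr']. }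
set (l := al x * r / r') in *.
assert (Hz : cos (t x) = 0 <-> cos (s x) = 0).
{ rewrite Ecos. split; intros F; [apply Rmult_integral in F; destruct F; lra | rewrite F; ring]. }
assert (Hsg : 0 <= cos (t x) * cos (s x)).
{ rewrite Ecos, Rmult_assoc. apply Rmult_le_pos; [lra | apply Rle_0_sqr]. }
intros k. split; apply passed_same_sign.
- exact Habs.
- exact Hz.
- exact Hsg.
- now rewrite Rabs_minus_sym.
- tauto.
- now rewrite Rmult_comm.
Qed.

(** * The phase of the Bessel function at infinity *)

Lemma is_lim_eventually (f : R -> R) (l : R) : is_lim f p_infty l ->
  forall e, 0 < e -> exists X, forall x, X < x -> Rabs (f x - l) < e.
Proof.
intros H e He. apply is_lim_spec in H. destruct (H (mkposreal e He)) as [X HX].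
exists X. exact HX.
Qed.

Lemma is_lim_of_eventually (f : R -> R) (l : R) :
  (forall e, 0 < e -> exists X, forall x, X < x -> Rabs (f x - l) < e) -> is_lim f p_infty l.
Proof.
intros H. apply is_lim_spec. intros [e He]. destruct (H e He) as [X HX]. now exists X.
Qed.

(** Once the cosine is positive, continuity keeps the angle within [PI / 2] of one
    multiple of [2 PI]. *)
Lemma angle_limit (D : R -> R) (a : R) :
  (forall x, a < x -> continuity_pt D x) ->
  (forall e, 0 < e -> exists X, forall x, X < x -> Rabs (sin (D x)) <= e /\ - e <= cos (D x)) ->
  exists n : Z, is_lim D p_infty (2 * PI * IZR n).
Proof.
intros Hc H. assert (HPI := PI_RGT_0). assert (HPI2 := PI2_1).
destruct (H (/ 2)) as [X0 HX0]; [lra |].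
set (X := Rmax X0 a).
assert (HX : forall x, X < x -> a < x /\ 0 < cos (D x)).
{ intros x Hx. assert (X0 < x) by (unfold X in Hx; apply Rle_lt_trans with (2 := Hx), Rmax_l).
  split; [unfold X in Hx; apply Rle_lt_trans with (2 := Hx), Rmax_r |].
  destruct (HX0 x H0) as [H1 H2].
  assert (Hsc := sin2_cos2 (D x)). unfold Rsqr in Hsc.
  apply Rabs_le_between in H1. nra. }
set (n := Zfloor (D (X + 1) / (2 * PI) + / 2)). exists n.
assert (Hn := Zfloor_bound (D (X + 1) / (2 * PI) + / 2)). fold n in Hn.
set (y := fun x => D x - 2 * PI * IZR n).
assert (Hcy : forall x, cos (y x) = cos (D x)).
{ intros x. rewrite <- (cos_2Z_period (y x) n). f_equal. unfold y. ring. }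
assert (Hsy : forall x, sin (y x) = sin (D x)).
{ intros x. rewrite <- (sin_2Z_period (y x) n). f_equal. unfold y. ring. }
assert (Hy0 : - PI <= y (X + 1) <= PI).
{ unfold y. assert (E : D (X + 1) = (D (X + 1) / (2 * PI)) * (2 * PI)) by (field; lra).
  set (u := D (X + 1) / (2 * PI)) in *. rewrite E. split; nra. }
assert (Hy : forall x, X < x -> y x ^ 2 - (PI / 2) ^ 2 < 0).
{ intros x Hx.
  apply (sign_constant (fun x => y x ^ 2 - (PI / 2) ^ 2) (fun z => X < z) (X + 1) x); try lra.
  - apply half_line_convex.
  - intros z Hz. apply (continuity_pt_minus (fun x => y x ^ 2) (fun _ => (PI / 2) ^ 2)).
    + apply (continuity_pt_comp y (fun y => y ^ 2)).
      * apply continuity_pt_minus; [now apply Hc, HX | now apply continuity_pt_const].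
      * apply derivable_continuous_pt, derivable_pt_pow.
    + now apply continuity_pt_const.
  - intros z Hz E. assert (F : (y z - PI / 2) * (y z + PI / 2) = 0) by (rewrite <- E; ring).
    destruct (HX z Hz) as [_ G]. rewrite <- Hcy in G.
    apply Rmult_integral in F. destruct F as [F | F].
    + replace (y z) with (PI / 2) in G by lra. rewrite cos_PI2 in G. lra.
    + replace (y z) with (- (PI / 2)) in G by lra. rewrite cos_neg, cos_PI2 in G. lra.
  - destruct (HX (X + 1)) as [_ G]; [lra |]. rewrite <- Hcy in G.
    destruct (Rlt_le_dec (y (X + 1) ^ 2 - (PI / 2) ^ 2) 0) as [L | L]; [exact L | exfalso].
    assert (L' : PI / 2 <= y (X + 1) \/ y (X + 1) <= - (PI / 2)) by
      (destruct (Rle_lt_dec (PI / 2) (y (X + 1))); [left; lra | right; nra]).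
    destruct L' as [L' | L'].
    + assert (cos (y (X + 1)) <= 0) by (apply cos_le_0; lra). lra.
    + assert (cos (- y (X + 1)) <= 0) by (apply cos_le_0; lra). rewrite cos_neg in H0. lra. }
apply is_lim_of_eventually. intros e He.
set (e1 := Rmin e 1).
assert (He1 : 0 < e1 /\ e1 <= e /\ e1 <= 1).
{ unfold e1. split; [apply Rmin_glb_lt; lra | split; [apply Rmin_l | apply Rmin_r]]. }
assert (Hse : 0 < sin e1) by (apply sin_gt_0; lra).
destruct (H (sin e1 / 2)) as [X1 HX1]; [lra |].
exists (Rmax X X1). intros x Hx.
assert (HxX : X < x) by (apply Rle_lt_trans with (2 := Hx), Rmax_l).
assert (HxX1 : X1 < x) by (apply Rle_lt_trans with (2 := Hx), Rmax_r).
fold (y x). destruct (HX1 x HxX1) as [G _]. rewrite <- Hsy in G.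
apply Rabs_le_between in G. specialize (Hy x HxX).
assert (Hyx : - (PI / 2) < y x < PI / 2) by (split; nra).
apply Rlt_le_trans with e1; [| lra].
apply Rabs_def1.
- apply sin_increasing_0; lra.
- apply sin_increasing_0; try lra. rewrite sin_neg. lra.
Qed.

Lemma sin_lipschitz (x y : R) : Rabs (sin (x + y) - sin x) <= Rabs y.
Proof.
destruct (MVT_gen sin x (x + y) cos) as (c & _ & E).
- intros s _. auto_derive; [easy | ring].
- intros s _. apply continuity_sin.
- rewrite E, Rabs_mult. replace (x + y - x) with y by ring.
  assert (Rabs (cos c) <= 1) by apply Rabs_le, COS_bound.
  assert (H0 := Rabs_pos y). nra.
Qed.

Lemma cos_lipschitz (x y : R) : Rabs (cos (x + y) - cos x) <= Rabs y.
Proof.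
rewrite <- !sin_shift. rewrite <- (Rabs_Ropp y).
replace (PI / 2 - (x + y)) with (PI / 2 - x + - y) by ring. apply sin_lipschitz.
Qed.

Lemma Rabs_combine (A B s c : R) : -1 <= s <= 1 -> -1 <= c <= 1 ->
  Rabs (A * s + B * c) <= Rabs A + Rabs B.
Proof.
intros Hs Hc. eapply Rle_trans; [apply Rabs_triang |]. rewrite !Rabs_mult.
assert (Rabs s <= 1) by now apply Rabs_le. assert (Rabs c <= 1) by now apply Rabs_le.
assert (H1 := Rabs_pos A). assert (H2 := Rabs_pos B). nra.
Qed.

(** [(n1, n2)] is close to [(v, w)], whose direction is close to
    [(- sin a, cos a)], at the angle [a + PI / 2]. *)
Lemma phase_perturbation (w v n1 n2 a eta psi k d : R) :
  0 < w ^ 2 + v ^ 2 -> 0 <= d <= / 4 ->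
  Rabs (w * sin a + v * cos a) <= k * sqrt (w ^ 2 + v ^ 2) ->
  - (k * sqrt (w ^ 2 + v ^ 2)) <= w * cos a - v * sin a ->
  Rabs (n1 - v) <= d * sqrt (w ^ 2 + v ^ 2) ->
  Rabs (n2 - w) <= d * sqrt (w ^ 2 + v ^ 2) ->
  Rabs eta <= d -> is_angle n1 n2 psi ->
  Rabs (sin (psi - (a + PI / 2 + eta))) <= 2 * (k + 4 * d) /\
  - (2 * (k + 4 * d)) <= cos (psi - (a + PI / 2 + eta)).
Proof.
intros Hpos Hd Hs Hc H1 H2 Heta [P1 P2].
set (rho := sqrt (w ^ 2 + v ^ 2)) in *.
assert (Hrho : 0 < rho) by now apply sqrt_lt_R0.
assert (Hrho2 : rho ^ 2 = w ^ 2 + v ^ 2) by (apply pow2_sqrt; lra).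
set (R := sqrt (n1 ^ 2 + n2 ^ 2)) in *.
assert (HR0 : 0 <= R) by apply sqrt_pos.
assert (HR2 : R ^ 2 = n1 ^ 2 + n2 ^ 2).
{ apply pow2_sqrt. assert (G1 := pow2_ge_0 n1). assert (G2 := pow2_ge_0 n2). lra. }
assert (Hv : Rabs v <= rho).
{ apply Rabs_le_of_sqr; [lra |]. rewrite Hrho2. assert (G := pow2_ge_0 w). lra. }
assert (Hw : Rabs w <= rho).
{ apply Rabs_le_of_sqr; [lra |]. rewrite Hrho2. assert (G := pow2_ge_0 v). lra. }
assert (HR : rho / 2 <= R).
{ destruct (Rle_lt_dec (rho / 2) R) as [G | G]; [exact G | exfalso].
  apply Rabs_le_between in H1. apply Rabs_le_between in H2.
  set (e1 := n1 - v) in *. set (e2 := n2 - w) in *.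
  assert (E1 : v = n1 - e1) by (unfold e1; ring). assert (E2 : w = n2 - e2) by (unfold e2; ring).
  assert (Hq : - (rho / 4) <= e1 <= rho / 4 /\ - (rho / 4) <= e2 <= rho / 4) by (split; nra).
  assert (G1 : rho ^ 2 <= R ^ 2 + 2 * (Rabs n1 + Rabs n2) * (rho / 4) + 2 * (rho / 4) ^ 2).
  { assert (G0 : forall n e t, - t <= e <= t -> (n - e) ^ 2 <= n ^ 2 + 2 * Rabs n * t + t ^ 2).
    { intros n e t He. assert (He2 : e ^ 2 <= t ^ 2) by nra.
      assert (- (n * e) <= Rabs n * t) by (unfold Rabs; destruct (Rcase_abs n); nra). nra. }
    assert (G2 := G0 n1 e1 _ (proj1 Hq)). assert (G3 := G0 n2 e2 _ (proj2 Hq)).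
    rewrite Hrho2, HR2, E1, E2. lra. }
  assert (G2 : Rabs n1 <= R) by (apply Rabs_le_of_sqr; [lra |]; rewrite HR2; assert (G3 := pow2_ge_0 n2); lra).
  assert (G4 : Rabs n2 <= R) by (apply Rabs_le_of_sqr; [lra |]; rewrite HR2; assert (G3 := pow2_ge_0 n1); lra).
  nra. }
assert (HRp : 0 < R) by lra.
set (b := a + eta).
assert (Es : sin (a + PI / 2 + eta) = cos b).
{ rewrite <- cos_shift. replace (PI / 2 - (a + PI / 2 + eta)) with (- b) by (unfold b; ring).
  apply cos_neg. }
assert (Ec : cos (a + PI / 2 + eta) = - sin b).
{ rewrite <- sin_shift. replace (PI / 2 - (a + PI / 2 + eta)) with (- b) by (unfold b; ring).
  apply sin_neg. }
assert (Ls := sin_lipschitz a eta). assert (Lc := cos_lipschitz a eta). fold b in Ls, Lc.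
assert (Bs : R * sin (psi - (a + PI / 2 + eta)) = - (n2 * sin b + n1 * cos b)).
{ rewrite sin_minus, Es, Ec.
  replace (R * (sin psi * - sin b - cos psi * cos b))
    with (- ((R * sin psi) * sin b + (R * cos psi) * cos b)) by ring.
  now rewrite <- P1, <- P2. }
assert (Bc : R * cos (psi - (a + PI / 2 + eta)) = n2 * cos b - n1 * sin b).
{ rewrite cos_minus, Es, Ec.
  replace (R * (cos psi * - sin b + sin psi * cos b))
    with ((R * sin psi) * cos b - (R * cos psi) * sin b) by ring.
  now rewrite <- P1, <- P2. }
assert (Hsb := SIN_bound b). assert (Hcb := COS_bound b).
assert (Hprod : forall p q, Rabs p <= rho -> Rabs q <= Rabs eta -> Rabs (p * q) <= d * rho).
{ intros p q Hp Hq. rewrite Rabs_mult. rewrite (Rmult_comm d).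
  apply Rmult_le_compat; try apply Rabs_pos; lra. }
assert (Q1 := Hprod w _ Hw Ls). assert (Q2 := Hprod v _ Hv Lc).
assert (Q3 := Hprod w _ Hw Lc). assert (Q4 := Hprod v _ Hv Ls).
assert (Q5 := Rabs_combine (n2 - w) (n1 - v) (sin b) (cos b) Hsb Hcb).
assert (Q6 := Rabs_combine (n2 - w) (- (n1 - v)) (cos b) (sin b) Hcb Hsb).
rewrite (Rabs_Ropp (n1 - v)) in Q6.
apply Rabs_le_between in Q1. apply Rabs_le_between in Q2. apply Rabs_le_between in Q3.
apply Rabs_le_between in Q4. apply Rabs_le_between in Q5. apply Rabs_le_between in Q6.
apply Rabs_le_between in Hs.
set (s := sin (psi - (a + PI / 2 + eta))) in *. set (c := cos (psi - (a + PI / 2 + eta))) in *.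
set (M := k + 4 * d).
assert (Z1 : - (M * rho) <= R * s <= M * rho).
{ rewrite Bs. unfold M. split; lra. }
assert (Z2 : - (M * rho) <= R * c).
{ rewrite Bc. unfold M. lra. }
assert (HM : 0 <= M) by (unfold M; nra).
split.
- apply Rabs_le. split.
  + apply (Rmult_le_reg_l R); [exact HRp |]. nra.
  + apply (Rmult_le_reg_l R); [exact HRp |]. nra.
- apply (Rmult_le_reg_l R); [exact HRp |]. nra.
Qed.

(** * Behaviour at the origin *)

Lemma continuity_pos_near (g : R -> R) : continuity_pt g 0 -> 0 < g 0 ->
  exists d, 0 < d /\ forall x, 0 < x < d -> 0 < g x.
Proof.
intros Hc Hg. destruct (Hc (g 0) Hg) as (d & Hd & H). exists d. split; [exact Hd |].
intros x Hx. specialize (H x). simpl in H. unfold R_dist in H.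
assert (G : Rabs (g x - g 0) < g 0).
{ apply H. split; [split; [exact I | lra] |]. rewrite Rminus_0_r, Rabs_pos_eq; lra. }
apply Rabs_def2 in G. lra.
Qed.

Lemma point_near_0 (d y : R) : 0 < d -> 0 < y -> exists z, 0 < z < d /\ z < y.
Proof.
intros Hd Hy. assert (H := Rmin_glb_lt d y 0 Hd Hy).
assert (H1 := Rmin_l d y). assert (H2 := Rmin_r d y).
exists (Rmin d y / 2). lra.
Qed.

Lemma bessel_entire_0 (nu : R) : 0 <= nu ->
  0 < bessel_entire nu 0 /\ bessel_entire' nu 0 < 0.
Proof.
intros H. unfold bessel_entire, bessel_entire'. rewrite !PSeries_0.
assert (H0 : 0 < bessel_coef nu 0).
{ destruct (Rabs_bessel_coef nu 0 H) as [E1 E2]. simpl in E1. lra. }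
split; [exact H0 |]. unfold PS_derive.
assert (H1 := bessel_coef_succ nu 0 H). simpl in H1 |- *. nra.
Qed.

Lemma continuity_bessel_entire_sq (nu x : R) : 0 <= nu ->
  continuity_pt (fun x => bessel_entire nu (x ^ 2 / 4)) x /\
  continuity_pt (fun x => bessel_entire' nu (x ^ 2 / 4)) x.
Proof.
intros H. destruct (bessel_entire_ode nu (x ^ 2 / 4) H) as (d & Hd & _).
assert (Hq : continuity_pt (fun x => x ^ 2 / 4) x).
{ apply (is_derive_continuity_pt _ _ (x / 2)). auto_derive; [easy | field]. }
split.
- apply (continuity_pt_comp (fun x => x ^ 2 / 4) (bessel_entire nu) x Hq).
  eapply is_derive_continuity_pt. now apply is_derive_bessel_entire.
- apply (continuity_pt_comp (fun x => x ^ 2 / 4) (bessel_entire' nu) x Hq).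
  eapply is_derive_continuity_pt, Hd.
Qed.

Lemma bessel_signs_near_0 (nu : R) : 0 <= nu ->
  exists d, 0 < d /\ forall x, 0 < x < d -> 0 < bessel_J nu x /\
    (0 < nu -> 0 < bessel_theta nu x) /\ (nu = 0 -> bessel_theta nu x < 0).
Proof.
intros H. destruct (bessel_entire_0 nu H) as [F0 F1].
destruct (continuity_bessel_entire_sq nu 0 H) as [C0 C1].
assert (E : 0 ^ 2 / 4 = 0) by field.
destruct (continuity_pos_near (fun x => bessel_entire nu (x ^ 2 / 4)) C0) as (d0 & Hd0 & P0).
{ now rewrite E. }
destruct (continuity_pos_near (fun x => - bessel_entire' nu (x ^ 2 / 4))) as (d1 & Hd1 & P1).
{ now apply (continuity_pt_opp (fun x => bessel_entire' nu (x ^ 2 / 4))). }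
{ rewrite E. lra. }
assert (H2 : exists d2, 0 < d2 /\ forall x, 0 < x < d2 -> 0 < nu ->
  0 < nu * bessel_entire nu (x ^ 2 / 4) + x ^ 2 / 2 * bessel_entire' nu (x ^ 2 / 4)).
{ destruct H as [H | <-].
  - destruct (continuity_pos_near (fun x =>
      nu * bessel_entire nu (x ^ 2 / 4) + x ^ 2 / 2 * bessel_entire' nu (x ^ 2 / 4)))
      as (d2 & Hd2 & P2).
    + apply (continuity_pt_plus (fun x => nu * bessel_entire nu (x ^ 2 / 4))
        (fun x => x ^ 2 / 2 * bessel_entire' nu (x ^ 2 / 4))).
      * now apply (continuity_pt_scal (fun x => bessel_entire nu (x ^ 2 / 4))).
      * apply (continuity_pt_mult (fun x => x ^ 2 / 2)); [| exact C1].
        apply (is_derive_continuity_pt _ _ 0). auto_derive; [easy | field].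
    + rewrite E. nra.
    + exists d2. auto.
  - exists 1. split; [lra |]. intros. lra. }
destruct H2 as (d2 & Hd2 & P2).
exists (Rmin d0 (Rmin d1 d2)). split; [repeat apply Rmin_glb_lt; assumption |].
intros x [Hx Hlt].
assert (L0 : x < d0) by (apply Rlt_le_trans with (1 := Hlt), Rmin_l).
assert (L12 : x < Rmin d1 d2) by (apply Rlt_le_trans with (1 := Hlt), Rmin_r).
assert (L1 : x < d1) by (apply Rlt_le_trans with (1 := L12), Rmin_l).
assert (L2 : x < d2) by (apply Rlt_le_trans with (1 := L12), Rmin_r).
assert (HP : 0 < Rpower (x / 2) nu) by apply exp_pos.
split; [| split].
- apply Rmult_lt_0_compat; [exact HP |]. now apply P0.
- intros Hn. apply Rmult_lt_0_compat; [exact HP |]. now apply P2.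
- intros Hn. unfold bessel_theta.
  assert (G : x ^ 2 / 2 * bessel_entire' nu (x ^ 2 / 4) < 0).
  { assert (G1 := P1 x (conj Hx L1)). assert (0 < x ^ 2 / 2) by nra. nra. }
  rewrite Hn in *. nra.
Qed.

(** If both vanished at [x0], they would vanish on [(0, x0]] by uniqueness of the
    solution of the system, against [J_nu > 0] near the origin. *)
Lemma bessel_nonvanishing (nu x0 : R) : 0 <= nu -> 0 < x0 ->
  0 < bessel_theta nu x0 ^ 2 + bessel_J nu x0 ^ 2.
Proof.
intros Hnu Hx0.
set (G := fun x => bessel_theta nu x ^ 2 + bessel_J nu x ^ 2).
destruct (bessel_signs_near_0 nu Hnu) as (d & Hd & Hs).
destruct (point_near_0 d x0 Hd Hx0) as (x1 & Hx1).
assert (HG : 0 < G x1).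
{ destruct (Hs x1 (proj1 Hx1)) as [H _]. unfold G.
  assert (G1 := pow2_ge_0 (bessel_theta nu x1)). nra. }
set (c := (1 + x0 ^ 2 + nu ^ 2) / x1).
set (dG := fun x => 2 * (bessel_theta nu x * bessel_J nu x) * ((1 - x ^ 2 + nu ^ 2) / x)).
assert (HdG : forall x, 0 < x -> is_derive G x (dG x)).
{ intros x Hx. unfold G, dG.
  assert (D1 := is_derive_bessel_J nu x Hnu Hx). assert (D2 := is_derive_bessel_theta nu x Hnu Hx).
  assert (E1 : Derive (fun y : R => bessel_J nu y) x = bessel_theta nu x / x)
    by exact (is_derive_unique _ _ _ D1).
  assert (E2 : Derive (fun y : R => bessel_theta nu y) x = - ((x ^ 2 - nu ^ 2) / x) * bessel_J nu x)
    by exact (is_derive_unique _ _ _ D2).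
  auto_derive; [repeat split; eexists; eassumption |].
  rewrite E1, E2. field. lra. }
assert (Hle := gronwall (fun t => G (x0 - t)) (fun t => - dG (x0 - t)) c (x0 - x1) ltac:(lra)).
cbv beta in Hle. replace (x0 - (x0 - x1)) with x1 in Hle by ring. rewrite Rminus_0_r in Hle.
assert (H : G x1 <= G x0 * exp (c * (x0 - x1))).
{ apply Hle.
  - intros t Ht. assert (D := HdG (x0 - t) ltac:(lra)).
    assert (E : Derive (fun y : R => G y) (x0 + - t) = dG (x0 - t)) by exact (is_derive_unique _ _ _ D).
    auto_derive; [eexists; apply D |]. rewrite E. ring.
  - intros t Ht. set (x := x0 - t). assert (Hx : x1 <= x <= x0) by (unfold x; lra).
    unfold dG, G. set (j := bessel_J nu x). set (u := bessel_theta nu x).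
    assert (Hr : - c <= (1 - x ^ 2 + nu ^ 2) / x <= c).
    { assert (H1 : 1 + x ^ 2 + nu ^ 2 <= c * x).
      { unfold c. apply Rle_trans with (1 + x0 ^ 2 + nu ^ 2); [nra |].
        apply (Rmult_le_reg_r x1); [lra |].
        replace ((1 + x0 ^ 2 + nu ^ 2) / x1 * x * x1) with ((1 + x0 ^ 2 + nu ^ 2) * x) by (field; lra).
        apply Rmult_le_compat_l; [nra | lra]. }
      assert (Hx2 := pow2_ge_0 x). assert (Hn2 := pow2_ge_0 nu).
      split; apply (Rmult_le_reg_r x); try lra;
        (replace ((1 - x ^ 2 + nu ^ 2) / x * x) with (1 - x ^ 2 + nu ^ 2) by (field; lra)); lra. }
    set (k := (1 - x ^ 2 + nu ^ 2) / x) in *.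
    assert (S1 := pow2_ge_0 (u + j)). assert (S2 := pow2_ge_0 (u - j)).
    assert (T1 : 0 <= (c + k) * (u + j) ^ 2) by (apply Rmult_le_pos; lra).
    assert (T2 : 0 <= (c - k) * (u - j) ^ 2) by (apply Rmult_le_pos; lra).
    lra. }
fold (G x0). assert (He := exp_pos (c * (x0 - x1))). nra.
Qed.

(** As long as [x <= nu] the product [J_nu (x J_nu')] is nondecreasing, and it is positive
    near the origin. *)
Lemma bessel_increasing_part (nu x : R) : 0 < nu -> 0 < x <= nu ->
  0 < bessel_J nu x /\ 0 < bessel_theta nu x.
Proof.
intros Hnu Hx. assert (Hnu0 : 0 <= nu) by lra.
destruct (bessel_signs_near_0 nu Hnu0) as (d & Hd & Hs).
set (G := fun x => bessel_theta nu x * bessel_J nu x).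
assert (HdG : forall x, 0 < x ->
  is_derive G x ((bessel_theta nu x ^ 2 + (nu ^ 2 - x ^ 2) * bessel_J nu x ^ 2) / x)).
{ intros y Hy. unfold G.
  assert (D1 := is_derive_bessel_J nu y Hnu0 Hy). assert (D2 := is_derive_bessel_theta nu y Hnu0 Hy).
  assert (E1 : Derive (fun y : R => bessel_J nu y) y = bessel_theta nu y / y)
    by exact (is_derive_unique _ _ _ D1).
  assert (E2 : Derive (fun y : R => bessel_theta nu y) y = - ((y ^ 2 - nu ^ 2) / y) * bessel_J nu y)
    by exact (is_derive_unique _ _ _ D2).
  auto_derive; [repeat split; eexists; eassumption |].
  rewrite E1, E2. field. lra. }
assert (HG : forall y, 0 < y <= nu -> 0 < G y).
{ intros y Hy. destruct (point_near_0 d y Hd (proj1 Hy)) as (z & Hz).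
  destruct (Hs z (proj1 Hz)) as (J0 & T0 & _). specialize (T0 Hnu).
  apply Rlt_le_trans with (G z); [now apply Rmult_lt_0_compat |].
  eapply (le_of_derive_nonneg G); [lra | intros t Ht; apply HdG; lra |].
  intros t Ht. cbv beta. apply Rmult_le_pos; [| apply Rlt_le, Rinv_0_lt_compat; lra].
  assert (S1 := pow2_ge_0 (bessel_theta nu t)). assert (S2 := pow2_ge_0 (bessel_J nu t)).
  assert (0 <= nu ^ 2 - t ^ 2) by nra. nra. }
assert (HJ : forall y, 0 < y <= nu -> 0 < bessel_J nu y).
{ intros y Hy. destruct (point_near_0 d y Hd (proj1 Hy)) as (z & Hz).
  destruct (Hs z (proj1 Hz)) as (J0 & _).
  assert (- bessel_J nu y < 0); [| lra].
  apply (sign_constant (fun t => - bessel_J nu t) (fun t => 0 < t <= nu) z y); try lra.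
  - intros. lra.
  - intros t Ht. apply (continuity_pt_opp (bessel_J nu)).
    eapply is_derive_continuity_pt, is_derive_bessel_J; lra.
  - intros t Ht E. specialize (HG t Ht). unfold G in HG. nra. }
split; [now apply HJ |]. specialize (HG x Hx). specialize (HJ x Hx). unfold G in HG. nra.
Qed.

(** * The comparison functions and their limits *)

Lemma is_lim_at_infinity (f g : R -> R) (X : R) : continuity_pt g 0 ->
  (forall x, X < x -> 0 < x -> f x = g (/ x)) -> is_lim f p_infty (g 0).
Proof.
intros Hc Hf. apply is_lim_of_eventually. intros e He.
destruct (Hc e He) as (d & Hd & H). exists (Rmax X (/ d)). intros x Hx.
assert (HX : X < x) by (apply Rle_lt_trans with (2 := Hx), Rmax_l).
assert (Hdx : / d < x) by (apply Rle_lt_trans with (2 := Hx), Rmax_r).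
assert (Hd0 : 0 < / d) by now apply Rinv_0_lt_compat.
assert (Hx0 : 0 < x) by lra.
assert (Hix : 0 < / x < d).
{ split; [now apply Rinv_0_lt_compat |]. rewrite <- (Rinv_inv d). now apply Rinv_lt_contravar; [nra |]. }
rewrite Hf by assumption. apply (H (/ x)).
split; [split; [exact I | lra] |]. simpl. unfold R_dist. rewrite Rminus_0_r, Rabs_pos_eq; lra.
Qed.

Definition sq (nu x : R) : R := sqrt (x ^ 2 - nu ^ 2).

Lemma sq_pos (nu x : R) : 0 <= nu < x -> 0 < sq nu x /\ sq nu x ^ 2 = x ^ 2 - nu ^ 2.
Proof.
intros H. assert (0 < x ^ 2 - nu ^ 2) by nra.
split; [now apply sqrt_lt_R0 | apply pow2_sqrt; lra].
Qed.

Lemma sq_inv (nu x : R) : 0 < x -> sq nu x = x * sqrt (1 - nu ^ 2 * (/ x) ^ 2).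
Proof.
intros H. unfold sq. rewrite <- (sqrt_pow2 x) at 2 by lra.
destruct (Rle_dec 0 (x ^ 2 - nu ^ 2)) as [Hp | Hn].
- assert (E : x ^ 2 - nu ^ 2 = x ^ 2 * (1 - nu ^ 2 * (/ x) ^ 2)) by (field; lra).
  rewrite E. rewrite sqrt_mult_alt; [reflexivity | nra].
- assert (E : x ^ 2 - nu ^ 2 = x ^ 2 * (1 - nu ^ 2 * (/ x) ^ 2)) by (field; lra).
  rewrite E. rewrite sqrt_mult_alt; [reflexivity | nra].
Qed.

Lemma is_lim_sq_ratio (nu : R) : is_lim (fun x => sq nu x / x) p_infty 1.
Proof.
set (g := fun t => sqrt (1 - nu ^ 2 * t ^ 2)).
replace (Finite 1) with (Finite (g 0)).
- apply (is_lim_at_infinity _ g 0).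
  + apply (is_derive_continuity_pt _ _ 0). unfold g. auto_derive; [lra |].
    rewrite Rmult_0_l, !Rmult_0_r. unfold Rdiv. ring.
  + intros x _ Hx. unfold g. rewrite sq_inv by exact Hx. field. lra.
- f_equal. unfold g. replace (1 - nu ^ 2 * 0 ^ 2) with 1 by ring. apply sqrt_1.
Qed.

Lemma is_derive_acos (y : R) : -1 < y < 1 -> is_derive acos y (- / sqrt (1 - y ^ 2)).
Proof.
intros Hy. apply is_derive_Reals.
replace (- / sqrt (1 - y ^ 2)) with (derive_pt acos y (derivable_pt_acos y Hy)).
- apply derive_pt_eq_1 with (derivable_pt_acos y Hy). reflexivity.
- rewrite derive_pt_acos. replace (1 - y²) with (1 - y ^ 2) by (unfold Rsqr; ring).
  unfold Rdiv. ring.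
Qed.

Definition omega (nu : R) : R := (nu + / 2) * (PI / 2).

Lemma is_lim_phi_low (nu : R) : 0 <= nu ->
  is_lim (fun x => phi_low nu x - (x - omega nu + PI / 2)) p_infty 0.
Proof.
intros Hnu.
set (g := fun t => - nu ^ 2 * t / (sqrt (1 - nu ^ 2 * t ^ 2) + 1) + nu * (PI / 2 - acos (nu * t))).
replace (Finite 0) with (Finite (g 0)).
- apply (is_lim_at_infinity _ g nu).
  + assert (Ha : continuity_pt (fun t => acos (nu * t)) 0).
    { apply (continuity_pt_comp (fun t => nu * t) acos).
      - apply (is_derive_continuity_pt _ _ nu). auto_derive; [easy | ring].
      - eapply is_derive_continuity_pt. apply is_derive_acos. lra. }
    apply (continuity_pt_plus (fun t => - nu ^ 2 * t / (sqrt (1 - nu ^ 2 * t ^ 2) + 1))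
             (fun t => nu * (PI / 2 - acos (nu * t)))).
    * eapply is_derive_continuity_pt. auto_derive; [| reflexivity].
      split; [rewrite Rmult_0_l, !Rmult_0_r; lra |].
      assert (G := sqrt_pos (1 + - (nu * (nu * 1) * (0 * (0 * 1))))).
      split; [lra | exact I].
    * apply (continuity_pt_scal (fun t => PI / 2 - acos (nu * t))).
      apply (continuity_pt_minus (fun _ => PI / 2)); [| exact Ha]. now apply continuity_pt_const.
  + intros x Hx Hx0. destruct (sq_pos nu x (conj Hnu Hx)) as [Hs Hs2].
    unfold phi_low, g, omega. fold (sq nu x). fold (nu / x).
    assert (E : sqrt (1 - nu ^ 2 * (/ x) ^ 2) = sq nu x / x) by (rewrite sq_inv by lra; field; lra).
    rewrite E. set (s := sq nu x) in *.
    replace (- nu ^ 2 * / x / (s / x + 1)) with (s - x).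
    * field.
    * replace (- nu ^ 2) with (s ^ 2 - x ^ 2) by lra. field. lra.
- f_equal. unfold g. rewrite !Rmult_0_r, acos_0. unfold Rdiv. ring.
Qed.

Lemma is_angle_scale (l p q t : R) : 0 < l -> is_angle p q t -> is_angle (l * p) (l * q) t.
Proof.
intros Hl [H1 H2]. unfold is_angle.
assert (E : sqrt ((l * p) ^ 2 + (l * q) ^ 2) = l * sqrt (p ^ 2 + q ^ 2)).
{ replace ((l * p) ^ 2 + (l * q) ^ 2) with (l ^ 2 * (p ^ 2 + q ^ 2)) by ring.
  rewrite sqrt_mult_alt by nra. rewrite sqrt_pow2 by lra. reflexivity. }
rewrite E. split; rewrite Rmult_assoc; f_equal; assumption.
Qed.

(** For large [x] the vector is close to a positive multiple of [(w', w)], where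
    [w = sqrt x J_nu x]: here [sq nu x] is close to [x], and
    [x J_nu' = sqrt x (w' - w / (2 x))]. *)
Lemma bessel_phase_limit (nu a : R) (al ga psi phi : R -> R) : 0 <= nu <= a ->
  is_lim al p_infty 1 -> is_lim ga p_infty 0 ->
  is_lim (fun x => phi x - (x - omega nu + PI / 2)) p_infty 0 ->
  (forall x, a < x -> continuity_pt psi x) -> (forall x, a < x -> continuity_pt phi x) ->
  (forall x, a < x -> is_angle (al x * bessel_theta nu x)
     (sq nu x * bessel_J nu x + ga x * bessel_theta nu x) (psi x)) ->
  exists n : Z, is_lim (fun x => psi x - phi x) p_infty (2 * PI * IZR n).
Proof.
intros Ha Hal Hga Hphi Cpsi Cphi Hang.
apply (angle_limit _ a).
{ intros x Hx. apply continuity_pt_minus; auto. }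
intros e0 He0.
set (m := nu ^ 2 - / 4). set (K := 2 * Rabs m * exp (Rabs m)).
(* The errors below are multiples of [e], and add up to at most [34 e]. *)
set (e := Rmin e0 1 / 64).
assert (He : 0 < e /\ 64 * e <= e0 /\ 64 * e <= 1).
{ assert (0 < Rmin e0 1) by (apply Rmin_glb_lt; lra).
  assert (Rmin e0 1 <= e0) by apply Rmin_l. assert (Rmin e0 1 <= 1) by apply Rmin_r.
  unfold e. lra. }
destruct He as (He & Hee0 & He1).
destruct (is_lim_eventually _ _ Hal e He) as [X1 H1].
destruct (is_lim_eventually _ _ Hga e He) as [X2 H2].
destruct (is_lim_eventually _ _ Hphi e He) as [X3 H3].
destruct (is_lim_eventually _ _ (is_lim_sq_ratio nu) e He) as [X4 H4].
assert (HK : 0 <= K).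
{ unfold K. apply Rmult_le_pos; [assert (G := Rabs_pos m); lra | apply Rlt_le, exp_pos]. }
exists (Rmax (Rmax (Rmax X1 X2) (Rmax X3 X4)) (Rmax (Rmax a 1) ((K + 1) / e))).
intros x Hx.
assert (HX : X1 < x /\ X2 < x /\ X3 < x /\ X4 < x /\ a < x /\ 1 < x /\ (K + 1) / e < x).
{ repeat match goal with H : Rmax _ _ < _ |- _ => apply Rmax_Rlt in H; destruct H end.
  repeat split; assumption. }
destruct HX as (HX1 & HX2 & HX3 & HX4 & Hax & Hx1 & HXK).
specialize (H1 x HX1). specialize (H2 x HX2). specialize (H3 x HX3). specialize (H4 x HX4).
rewrite Rminus_0_r in H2, H3.
assert (Hix : 0 < / x) by (apply Rinv_0_lt_compat; lra).
assert (Hixe : / x <= e /\ K / x <= e).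
{ assert (G : K + 1 <= e * x).
  { apply Rlt_le. apply (Rmult_lt_compat_r e) in HXK; [| exact He].
    replace ((K + 1) / e * e) with (K + 1) in HXK by (field; lra). lra. }
  split; apply (Rmult_le_reg_r x); try lra.
  - rewrite Rinv_l by lra. lra.
  - unfold Rdiv. rewrite Rmult_assoc, Rinv_l by lra. lra. }
assert (Hx0 : 0 < x) by lra.
set (w := bessel_entire nu (x ^ 2 / 4)).
set (w' := bessel_entire' nu (x ^ 2 / 4)).
set (v := / x * ((nu + / 2) * w + x ^ 2 / 2 * w')).
set (P := Rpower (x / 2) nu).
assert (HP : 0 < P) by apply exp_pos.
assert (EJ : bessel_J nu x = P * w) by reflexivity.
assert (ET : bessel_theta nu x = P * x * (v - / x * w / 2)).
{ unfold bessel_theta. fold P. fold w. fold w'. unfold v. field. lra. }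
destruct (ray_connection nu x (proj1 Ha) (Rlt_le _ _ Hx1)) as [C1 C2].
fold m in C1, C2. fold K in C1, C2. fold (omega nu) in C1, C2. fold w in C1, C2. fold w' in C1, C2.
fold v in C1, C2. cbv zeta in C1, C2.
set (rho := sqrt (w ^ 2 + v ^ 2)) in *.
assert (Hpos : 0 < w ^ 2 + v ^ 2).
{ assert (G := bessel_nonvanishing nu x (proj1 Ha) Hx0). rewrite EJ, ET in G.
  destruct (Rlt_le_dec 0 (w ^ 2 + v ^ 2)) as [L | L]; [exact L | exfalso].
  assert (Gw := pow2_ge_0 w). assert (Gv := pow2_ge_0 v).
  assert (w = 0) by (apply Rsqr_0_uniq; unfold Rsqr; lra).
  assert (v = 0) by (apply Rsqr_0_uniq; unfold Rsqr; lra).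
  rewrite H, H0 in G. replace (_ + _) with 0 in G by (field; lra); lra. }
assert (Hrho2 : rho ^ 2 = w ^ 2 + v ^ 2) by (apply pow2_sqrt; lra).
assert (Hrho : 0 < rho) by now apply sqrt_lt_R0.
assert (Hv : Rabs v <= rho).
{ apply Rabs_le_of_sqr; [lra |]. rewrite Hrho2. assert (G := pow2_ge_0 w). lra. }
assert (Hw : Rabs w <= rho).
{ apply Rabs_le_of_sqr; [lra |]. rewrite Hrho2. assert (G := pow2_ge_0 v). lra. }
set (n1 := al x * (v - / x * w / 2)).
set (n2 := sq nu x / x * w + ga x * (v - / x * w / 2)).
assert (Hang' : is_angle n1 n2 (psi x)).
{ assert (G := is_angle_scale (/ (P * x)) _ _ _ ltac:(apply Rinv_0_lt_compat; now apply Rmult_lt_0_compat) (Hang x Hax)).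
  rewrite EJ, ET in G.
  replace n1 with (/ (P * x) * (al x * (P * x * (v - / x * w / 2)))) by (unfold n1; field; lra).
  replace n2 with (/ (P * x) * (sq nu x * (P * w) + ga x * (P * x * (v - / x * w / 2))))
    by (unfold n2; field; lra).
  exact G. }
assert (Hsmall : Rabs (v - / x * w / 2) <= 2 * rho).
{ unfold Rminus. eapply Rle_trans; [apply Rabs_triang |]. rewrite Rabs_Ropp.
  replace (/ x * w / 2) with (/ x / 2 * w) by (field; lra). rewrite Rabs_mult.
  rewrite (Rabs_pos_eq (/ x / 2)) by lra. assert (G := Rabs_pos w). nra. }
assert (N1 : Rabs (n1 - v) <= 4 * e * rho).
{ unfold n1. replace (_ - v) with ((al x - 1) * (v - / x * w / 2) + - (/ x / 2 * w)) by (field; lra).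
  eapply Rle_trans; [apply Rabs_triang |]. rewrite Rabs_Ropp, !Rabs_mult.
  rewrite (Rabs_pos_eq (/ x / 2)) by lra.
  assert (G1 := Rabs_pos w). assert (G2 := Rabs_pos (v - / x * w / 2)).
  assert (G3 : Rabs (al x - 1) * Rabs (v - / x * w / 2) <= e * (2 * rho))
    by (apply Rmult_le_compat; [apply Rabs_pos | | lra |]; assumption).
  nra. }
assert (N2 : Rabs (n2 - w) <= 4 * e * rho).
{ unfold n2. replace (_ - w) with ((sq nu x / x - 1) * w + ga x * (v - / x * w / 2)) by ring.
  eapply Rle_trans; [apply Rabs_triang |]. rewrite !Rabs_mult.
  assert (G1 := Rabs_pos w). assert (G2 := Rabs_pos (v - / x * w / 2)).
  assert (G3 : Rabs (ga x) * Rabs (v - / x * w / 2) <= e * (2 * rho))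
    by (apply Rmult_le_compat; [apply Rabs_pos | | lra |]; assumption).
  assert (G4 : Rabs (sq nu x / x - 1) * Rabs w <= e * rho)
    by (apply Rmult_le_compat; [apply Rabs_pos | | lra |]; assumption).
  assert (G5 : 0 < e * rho) by now apply Rmult_lt_0_compat.
  lra. }
set (eta := phi x - (x - omega nu + PI / 2)) in *.
destruct (phase_perturbation w v n1 n2 (x - omega nu) eta (psi x) (K / x) (4 * e)) as [R1 R2];
  try assumption; try lra.
replace (x - omega nu + PI / 2 + eta) with (phi x) in R1, R2 by (unfold eta; ring).
split; lra.
Qed.

(** The derivative of [phi_low].  The derivatives below are written as [rate] times a
    factor, the derivative in the variable [phi_low]. *)
Definition rate (nu x : R) : R := sq nu x / x.
(** The logarithmic derivative of [sqrt (sq nu)] in that variable. *)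
Definition kappa (nu x : R) : R := x ^ 2 / (2 * sq nu x ^ 3).
(** The function [h] such that [c = (sq nu)^(-1/2) x J_nu'] satisfies
    [c'' + (1 - h) c = 0]; [defect1] and [defect2] are [h'] and [h'']. *)
Definition defect (nu x : R) : R := x ^ 2 * (3 * x ^ 2 + 4 * nu ^ 2) / (4 * sq nu x ^ 6).
Definition defect1 (nu x : R) : R :=
  - (x ^ 2 * (3 * x ^ 4 + 14 * nu ^ 2 * x ^ 2 + 4 * nu ^ 4)) / (2 * sq nu x ^ 9).
Definition defect2 (nu x : R) : R :=
  x ^ 2 * (9 / 2 * x ^ 6 + 44 * nu ^ 2 * x ^ 4 + 42 * nu ^ 4 * x ^ 2 + 4 * nu ^ 6) /
  sq nu x ^ 12.

Lemma is_derive_sq (nu x : R) : 0 <= nu < x -> is_derive (sq nu) x (x / sq nu x).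
Proof.
intros H. destruct (sq_pos nu x H) as [H1 H2]. unfold sq.
auto_derive; [nra |]. unfold sq in H1.
change (x * (x * 1) + - (nu * (nu * 1))) with (x ^ 2 - nu ^ 2). field. lra.
Qed.

Ltac derive_with_sq H :=
  match type of H with 0 <= ?nu < ?x =>
    let D := fresh "D" in let E := fresh "E" in let P := fresh "P" in let P2 := fresh "P2" in
    assert (D := is_derive_sq nu x H);
    assert (E : Derive (fun y : R => sq nu y) x = x / sq nu x) by exact (is_derive_unique _ _ _ D);
    assert (G : ex_derive (fun y : R => sq nu y) x) by (eexists; exact D);
    destruct (sq_pos nu x H) as [P P2];
    assert (N : nu * (nu * 1) = x ^ 2 - sq nu x ^ 2) by (rewrite P2; ring)
  end.

Ltac nonzero := repeat match goal with
  | |- _ /\ _ => split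
  | |- True => exact I
  | |- _ * _ <> 0 => apply Rmult_integral_contrapositive_currified
  | |- _ ^ _ <> 0 => apply pow_nonzero
  end; try assumption; try lra.

Lemma is_derive_kappa (nu x : R) : 0 <= nu < x ->
  is_derive (kappa nu) x (- rate nu x * (x ^ 2 * (x ^ 2 + 2 * nu ^ 2)) / (2 * sq nu x ^ 6)).
Proof.
intros H. derive_with_sq H. unfold kappa, rate. auto_derive; [nonzero |].
rewrite E. set (s := sq nu x) in *. replace (nu ^ 2) with (x ^ 2 - s ^ 2) by lra.
field. lra.
Qed.

Lemma is_derive_defect (nu x : R) : 0 <= nu < x ->
  is_derive (defect nu) x (rate nu x * defect1 nu x).
Proof.
intros H. derive_with_sq H. unfold defect, defect1, rate. auto_derive; [nonzero |].
rewrite E. set (s := sq nu x) in *.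
replace (nu ^ 4) with (nu ^ 2 * nu ^ 2) by ring.
replace (nu * (nu * 1)) with (nu ^ 2) by ring.
replace (nu ^ 2) with (x ^ 2 - s ^ 2) by lra.
field. lra.
Qed.

Lemma is_derive_defect1 (nu x : R) : 0 <= nu < x ->
  is_derive (defect1 nu) x (rate nu x * defect2 nu x).
Proof.
intros H. derive_with_sq H. unfold defect1, defect2, rate. auto_derive; [nonzero |].
rewrite E. set (s := sq nu x) in *.
replace (nu ^ 6) with (nu ^ 2 * nu ^ 2 * nu ^ 2) by ring.
replace (nu ^ 4) with (nu ^ 2 * nu ^ 2) by ring.
replace (nu * (nu * (nu * (nu * 1)))) with (nu ^ 2 * nu ^ 2) by ring.
replace (nu * (nu * 1)) with (nu ^ 2) by ring.
replace (nu ^ 2) with (x ^ 2 - s ^ 2) by lra.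
field. lra.
Qed.

Lemma ex_derive_defect2 (nu x : R) : 0 <= nu < x -> ex_derive (defect2 nu) x.
Proof.
intros H. derive_with_sq H. unfold defect2. auto_derive. nonzero.
Qed.

Lemma defect_pos (nu x : R) : 0 <= nu < x -> 0 < defect nu x.
Proof.
intros H. destruct (sq_pos nu x H) as [H1 H2]. unfold defect.
assert (0 < x ^ 2) by nra. assert (G := pow2_ge_0 nu).
apply Rdiv_lt_0_compat; [apply Rmult_lt_0_compat; lra |].
assert (0 < sq nu x ^ 6) by now apply pow_lt. lra.
Qed.

(** After division by [x^2 (x^2 - nu^2)^(-6)] both sides are polynomials in [x^2] and
    [nu^2], and the coefficients of the right one dominate. *)
Lemma defect_convex (nu x : R) : 0 <= nu < x -> defect nu x ^ 2 <= defect2 nu x.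
Proof.
intros H. destruct (sq_pos nu x H) as [H1 _]. unfold defect, defect2.
set (s := sq nu x) in *. assert (Hs : 0 < s ^ 12) by now apply pow_lt.
apply (Rmult_le_reg_r (s ^ 12)); [exact Hs |].
replace ((x ^ 2 * (3 * x ^ 2 + 4 * nu ^ 2) / (4 * s ^ 6)) ^ 2 * s ^ 12)
  with ((x ^ 2 * (3 * x ^ 2 + 4 * nu ^ 2)) ^ 2 / 16) by (field; lra).
unfold Rdiv at 2. rewrite Rmult_assoc, Rinv_l, Rmult_1_r by lra.
assert (X2 := pow2_ge_0 x). assert (N2 := pow2_ge_0 nu).
replace (x ^ 6) with (x ^ 2 * x ^ 2 * x ^ 2) by ring.
replace (x ^ 4) with (x ^ 2 * x ^ 2) by ring.
replace (nu ^ 6) with (nu ^ 2 * nu ^ 2 * nu ^ 2) by ring.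
replace (nu ^ 4) with (nu ^ 2 * nu ^ 2) by ring.
set (X := x ^ 2) in *. set (n := nu ^ 2) in *. clearbody X n.
replace ((X * (3 * X + 4 * n)) ^ 2 / 16) with
  (X * (9 / 16 * (X * X * X) + 24 / 16 * (n * (X * X)) + (n * n * X))) by field.
apply Rmult_le_compat_l; [exact X2 |].
assert (0 <= X * X * X) by (repeat apply Rmult_le_pos; assumption).
assert (0 <= n * (X * X)) by (repeat apply Rmult_le_pos; assumption).
assert (0 <= n * n * X) by (repeat apply Rmult_le_pos; assumption).
assert (0 <= n * n * n) by (repeat apply Rmult_le_pos; assumption).
lra.
Qed.

Lemma is_derive_phi_low (nu x : R) : 0 <= nu < x -> is_derive (phi_low nu) x (rate nu x).
Proof.
intros H. derive_with_sq H. unfold phi_low, rate.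
assert (Hr : -1 < nu / x < 1).
{ assert (0 <= nu / x) by (apply Rmult_le_pos; [lra | apply Rlt_le, Rinv_0_lt_compat; lra]).
  split; [lra |]. apply (Rmult_lt_reg_r x); [lra |].
  unfold Rdiv. rewrite Rmult_assoc, Rinv_l by lra. lra. }
assert (Da := is_derive_acos (nu / x) Hr).
assert (Ea : Derive (fun y : R => acos y) (nu * / x) = - / sqrt (1 - (nu / x) ^ 2))
  by exact (is_derive_unique _ _ _ Da).
apply (is_derive_ext (fun x => sq nu x - nu * acos (nu / x) + PI / 4)); [reflexivity |].
auto_derive.
- repeat split; [exact G | eexists; exact Da | lra].
- rewrite E, Ea.
  assert (Es : sqrt (1 - (nu / x) ^ 2) = sq nu x / x).
  { rewrite sq_inv by lra. replace (1 - (nu / x) ^ 2) with (1 - nu ^ 2 * (/ x) ^ 2) by (field; lra).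
    field. lra. }
  rewrite Es. set (s := sq nu x) in *.
  apply (Rmult_eq_reg_r (s * x)); [| nra].
  transitivity (x ^ 2 - nu * (nu * 1)); [field; lra |]. rewrite N. field. lra.
Qed.

Lemma phi_tilde_sq (nu x : R) : 0 <= nu < x ->
  phi_tilde nu x = phi_low nu x + (9 * x ^ 2 - 2 * nu ^ 2) / (24 * sq nu x ^ 3).
Proof.
intros H. destruct (sq_pos nu x H) as [H1 H2]. unfold phi_tilde. do 3 f_equal.
replace (3 / 2) with (1 + / 2) by field.
assert (HQ : 0 < x ^ 2 - nu ^ 2) by (rewrite <- H2; now apply pow_lt).
rewrite Rpower_plus, Rpower_1, Rpower_sqrt by lra. fold (sq nu x).
rewrite <- H2. ring.
Qed.

Lemma is_derive_phi_tilde (nu x : R) : 0 <= nu < x ->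
  is_derive (phi_tilde nu) x (rate nu x * (1 - defect nu x / 2)).
Proof.
intros H. derive_with_sq H.
apply (is_derive_ext_loc (fun x => phi_low nu x + (9 * x ^ 2 - 2 * nu ^ 2) / (24 * sq nu x ^ 3))).
{ apply (filter_imp (fun y => nu < y)); [| exact (open_gt nu x (proj2 H))].
  intros y Hy. symmetry. apply phi_tilde_sq. lra. }
assert (Dp := is_derive_phi_low nu x H).
assert (Ep : Derive (fun y : R => phi_low nu y) x = rate nu x) by exact (is_derive_unique _ _ _ Dp).
auto_derive.
- split; [eexists; exact Dp | nonzero].
- rewrite E, Ep. unfold rate, defect. set (s := sq nu x) in *.
  replace (nu * (nu * 1)) with (nu ^ 2) by ring.
  replace (nu ^ 2) with (x ^ 2 - s ^ 2) by lra.
  field. lra.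
Qed.

(** In terms of [c], the pair [(bessel_theta, bessel_q)] is [(sq nu)^(1/2) (c, - c')]. *)
Definition bessel_q (nu x : R) : R :=
  sq nu x * bessel_J nu x + kappa nu x * bessel_theta nu x.

Lemma is_derive_theta_pair (nu x : R) : 0 <= nu < x ->
  is_derive (bessel_theta nu) x
    (rate nu x * (kappa nu x * bessel_theta nu x - bessel_q nu x)) /\
  is_derive (bessel_q nu) x (rate nu x *
    (kappa nu x * bessel_q nu x + (1 - defect nu x) * bessel_theta nu x)).
Proof.
intros H. assert (Hx : 0 < x) by lra. derive_with_sq H.
assert (D1 := is_derive_bessel_J nu x (proj1 H) Hx).
assert (D2 := is_derive_bessel_theta nu x (proj1 H) Hx).
assert (D3 := is_derive_kappa nu x H).
split.
- replace (_ * _) with (- ((x ^ 2 - nu ^ 2) / x) * bessel_J nu x); [exact D2 |].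
  unfold rate, bessel_q. rewrite <- P2. field. lra.
- assert (E1 : Derive (fun y : R => bessel_J nu y) x = bessel_theta nu x / x)
    by exact (is_derive_unique _ _ _ D1).
  assert (E2 : Derive (fun y : R => bessel_theta nu y) x = - ((x ^ 2 - nu ^ 2) / x) * bessel_J nu x)
    by exact (is_derive_unique _ _ _ D2).
  assert (E3 := is_derive_unique (fun y : R => kappa nu y) _ _ D3).
  unfold bessel_q at 1. auto_derive.
  + repeat split; try exact G; eexists; eassumption.
  + rewrite E, E1, E2, E3. unfold bessel_q, kappa, rate, defect.
    set (s := sq nu x) in *.
    replace (nu ^ 2) with (x ^ 2 - s ^ 2) by lra.
    field. lra.
Qed.

(** * Two comparison phases *)

(** Expressions in [/ x] and [sq nu x / x] have at infinity the limit given by the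
    values [0] and [1] of these two variables. *)
Lemma is_lim_sq_expr (nu : R) (F : R -> R -> R) (f : R -> R) : 0 <= nu ->
  (forall r : R -> R, r 0 = 1 -> ex_derive r 0 -> ex_derive (fun t => F t (r t)) 0) ->
  (forall x, nu < x -> 0 < x -> f x = F (/ x) (sq nu x / x)) ->
  is_lim f p_infty (F 0 1).
Proof.
intros Hnu HF Hf.
set (r := fun t => sqrt (1 - nu ^ 2 * t ^ 2)).
assert (Hr0 : r 0 = 1).
{ unfold r. replace (1 - nu ^ 2 * 0 ^ 2) with 1 by ring. apply sqrt_1. }
rewrite <- Hr0. apply (is_lim_at_infinity f (fun t => F t (r t)) nu).
- destruct (HF r Hr0) as [l Hl].
  + unfold r. auto_derive. lra.
  + now apply is_derive_continuity_pt with l.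
- intros x Hx Hx0. rewrite Hf by assumption. f_equal. unfold r.
  rewrite sq_inv by exact Hx0. field. lra.
Qed.

Ltac nonzero_at H := rewrite ?H; nonzero.

Lemma is_lim_kappa (nu : R) : 0 <= nu -> is_lim (kappa nu) p_infty 0.
Proof.
intros Hnu. set (F := fun t r : R => t / (2 * r ^ 3)).
replace (Finite 0) with (Finite (F 0 1)) by (unfold F; f_equal; field).
apply (is_lim_sq_expr nu F); [exact Hnu | |].
- intros r Hr Hd. unfold F. auto_derive. nonzero_at Hr.
- intros x Hx Hx0. destruct (sq_pos nu x (conj Hnu Hx)) as [H _].
  unfold F, kappa. field. lra.
Qed.

Lemma is_lim_defect (nu : R) : 0 <= nu -> is_lim (defect nu) p_infty 0.
Proof.
intros Hnu. set (F := fun t r : R => t ^ 2 * (3 + 4 * nu ^ 2 * t ^ 2) / (4 * r ^ 6)).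
replace (Finite 0) with (Finite (F 0 1)) by (unfold F; f_equal; field).
apply (is_lim_sq_expr nu F); [exact Hnu | |].
- intros r Hr Hd. unfold F. auto_derive. nonzero_at Hr.
- intros x Hx Hx0. destruct (sq_pos nu x (conj Hnu Hx)) as [H _].
  unfold F, defect. field. lra.
Qed.

Lemma is_lim_defect1 (nu : R) : 0 <= nu -> is_lim (defect1 nu) p_infty 0.
Proof.
intros Hnu. set (F := fun t r : R =>
  - (t ^ 3 * (3 + 14 * nu ^ 2 * t ^ 2 + 4 * nu ^ 4 * t ^ 4)) / (2 * r ^ 9)).
replace (Finite 0) with (Finite (F 0 1)) by (unfold F; f_equal; field).
apply (is_lim_sq_expr nu F); [exact Hnu | |].
- intros r Hr Hd. unfold F. auto_derive. nonzero_at Hr.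
- intros x Hx Hx0. destruct (sq_pos nu x (conj Hnu Hx)) as [H _].
  unfold F, defect1. field. lra.
Qed.

Lemma is_lim_phi_tilde_low (nu : R) : 0 <= nu ->
  is_lim (fun x => phi_tilde nu x - phi_low nu x) p_infty 0.
Proof.
intros Hnu. set (F := fun t r : R => t * (9 - 2 * nu ^ 2 * t ^ 2) / (24 * r ^ 3)).
replace (Finite 0) with (Finite (F 0 1)) by (unfold F; f_equal; field).
apply (is_lim_sq_expr nu F); [exact Hnu | |].
- intros r Hr Hd. unfold F. auto_derive. nonzero_at Hr.
- intros x Hx Hx0. destruct (sq_pos nu x (conj Hnu Hx)) as [H _].
  rewrite phi_tilde_sq by lra. unfold F. field. lra.
Qed.

Lemma le_of_nonincreasing_limit (D D' : R -> R) (a l : R) :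
  (forall x, a < x -> is_derive D x (D' x)) -> (forall x, a < x -> D' x <= 0) ->
  is_lim D p_infty l -> forall x, a < x -> l <= D x.
Proof.
intros Hd Hn Hl x Hx.
apply (is_lim_le_loc D (fun _ => D x) p_infty l (D x)); [| exact Hl | apply is_lim_const].
exists x. intros y Hy.
assert (H : - D x <= - D y); [| lra].
apply (le_of_derive_nonneg (fun y => - D y) (fun y => - D' y)); [lra | |].
- intros z Hz. apply (is_derive_opp D). apply Hd. lra.
- intros z Hz. assert (D' z <= 0) by (apply Hn; lra). lra.
Qed.

Lemma bessel_q_pos (nu x : R) : 0 <= nu < x -> 0 < bessel_theta nu x ^ 2 + bessel_q nu x ^ 2.
Proof.
intros H. destruct (sq_pos nu x H) as [H1 _].
assert (H2 := bessel_nonvanishing nu x (proj1 H) ltac:(lra)). unfold bessel_q.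
destruct (Req_dec (bessel_theta nu x) 0) as [E | E].
- rewrite E in *.
  assert (G : bessel_J nu x <> 0) by (intros G; rewrite G in H2; lra).
  assert (0 < (sq nu x * bessel_J nu x + kappa nu x * 0) ^ 2); [| lra].
  apply pow2_gt_0. rewrite Rmult_0_r, Rplus_0_r.
  apply Rmult_integral_contrapositive_currified; lra.
- assert (0 < bessel_theta nu x ^ 2) by now apply pow2_gt_0.
  assert (G := pow2_ge_0 (sq nu x * bessel_J nu x + kappa nu x * bessel_theta nu x)). lra.
Qed.

Lemma continuous_of_ex (f : R -> R) (x : R) : ex_derive f x -> continuous f x.
Proof. intros H. now apply (ex_derive_continuous f). Qed.

Ltac ex_derivs H :=
  match type of H with 0 <= ?nu < ?x =>
    assert (X1 : ex_derive (fun y : R => sq nu y) x) by (eexists; apply is_derive_sq, H);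
    assert (X2 : ex_derive (fun y : R => kappa nu y) x) by (eexists; apply is_derive_kappa, H);
    assert (X3 : ex_derive (fun y : R => defect nu y) x) by (eexists; apply is_derive_defect, H);
    assert (X4 : ex_derive (fun y : R => defect1 nu y) x) by (eexists; apply is_derive_defect1, H);
    assert (X5 : ex_derive (fun y : R => defect2 nu y) x) by (apply ex_derive_defect2, H);
    assert (X6 : ex_derive (fun y : R => bessel_theta nu y) x) by (exact (ex_intro _ _ (proj1 (is_derive_theta_pair nu x H))));
    assert (X7 : ex_derive (fun y : R => bessel_q nu y) x) by (exact (ex_intro _ _ (proj2 (is_derive_theta_pair nu x H))))
  end.

(** The angle of [(c, - c')] has the velocity [1 - h cos^2 <= 1] in the variable
    [phi_low], so its difference with [phi_low] decreases to its limit. *)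
Lemma phase_above_phi_low (nu : R) (th : R -> R) : 0 <= nu ->
  (forall x, nu < x -> continuity_pt th x) ->
  (forall x, nu < x -> is_angle (bessel_theta nu x) (bessel_J nu x) (th x)) ->
  exists (psi : R -> R) (n : Z),
    (forall x, nu < x -> forall k, passed k (psi x) <-> passed k (th x)) /\
    (forall x, nu < x -> phi_low nu x + 2 * PI * IZR n <= psi x) /\
    is_lim (fun x => psi x - phi_low nu x) p_infty (2 * PI * IZR n).
Proof.
intros Hnu Cth Hth.
set (u := bessel_theta nu). set (q := bessel_q nu).
set (w := fun x => rate nu x * (1 - defect nu x * (u x ^ 2 / (u x ^ 2 + q x ^ 2)))).
destruct (polar_lift u q
  (fun x => rate nu x * (kappa nu x * u x - q x))
  (fun x => rate nu x * (kappa nu x * q x + (1 - defect nu x) * u x))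
  w nu (nu + 1) (th (nu + 1))) as (psi & Hd & Ha & H0).
- lra.
- intros x Hx. exact (proj1 (is_derive_theta_pair nu x (conj Hnu Hx))).
- intros x Hx. exact (proj2 (is_derive_theta_pair nu x (conj Hnu Hx))).
- intros x Hx. now apply bessel_q_pos.
- intros x Hx. assert (Hp := bessel_q_pos nu x (conj Hnu Hx)). fold u q in Hp.
  unfold w. field. lra.
- intros x Hx. assert (Hp := bessel_q_pos nu x (conj Hnu Hx)). fold u q in Hp.
  assert (H := conj Hnu Hx). ex_derivs H. fold u in X6. fold q in X7.
  apply continuous_of_ex. unfold w, rate. auto_derive.
  repeat split; try assumption; simpl in Hp; lra.
- exists psi.
  assert (Cpsi : forall x, nu < x -> continuity_pt psi x).
  { intros x Hx. eapply is_derive_continuity_pt. now apply Hd. }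
  assert (Clow : forall x, nu < x -> continuity_pt (phi_low nu) x).
  { intros x Hx. eapply is_derive_continuity_pt. apply is_derive_phi_low. lra. }
  assert (Ha' : forall x, nu < x -> is_angle (1 * bessel_theta nu x)
      (sq nu x * bessel_J nu x + kappa nu x * bessel_theta nu x) (psi x)).
  { intros x Hx. rewrite Rmult_1_l. now apply Ha. }
  destruct (bessel_phase_limit nu nu (fun _ => 1) (kappa nu) psi (phi_low nu)) as [n Hn];
    trivial; [lra | apply is_lim_const | now apply is_lim_kappa | now apply is_lim_phi_low |].
  exists n. split; [| split; [| exact Hn]].
  + intros x Hx.
    apply (sheared_angles u (bessel_J nu) (fun _ => 1) (sq nu) (kappa nu) th psi nu (nu + 1));
      trivial; try lra.
    * intros y Hy. apply bessel_nonvanishing; lra.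
    * intros; lra.
    * intros y Hy. apply sq_pos. lra.
  + intros x Hx.
    assert (G := le_of_nonincreasing_limit (fun x => psi x - phi_low nu x)
      (fun x => w x - rate nu x) nu (2 * PI * IZR n)).
    assert (2 * PI * IZR n <= psi x - phi_low nu x); [| lra].
    apply G; trivial.
    * intros y Hy. apply (is_derive_minus psi (phi_low nu)); [now apply Hd |].
      apply is_derive_phi_low. lra.
    * intros y Hy. unfold w. assert (Hp := bessel_q_pos nu y (conj Hnu Hy)). fold u q in Hp.
      assert (Hh := defect_pos nu y (conj Hnu Hy)).
      assert (Hs : 0 < rate nu y) by (apply Rdiv_lt_0_compat; [apply sq_pos |]; lra).
      assert (0 <= u y ^ 2 / (u y ^ 2 + q y ^ 2)).
      { apply Rmult_le_pos; [apply pow2_ge_0 | now apply Rlt_le, Rinv_0_lt_compat]. }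
      assert (0 <= rate nu y * (defect nu y * (u y ^ 2 / (u y ^ 2 + q y ^ 2)))); [| lra].
      apply Rmult_le_pos; [lra |]. apply Rmult_le_pos; lra.
Qed.

(** The velocity of [phi_tilde] in the variable [phi_low]; it is the mean value of the
    velocity [1 - h cos^2] of the angle of [(c, - c')]. *)
Definition freq (nu x : R) : R := 1 - defect nu x / 2.
(** With [f = freq], this is [- f' / (2 f)], the value for which the velocity of the angle of
    [(f c, - c' + shear c)] has no term in [c c']. *)
Definition shear (nu x : R) : R := defect1 nu x / (4 * freq nu x).

(** The angle of [(f c, - c' + shear c)] has the velocity [f + c2 c^2 / rho^2], where
    [rho] is the length of the vector and
    [c2 = (h'' - f h^2) / 4 + 3 h'^2 / (16 f)], which is nonnegative for [0 < f <= 1]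
    since [h'' >= h^2]. *)
Lemma phase_below_phi_tilde (nu a : R) (th : R -> R) : 0 <= nu <= a ->
  (forall x, a < x -> defect nu x < 2) ->
  (forall x, nu < x -> continuity_pt th x) ->
  (forall x, nu < x -> is_angle (bessel_theta nu x) (bessel_J nu x) (th x)) ->
  exists (psi : R -> R) (n : Z),
    (forall x, a < x -> forall k, passed k (psi x) <-> passed k (th x)) /\
    (forall x, a < x -> psi x <= phi_tilde nu x + 2 * PI * IZR n) /\
    is_lim (fun x => psi x - phi_tilde nu x) p_infty (2 * PI * IZR n).
Proof.
intros Hnua Hdef Cth Hth.
assert (Hnu : 0 <= nu) by lra.
set (u := bessel_theta nu). set (q := bessel_q nu). set (f := freq nu). set (g := shear nu).
assert (Hf : forall x, a < x -> 0 < f x).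
{ intros x Hx. specialize (Hdef x Hx). unfold f, freq. lra. }
set (p := fun x => f x * u x). set (t := fun x => q x + g x * u x).
set (c2 := fun x => - f x * defect nu x ^ 2 / 4 + defect2 nu x / 4 +
   3 / 16 * defect1 nu x ^ 2 / f x).
set (w := fun x => rate nu x * (f x + c2 x * (u x ^ 2 / (p x ^ 2 + t x ^ 2)))).
assert (Hpos : forall x, a < x -> 0 < p x ^ 2 + t x ^ 2).
{ intros x Hx. assert (G := bessel_q_pos nu x ltac:(lra)). fold u q in G.
  specialize (Hf x Hx). unfold p, t.
  destruct (Req_dec (u x) 0) as [E | E].
  - rewrite E in *. replace ((f x * 0) ^ 2 + (q x + g x * 0) ^ 2) with (0 ^ 2 + q x ^ 2) by ring.
    exact G.
  - assert (0 < (f x * u x) ^ 2).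
    { apply pow2_gt_0, Rmult_integral_contrapositive_currified; lra. }
    assert (G2 := pow2_ge_0 (q x + g x * u x)). lra. }
assert (Df : forall x, a < x -> is_derive f x (- (rate nu x * defect1 nu x) / 2)).
{ intros x Hx. assert (D := is_derive_defect nu x ltac:(lra)).
  assert (E := is_derive_unique (fun y : R => defect nu y) _ _ D).
  unfold f, freq. auto_derive; [eexists; exact D |]. rewrite E. field. }
assert (Dg : forall x, a < x -> is_derive g x
   (rate nu x * (defect2 nu x / (4 * f x) + defect1 nu x ^ 2 / (8 * f x ^ 2)))).
{ intros x Hx. assert (D := is_derive_defect1 nu x ltac:(lra)).
  assert (E := is_derive_unique (fun y : R => defect1 nu y) _ _ D).
  assert (E2 := is_derive_unique (fun y : R => f y) _ _ (Df x Hx)).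
  specialize (Hf x Hx).
  unfold g, shear. fold f. auto_derive.
  - repeat split; [eexists; exact D | eexists; apply Df, Hx | lra].
  - rewrite E, E2. field. lra. }
set (u' := fun x => rate nu x * (kappa nu x * u x - q x)).
set (q' := fun x => rate nu x * (kappa nu x * q x + (1 - defect nu x) * u x)).
assert (Du : forall x, a < x -> is_derive u x (u' x)).
{ intros x Hx. exact (proj1 (is_derive_theta_pair nu x ltac:(lra))). }
assert (Dq : forall x, a < x -> is_derive q x (q' x)).
{ intros x Hx. exact (proj2 (is_derive_theta_pair nu x ltac:(lra))). }
destruct (polar_lift p t
  (fun x => - (rate nu x * defect1 nu x) / 2 * u x + f x * u' x)
  (fun x => q' x + (rate nu x * (defect2 nu x / (4 * f x) + defect1 nu x ^ 2 / (8 * f x ^ 2)) * u x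
              + g x * u' x))
  w a (a + 1) (th (a + 1))) as (psi & Hd & Ha & H0).
- lra.
- intros x Hx. apply (is_derive_mult f u); [now apply Df | now apply Du |].
  intros; apply Rmult_comm.
- intros x Hx. apply (is_derive_plus q (fun x => g x * u x)); [now apply Dq |].
  apply (is_derive_mult g u); [now apply Dg | now apply Du |]. intros; apply Rmult_comm.
- exact Hpos.
- intros x Hx. specialize (Hf x Hx). specialize (Hpos x Hx).
  unfold w. transitivity (rate nu x * (f x * (p x ^ 2 + t x ^ 2) + c2 x * u x ^ 2)).
  2: { field. lra. }
  unfold p, t, u', q', c2, g, shear. fold f.
  replace (defect nu x) with (2 - 2 * f x) by (unfold f, freq; field).
  field. lra.
- intros x Hx. assert (H : 0 <= nu < x) by lra. ex_derivs H. fold u in X6. fold q in X7.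
  assert (X8 : ex_derive (fun y : R => f y) x) by (eexists; apply Df, Hx).
  assert (X9 : ex_derive (fun y : R => g y) x) by (eexists; apply Dg, Hx).
  specialize (Hf x Hx). specialize (Hpos x Hx). unfold p, t in Hpos.
  apply continuous_of_ex. unfold w, rate, c2, p, t. auto_derive.
  repeat split; try assumption; simpl in Hpos; lra.
- exists psi.
  assert (Cpsi : forall x, a < x -> continuity_pt psi x).
  { intros x Hx. eapply is_derive_continuity_pt. now apply Hd. }
  assert (Ct : forall x, a < x -> continuity_pt (phi_tilde nu) x).
  { intros x Hx. eapply is_derive_continuity_pt. apply is_derive_phi_tilde. lra. }
  set (ga := fun x => kappa nu x + g x).
  assert (Ha' : forall x, a < x -> is_angle (f x * bessel_theta nu x)
      (sq nu x * bessel_J nu x + ga x * bessel_theta nu x) (psi x)).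
  { intros x Hx. specialize (Ha x Hx). unfold p, t, q, bessel_q in Ha. fold u.
    replace (sq nu x * bessel_J nu x + ga x * u x)
      with (sq nu x * bessel_J nu x + kappa nu x * bessel_theta nu x + g x * u x)
      by (unfold ga, u; ring). exact Ha. }
  assert (Lf : is_lim f p_infty 1).
  { assert (L := is_lim_scal_l (defect nu) (- / 2) p_infty _ (is_lim_defect nu Hnu)).
    replace (Finite 1) with (Finite (1 + - / 2 * 0)) by (f_equal; ring).
    apply (is_lim_ext (fun x => 1 + - / 2 * defect nu x)).
    - intros y. unfold f, freq. field.
    - apply is_lim_plus'; [apply is_lim_const | exact L]. }
  assert (Lg : is_lim ga p_infty 0).
  { assert (Li : is_lim (fun x => / f x) p_infty (/ 1)).
    { apply (is_lim_inv f p_infty 1 Lf). intros E. inversion E. lra. }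
    assert (Lm := is_lim_mult _ _ p_infty _ _ (is_lim_defect1 nu Hnu) Li I).
    assert (L4 := is_lim_scal_l _ (/ 4) p_infty _ Lm).
    assert (Lp := is_lim_plus' _ _ p_infty _ _ (is_lim_kappa nu Hnu) L4).
    replace (Finite 0) with (Finite (0 + / 4 * (0 * / 1))) by (f_equal; field).
    eapply is_lim_ext_loc; [| exact Lp].
    exists a. intros y Hy. specialize (Hf y Hy). unfold ga, g, shear. fold f. field. lra. }
  destruct (bessel_phase_limit nu a f ga psi (phi_tilde nu)) as [n Hn]; trivial.
  { replace (Finite 0) with (Finite (0 + 0)) by (f_equal; ring).
    apply (is_lim_ext (fun x => (phi_tilde nu x - phi_low nu x) +
       (phi_low nu x - (x - omega nu + PI / 2)))); [intros; ring |].
    apply is_lim_plus'; [now apply is_lim_phi_tilde_low | now apply is_lim_phi_low]. }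
  exists n. split; [| split; [| exact Hn]].
  + intros x Hx.
    apply (sheared_angles u (bessel_J nu) f (sq nu) ga th psi a (a + 1)); trivial; try lra.
    * intros y Hy. apply bessel_nonvanishing; lra.
    * intros y Hy. apply sq_pos. lra.
    * intros y Hy. apply Hth. lra.
    * intros y Hy. apply Cth. lra.
  + intros x Hx.
    assert (G := le_of_nonincreasing_limit (fun x => phi_tilde nu x - psi x)
      (fun x => rate nu x * f x - w x) a (- (2 * PI * IZR n))).
    assert (- (2 * PI * IZR n) <= phi_tilde nu x - psi x); [| lra].
    apply G; trivial.
    * intros y Hy. apply (is_derive_minus (phi_tilde nu) psi); [| now apply Hd].
      apply is_derive_phi_tilde. lra.
    * intros y Hy. unfold w. specialize (Hpos y Hy). specialize (Hf y Hy).
      assert (Hy0 : 0 <= nu < y) by lra.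
      assert (Hs : 0 < rate nu y) by (apply Rdiv_lt_0_compat; [apply sq_pos |]; lra).
      assert (Hc2 : 0 <= c2 y).
      { unfold c2. assert (G1 := defect_convex nu y Hy0). assert (G2 := defect_pos nu y Hy0).
        assert (G3 : 0 <= 3 / 16 * defect1 nu y ^ 2 / f y).
        { apply Rmult_le_pos; [| now apply Rlt_le, Rinv_0_lt_compat].
          apply Rmult_le_pos; [lra | apply pow2_ge_0]. }
        assert (G4 : f y * defect nu y ^ 2 <= 1 * defect nu y ^ 2).
        { apply Rmult_le_compat_r; [apply pow2_ge_0 |]. unfold f, freq. lra. }
        lra. }
      assert (0 <= u y ^ 2 / (p y ^ 2 + t y ^ 2)).
      { apply Rmult_le_pos; [apply pow2_ge_0 | now apply Rlt_le, Rinv_0_lt_compat]. }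
      assert (0 <= rate nu y * (c2 y * (u y ^ 2 / (p y ^ 2 + t y ^ 2)))); [| lra].
      apply Rmult_le_pos; [lra |]. apply Rmult_le_pos; lra.
    * apply (is_lim_ext (fun x => - (psi x - phi_tilde nu x))); [intros; ring |].
      now apply (is_lim_opp (fun x => psi x - phi_tilde nu x) p_infty (2 * PI * IZR n)).
Qed.

(** * The minimum of [phi_tilde] *)

Lemma p_poly_defect (nu x : R) : 0 <= nu < x ->
  p_poly nu x = 8 * sq nu x ^ 6 * (1 - defect nu x / 2).
Proof.
intros H. destruct (sq_pos nu x H) as [H1 H2]. unfold p_poly, defect.
set (s := sq nu x) in *.
replace (nu ^ 6) with (nu ^ 2 * nu ^ 2 * nu ^ 2) by ring.
replace (nu ^ 2) with (x ^ 2 - s ^ 2) by lra. field. lra.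
Qed.

Lemma defect_decreasing (nu x y : R) : 0 <= nu < x -> x < y -> defect nu y < defect nu x.
Proof.
intros H Hxy.
destruct (mean_value (defect nu) (fun t => rate nu t * defect1 nu t) x y) as (c & Hc & E).
- lra.
- intros t Ht. apply is_derive_defect. lra.
- assert (Hc0 : 0 <= nu < c) by lra. destruct (sq_pos nu c Hc0) as [H1 _].
  assert (R0 : 0 < rate nu c) by (apply Rdiv_lt_0_compat; lra).
  assert (D0 : 0 < - defect1 nu c).
  { unfold defect1. unfold Rdiv. rewrite Ropp_mult_distr_l, Ropp_involutive.
    apply Rmult_lt_0_compat.
    - assert (0 < c ^ 2) by (apply pow_lt; lra). assert (0 < c ^ 4) by (apply pow_lt; lra).
      assert (0 <= nu ^ 2 * c ^ 2) by (apply Rmult_le_pos; apply pow2_ge_0).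
      assert (0 <= nu ^ 4) by (apply pow_le; lra).
      apply Rmult_lt_0_compat; [assumption |]. lra.
    - apply Rinv_0_lt_compat. assert (0 < sq nu c ^ 9) by now apply pow_lt. lra. }
  assert (0 < rate nu c * (- defect1 nu c) * (y - x)).
  { apply Rmult_lt_0_compat; [now apply Rmult_lt_0_compat | lra]. }
  lra.
Qed.

(** The polynomial equals [- 7 nu^4] at [nu], and at [3 (nu + 1)] its leading term
    dominates; for [nu = 0] it is negative at [1 / 2]. *)
Lemma x_star_spec (nu : R) : 0 <= nu -> nu < x_star nu /\ p_poly nu (x_star nu) = 0.
Proof.
intros Hnu. unfold x_star. apply epsilon_spec.
assert (Hc : forall x, continuity_pt (p_poly nu) x).
{ intros x. eapply is_derive_continuity_pt. unfold p_poly. auto_derive; [easy | reflexivity]. }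
assert (H0 : exists x0, nu <= x0 /\ (0 < x0) /\ p_poly nu x0 < 0 /\ x0 <= nu + 1 /\ (x0 = nu \/ nu < x0)).
{ destruct Hnu as [H | <-].
  - exists nu. repeat split; try lra. unfold p_poly.
    assert (0 < nu ^ 4) by now apply pow_lt.
    replace (8 * nu ^ 6 - _ + _ - _) with (- 7 * nu ^ 4) by ring. lra.
  - exists (/ 2). unfold p_poly. repeat split; lra. }
destruct H0 as (x0 & Hx0 & Hx0p & Hp0 & Hx0u & Hx0e).
set (x1 := 3 * (nu + 1)).
assert (Hp1 : 0 < p_poly nu x1).
{ assert (HX : 9 * nu ^ 2 <= x1 ^ 2 /\ 9 <= x1 ^ 2) by (unfold x1; split; nra).
  unfold p_poly. replace (x1 ^ 6) with (x1 ^ 2 * x1 ^ 2 * x1 ^ 2) by ring.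
  replace (x1 ^ 4) with (x1 ^ 2 * x1 ^ 2) by ring.
  replace (nu ^ 6) with (nu ^ 2 * nu ^ 2 * nu ^ 2) by ring.
  assert (Hn := pow2_ge_0 nu).
  set (X := x1 ^ 2) in *. set (n := nu ^ 2) in *. clearbody X n.
  replace (8 * (X * X * X) - 3 * (8 * n + 1) * (X * X) + 4 * n * (6 * n - 1) * X - 8 * (n * n * n))
    with (8 * (X - n) ^ 3 - 3 * X ^ 2 - 4 * n * X) by ring.
  assert ((8 * X / 9) ^ 3 <= (X - n) ^ 3) by (apply pow_incr; lra).
  assert (9 * X ^ 2 <= X ^ 3) by (replace (X ^ 3) with (X * X ^ 2) by ring; apply Rmult_le_compat_r; [apply pow2_ge_0 | lra]).
  assert (0 < X ^ 2) by (apply pow_lt; lra).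
  assert (n * X <= X ^ 2 / 9) by nra.
  lra. }
destruct (Ranalysis5.IVT_interv (p_poly nu) x0 x1) as (z & Hz & E).
- intros; apply Hc.
- unfold x1. lra.
- exact Hp0.
- exact Hp1.
- exists z. split; [| exact E].
  destruct Hx0e as [G | G]; [| lra].
  destruct (Rle_lt_or_eq_dec nu z) as [L | L]; [lra | exact L | exfalso].
  rewrite G in Hp0. rewrite <- L in E. lra.
Qed.

Lemma defect_beyond_x_star (nu x : R) : 0 <= nu -> x_star nu < x -> defect nu x < 2.
Proof.
intros Hnu Hx. destruct (x_star_spec nu Hnu) as [H1 H2].
rewrite p_poly_defect in H2 by lra.
destruct (sq_pos nu (x_star nu) (conj Hnu H1)) as [H3 _].
assert (0 < sq nu (x_star nu) ^ 6) by now apply pow_lt.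
assert (E : defect nu (x_star nu) = 2).
{ apply Rmult_integral in H2. destruct H2; lra. }
rewrite <- E. apply defect_decreasing; lra.
Qed.

Lemma atan_bounds (y : R) : 0 <= y -> y - y ^ 3 / 3 <= atan y <= y.
Proof.
intros Hy. split.
- assert (H : atan 0 - (0 - 0 ^ 3 / 3) <= atan y - (y - y ^ 3 / 3)).
  { apply (le_of_derive_nonneg (fun y => atan y - (y - y ^ 3 / 3))
      (fun y => / (1 + y ^ 2) - (1 - y ^ 2))); [exact Hy | |].
    - intros x _. auto_derive; [easy |]. unfold Rsqr. field. nra.
    - intros x _. assert (G := pow2_ge_0 x).
      replace (/ (1 + x ^ 2) - (1 - x ^ 2)) with (x ^ 2 * x ^ 2 / (1 + x ^ 2)) by (field; lra).
      apply Rmult_le_pos; [nra | apply Rlt_le, Rinv_0_lt_compat; lra]. }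
  rewrite atan_0 in H. lra.
- assert (H : 0 - atan 0 <= y - atan y).
  { apply (le_of_derive_nonneg (fun y => y - atan y) (fun y => y ^ 2 / (1 + y ^ 2)));
      [exact Hy | |].
    - intros x _. auto_derive; [easy |]. unfold Rsqr. field. nra.
    - intros x _. assert (G := pow2_ge_0 x).
      apply Rmult_le_pos; [exact G | apply Rlt_le, Rinv_0_lt_compat; lra]. }
  rewrite atan_0 in H. lra.
Qed.

(** As [acos (nu / x) = atan (S / nu)] with [S = sq nu x], these are bounds of
    [nu (tan a - a)]. *)
Lemma phi_low_bounds (nu x : R) : 0 < nu < x ->
  PI / 4 <= phi_low nu x <= sq nu x ^ 3 / (3 * nu ^ 2) + PI / 4.
Proof.
intros H. destruct (sq_pos nu x ltac:(lra)) as [H1 H2].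
assert (Hr : 0 < nu / x) by (apply Rdiv_lt_0_compat; lra).
unfold phi_low. fold (sq nu x). rewrite acos_atan by exact Hr.
replace (sqrt (1 - (nu / x)²) / (nu / x)) with (sq nu x / nu).
- set (s := sq nu x) in *.
  destruct (atan_bounds (s / nu) (Rlt_le _ _ (Rdiv_lt_0_compat _ _ H1 (proj1 H)))) as [G1 G2].
  apply (Rmult_le_compat_l nu) in G1; [| lra]. apply (Rmult_le_compat_l nu) in G2; [| lra].
  replace (nu * (s / nu - (s / nu) ^ 3 / 3)) with (s - s ^ 3 / (3 * nu ^ 2)) in G1 by (field; lra).
  replace (nu * (s / nu)) with s in G2 by (field; lra).
  lra.
- rewrite sq_inv by lra. replace ((nu / x)²) with (nu ^ 2 * (/ x) ^ 2) by (unfold Rsqr; field; lra).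
  field. lra.
Qed.

(** The minimum is attained at [(x^2 - nu^2)^(3/2)] of the order of [max (1, nu^2)]; the
    factor [8] puts the test point beyond [x_star], and the value there is at most
    [8 / 3 + 1 / 4 + PI / 4]. *)
Lemma phi_tilde_small_somewhere (nu : R) : 0 <= nu ->
  exists x, x_star nu < x /\ phi_tilde nu x < 3 * PI / 2.
Proof.
intros Hnu. assert (HPI := PI2_3_2).
set (m := Rmax 1 (nu ^ 2)).
assert (Hm : 1 <= m /\ nu ^ 2 <= m) by (split; [apply Rmax_l | apply Rmax_r]).
set (d := Rpower (8 * m) (/ 3)).
assert (Hd : 0 < d) by apply exp_pos.
assert (Hd3 : d ^ 3 = 8 * m).
{ unfold d. rewrite <- Rpower_pow by apply exp_pos. rewrite Rpower_mult.
  replace (/ 3 * INR 3) with 1 by (simpl; field). apply Rpower_1. lra. }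
assert (Hd2 : 2 <= d).
{ destruct (Rle_lt_dec 2 d) as [L | L]; [exact L | exfalso].
  assert (d ^ 3 < 2 ^ 3) by (simpl; nra). lra. }
assert (Hdm : d ^ 2 <= 4 * m).
{ assert (2 * d ^ 2 <= d ^ 3); [| lra].
  replace (d ^ 3) with (d * d ^ 2) by ring. apply Rmult_le_compat_r; [apply pow2_ge_0 | exact Hd2]. }
set (x := sqrt (nu ^ 2 + d ^ 2)).
assert (N2 := pow2_ge_0 nu). assert (D2 : 0 < d ^ 2) by now apply pow_lt.
assert (Hx2 : x ^ 2 = nu ^ 2 + d ^ 2) by (apply pow2_sqrt; lra).
assert (Hx : 0 <= nu < x).
{ split; [exact Hnu |]. rewrite <- (sqrt_pow2 nu Hnu). apply sqrt_lt_1; lra. }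
assert (Hs : sq nu x = d).
{ unfold sq. rewrite Hx2. replace (nu ^ 2 + d ^ 2 - nu ^ 2) with (d ^ 2) by ring. apply sqrt_pow2; lra. }
assert (Hdef : defect nu x < 2).
{ unfold defect. rewrite Hs, Hx2. replace (d ^ 6) with (d ^ 3 * d ^ 3) by ring. rewrite Hd3.
  apply (Rmult_lt_reg_r (4 * (8 * m * (8 * m)))); [nra |].
  unfold Rdiv. rewrite Rmult_assoc, Rinv_l by nra.
  assert ((nu ^ 2 + d ^ 2) * (3 * (nu ^ 2 + d ^ 2) + 4 * nu ^ 2) <= (5 * m) * (19 * m))
    by (apply Rmult_le_compat; lra). nra. }
exists x. split.
- destruct (x_star_spec nu Hnu) as [H1 H2].
  destruct (Rlt_le_dec (x_star nu) x) as [L | L]; [exact L | exfalso].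
  assert (Hps : 0 < p_poly nu (x_star nu)); [| lra].
  rewrite p_poly_defect by lra.
  assert (defect nu (x_star nu) < 2).
  { destruct L as [L | <-]; [| exact Hdef]. assert (G := defect_decreasing nu x _ Hx L). lra. }
  destruct (sq_pos nu (x_star nu)) as [G _]; [lra |].
  assert (0 < sq nu (x_star nu) ^ 6) by now apply pow_lt.
  apply Rmult_lt_0_compat; lra.
- rewrite phi_tilde_sq by exact Hx.
  assert (T : (9 * x ^ 2 - 2 * nu ^ 2) / (24 * sq nu x ^ 3) <= / 4).
  { rewrite Hs, Hx2, Hd3. apply (Rmult_le_reg_r (24 * (8 * m))); [lra |].
    unfold Rdiv. rewrite Rmult_assoc, Rinv_l by lra. lra. }
  assert (L : phi_low nu x <= 8 / 3 + PI / 4); [| lra].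
  destruct (Rle_lt_dec nu 1) as [G | G].
  + assert (Em : m = 1) by (unfold m; apply Rmax_left; nra).
    assert (Ed : d <= 2).
    { destruct (Rle_lt_dec d 2) as [L | L]; [exact L | exfalso]. rewrite Em in Hd3. nra. }
    unfold phi_low. fold (sq nu x). rewrite Hs.
    assert (0 <= nu * acos (nu / x)) by (apply Rmult_le_pos; [exact Hnu | apply acos_bound]).
    lra.
  + assert (Em : m = nu ^ 2) by (unfold m; apply Rmax_right; nra).
    eapply Rle_trans; [apply phi_low_bounds; lra |]. rewrite Hs, Hd3, Em.
    right. field. lra.
Qed.

(** * The counting angle *)

(** The index of the last zero of the cosine that the angle has passed when [x] leaves
    [nu]; for [nu = 0] it accounts for the conventional value [j'_(0,1) = 0]. *)
Definition start_index (nu : R) : Z := if Req_EM_T nu 0 then 1%Z else 0%Z.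

(** The velocity is [(u^2 + (x^2 - nu^2) J^2) / (x (u^2 + J^2))], which is positive for
    [x > nu].  For [nu > 0] the curve is in the first quadrant at [x = nu]; for [nu = 0] it
    is in the second one just after the origin. *)
Lemma bessel_angle (nu : R) : 0 <= nu ->
  exists th : R -> R,
    (forall x, nu < x -> continuity_pt th x) /\
    (forall x, nu < x -> is_angle (bessel_theta nu x) (bessel_J nu x) (th x)) /\
    (forall x y, nu < x < y -> th x < th y) /\
    (forall x, nu < x -> PI * (IZR (start_index nu) - / 2) < th x) /\
    (exists x, nu < x /\ th x < PI * (IZR (start_index nu) + / 2)).
Proof.
intros Hnu. assert (HPI := PI_RGT_0).
set (u := bessel_theta nu). set (j := bessel_J nu).
set (w := fun x => (u x ^ 2 + (x ^ 2 - nu ^ 2) * j x ^ 2) / (x * (u x ^ 2 + j x ^ 2))).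
assert (Hpos : forall x, 0 < x -> 0 < u x ^ 2 + j x ^ 2).
{ intros x Hx. now apply bessel_nonvanishing. }
assert (Hlift : forall x0 t0, 0 < x0 -> exists th, (forall x, 0 < x -> is_derive th x (w x)) /\
  (forall x, 0 < x -> is_angle (u x) (j x) (th x)) /\ Rabs (th x0 - t0) <= PI).
{ intros x0 t0 Hx0.
  apply (polar_lift u j (fun x => - ((x ^ 2 - nu ^ 2) / x) * j x) (fun x => u x / x)); trivial.
  - intros x Hx. now apply is_derive_bessel_theta.
  - intros x Hx. now apply is_derive_bessel_J.
  - intros x Hx. specialize (Hpos x Hx). unfold w. field. lra.
  - intros x Hx. specialize (Hpos x Hx).
    assert (X1 : ex_derive (fun y : R => u y) x) by (eexists; now apply is_derive_bessel_theta).
    assert (X2 : ex_derive (fun y : R => j y) x) by (eexists; now apply is_derive_bessel_J).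
    apply continuous_of_ex. unfold w. auto_derive.
    repeat split; try assumption. apply Rmult_integral_contrapositive_currified; [lra |].
    simpl in Hpos. lra. }
assert (Hw : forall x, 0 < x -> nu <= x -> 0 <= w x).
{ intros x Hx Hx'. specialize (Hpos x Hx).
  apply Rmult_le_pos; [| apply Rlt_le, Rinv_0_lt_compat; now apply Rmult_lt_0_compat].
  assert (0 <= x ^ 2 - nu ^ 2) by nra. assert (G1 := pow2_ge_0 (u x)). assert (G2 := pow2_ge_0 (j x)).
  assert (0 <= (x ^ 2 - nu ^ 2) * j x ^ 2) by now apply Rmult_le_pos. lra. }
assert (Hw' : forall x, nu < x -> 0 < w x).
{ intros x Hx'. assert (Hx : 0 < x) by lra. specialize (Hpos x Hx).
  apply Rdiv_lt_0_compat; [| now apply Rmult_lt_0_compat].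
  assert (0 < x ^ 2 - nu ^ 2) by nra. assert (G1 := pow2_ge_0 (u x)). assert (G2 := pow2_ge_0 (j x)).
  destruct (Req_dec (j x) 0) as [E | E].
  - rewrite E in *. lra.
  - assert (0 < j x ^ 2) by now apply pow2_gt_0. nra. }
assert (Hmono : forall th, (forall x, 0 < x -> is_derive th x (w x)) ->
  (forall x y, 0 < x -> nu <= x <= y -> th x <= th y) /\ (forall x y, nu < x < y -> th x < th y)).
{ intros th Hd. split.
  - intros x y Hx Hxy. apply (le_of_derive_nonneg th w); [lra | |]; intros t Ht.
    + apply Hd. lra.
    + apply Hw; lra.
  - intros x y Hxy. destruct (mean_value th w x y) as (c & Hc & E); [lra | intros; apply Hd; lra |].
    assert (Hwc := Hw' c ltac:(lra)). nra. }
unfold start_index. destruct (Req_EM_T nu 0) as [E0 | N0].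
- destruct (bessel_signs_near_0 nu Hnu) as (d & Hd & Hs).
  assert (Hs' : forall x, 0 < x <= d / 2 -> 0 < j x /\ u x < 0).
  { intros x Hx. destruct (Hs x) as (G1 & _ & G2); [lra |]. split; [exact G1 | now apply G2]. }
  destruct (Hlift (d / 2) (3 * PI / 4)) as (th & Hth & Ha & H0); [lra |].
  destruct (Hmono th Hth) as [M1 M2].
  assert (Hq : PI / 2 < th (d / 2) < PI).
  { destruct (Hs' (d / 2)) as [G1 G2]; [lra |]. destruct (Ha (d / 2)) as [A1 A2]; [lra |].
    set (r := sqrt (u (d / 2) ^ 2 + j (d / 2) ^ 2)) in *. assert (Hr : 0 <= r) by apply sqrt_pos.
    set (t := th (d / 2)) in *. apply Rabs_le_between in H0.
    assert (Hsin : 0 < sin t) by (destruct (Rlt_le_dec 0 (sin t)); [assumption | nra]).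
    assert (Hcos : cos t < 0) by (destruct (Rlt_le_dec (cos t) 0); [assumption | nra]).
    assert (L1 : 0 < t).
    { destruct (Rlt_le_dec 0 t) as [L | L]; [exact L | exfalso].
      assert (0 <= sin (- t)) by (apply sin_ge_0; lra). rewrite sin_neg in H. lra. }
    assert (L2 : t < PI).
    { destruct (Rlt_le_dec t PI) as [L | L]; [exact L | exfalso].
      assert (sin t <= 0) by (apply sin_le_0; lra). lra. }
    split; [| exact L2].
    destruct (Rlt_le_dec (PI / 2) t) as [L | L]; [exact L | exfalso].
    assert (0 <= cos t) by (apply cos_ge_0; lra). lra. }
  exists th. split; [| split; [| split; [exact M2 | split]]].
  + intros x Hx. eapply is_derive_continuity_pt. apply Hth. lra.
  + intros x Hx. apply Ha. lra.
  + intros x Hx. destruct (Rle_lt_dec (d / 2) x) as [L | L].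
    * assert (th (d / 2) <= th x) by (apply M1; lra). lra.
    * assert (PI / 2 - th x < 0); [| lra].
      apply (sign_constant (fun t => PI / 2 - th t) (fun t => 0 < t <= d / 2) (d / 2) x); try lra.
      -- intros; lra.
      -- intros z Hz. apply continuity_pt_minus; [now apply continuity_pt_const |].
         eapply is_derive_continuity_pt. apply Hth. lra.
      -- intros z Hz E. destruct (Hs' z Hz) as [_ G]. destruct (Ha z (proj1 Hz)) as [A1 _].
         replace (th z) with (PI / 2) in A1 by lra. rewrite cos_PI2, Rmult_0_r in A1. lra.
  + exists (d / 2). split; lra.
- assert (Hnup : 0 < nu) by lra.
  destruct (Hlift nu (PI / 4) Hnup) as (th & Hth & Ha & H0).
  destruct (Hmono th Hth) as [M1 M2].
  assert (Hq : 0 < th nu < PI / 2).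
  { destruct (bessel_increasing_part nu nu Hnup) as [G1 G2]; [lra |].
    destruct (Ha nu Hnup) as [A1 A2]. fold u in G2. fold j in G1.
    set (r := sqrt (u nu ^ 2 + j nu ^ 2)) in *. assert (Hr : 0 <= r) by apply sqrt_pos.
    set (t := th nu) in *. apply Rabs_le_between in H0.
    assert (Hsin : 0 < sin t) by (destruct (Rlt_le_dec 0 (sin t)); [assumption | nra]).
    assert (Hcos : 0 < cos t) by (destruct (Rlt_le_dec 0 (cos t)); [assumption | nra]).
    assert (L1 : 0 < t).
    { destruct (Rlt_le_dec 0 t) as [L | L]; [exact L | exfalso].
      assert (0 <= sin (- t)) by (apply sin_ge_0; lra). rewrite sin_neg in H. lra. }
    split; [exact L1 |].
    destruct (Rlt_le_dec t (PI / 2)) as [L | L]; [exact L | exfalso].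
    assert (cos t <= 0) by (apply cos_le_0; lra). lra. }
  exists th. split; [| split; [| split; [exact M2 | split]]].
  + intros x Hx. eapply is_derive_continuity_pt. apply Hth. lra.
  + intros x Hx. apply Ha. lra.
  + intros x Hx. assert (th nu <= th x) by (apply M1; lra). lra.
  + assert (C := is_derive_continuity_pt _ _ _ (Hth nu Hnup)).
    destruct (C (PI / 2 - th nu)) as (e & He & H); [lra |].
    exists (nu + e / 2). split; [lra |].
    assert (G : Rabs (th (nu + e / 2) - th nu) < PI / 2 - th nu).
    { apply (H (nu + e / 2)). split; [split; [exact I | lra] |].
      simpl. unfold R_dist. rewrite Rabs_pos_eq; lra. }
    apply Rabs_def2 in G. lra.
Qed.

Lemma passed_le (k : Z) (s t : R) : s <= t -> passed k s -> passed k t.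
Proof. unfold passed. lra. Qed.

Lemma IZR_lt_1 (n k : Z) : IZR n < IZR k + 1 -> (n <= k)%Z.
Proof. intros H. rewrite <- plus_IZR in H. apply lt_IZR in H. lia. Qed.

Lemma start_index_bounds (nu : R) : (0 <= start_index nu <= 1)%Z.
Proof. unfold start_index. destruct (Req_EM_T nu 0); lia. Qed.

(** The two comparison phases are asymptotic to [phi_low + 2 PI n] and to
    [phi_tilde + 2 PI nt].  As they pass the same zeros, they differ by at most [PI], so
    [n = nt].  Near [nu] few zeros have been passed although [phi_low >= PI / 4], hence
    [n <= 0]; a point with [phi_tilde < 3 PI / 2] gives [nt >= 0]. *)
Lemma bessel_angle_enclosure (nu : R) (th : R -> R) : 0 <= nu ->
  (forall x, nu < x -> continuity_pt th x) ->
  (forall x, nu < x -> is_angle (bessel_theta nu x) (bessel_J nu x) (th x)) ->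
  (forall x, nu < x -> PI * (IZR (start_index nu) - / 2) < th x) ->
  (exists x, nu < x /\ th x < PI * (IZR (start_index nu) + / 2)) ->
  (forall x k, nu < x -> passed k (phi_low nu x) -> passed k (th x)) /\
  (forall x k, x_star nu < x -> passed k (th x) -> passed k (phi_tilde nu x)).
Proof.
intros Hnu Cth Ath Hlow (x2 & Hx2 & Hth2).
assert (HPI := PI_RGT_0).
destruct (x_star_spec nu Hnu) as [Hstar _].
assert (Hidx : 0 <= IZR (start_index nu) <= 1).
{ split; apply IZR_le; apply start_index_bounds. }
destruct (phase_above_phi_low nu th Hnu Cth Ath) as (psi & n & P1 & P2 & P3).
destruct (phase_below_phi_tilde nu (x_star nu) th) as (psit & nt & T1 & T2 & T3); trivial; [lra | |].
{ intros x Hx. now apply defect_beyond_x_star. }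
assert (Hn : (n <= 0)%Z).
{ apply IZR_lt_1.
  assert (G : psi x2 < PI * (IZR (start_index nu) + / 2)).
  { destruct (Rlt_le_dec (psi x2) (PI * (IZR (start_index nu) + / 2))) as [L | L]; [exact L | exfalso].
    assert (Q : passed (start_index nu + 1) (th x2)).
    { apply (P1 x2 Hx2). unfold passed. rewrite plus_IZR. lra. }
    unfold passed in Q. rewrite plus_IZR in Q. lra. }
  assert (L := P2 x2 Hx2).
  assert (Q : PI / 4 <= phi_low nu x2).
  { destruct Hnu as [Hnu | <-]; [apply phi_low_bounds; lra |].
    unfold phi_low. rewrite Rmult_0_l, Rminus_0_r.
    assert (H := sqrt_pos (x2 ^ 2 - 0 ^ 2)). lra. }
  assert (2 * PI * IZR n < 2 * PI * 1); [nra |].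
  apply (Rmult_lt_reg_l (2 * PI)); lra. }
assert (Hnt : (0 <= nt)%Z).
{ assert (G : (- nt <= 0)%Z); [| lia].
  destruct (phi_tilde_small_somewhere nu Hnu) as (x1 & Hx1 & Hphi).
  apply IZR_lt_1. rewrite opp_IZR.
  assert (Q : passed (start_index nu) (psit x1)).
  { apply (T1 x1 Hx1). unfold passed. apply Rlt_le, Hlow. lra. }
  unfold passed in Q. assert (L := T2 x1 Hx1).
  assert (- (PI / 2) <= PI * (IZR (start_index nu) - / 2)) by nra.
  apply (Rmult_lt_reg_l (2 * PI)); lra. }
assert (Hnn : n = nt).
{ destruct (is_lim_eventually _ _ P3 (PI / 8)) as [X1 HX1]; [lra |].
  destruct (is_lim_eventually _ _ T3 (PI / 8)) as [X2 HX2]; [lra |].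
  destruct (is_lim_eventually _ _ (is_lim_phi_tilde_low nu Hnu) (PI / 8)) as [X3 HX3]; [lra |].
  set (x := Rmax (Rmax X1 X2) (Rmax X3 (x_star nu)) + 1).
  assert (Hx : X1 < x /\ X2 < x /\ X3 < x /\ x_star nu < x).
  { assert (H : Rmax (Rmax X1 X2) (Rmax X3 (x_star nu)) < x) by (unfold x; lra).
    repeat match goal with H : Rmax _ _ < _ |- _ => apply Rmax_Rlt in H; destruct H end.
    repeat split; assumption. }
  destruct Hx as (G1 & G2 & G3 & G4).
  specialize (HX1 x G1). specialize (HX2 x G2). specialize (HX3 x G3).
  apply Rabs_def2 in HX1. apply Rabs_def2 in HX2. apply Rabs_def2 in HX3.
  assert (Q : forall k, passed k (psi x) <-> passed k (psit x)).
  { intros k. rewrite (P1 x ltac:(lra) k), (T1 x G4 k). tauto. }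
  assert (Hd : Rabs (psi x - psit x) <= PI).
  { set (k := Zfloor (psi x / PI + / 2)). assert (B := Zfloor_bound (psi x / PI + / 2)). fold k in B.
    assert (E : psi x = psi x / PI * PI) by (field; lra).
    assert (B1 : passed k (psi x)) by (unfold passed; rewrite E; nra).
    assert (B2 : ~ passed (k + 1) (psi x)) by (unfold passed; rewrite plus_IZR, E; nra).
    assert (B3 := proj1 (Q k) B1).
    assert (B4 : ~ passed (k + 1) (psit x)) by (intros F; apply B2; now apply Q).
    unfold passed in *. rewrite plus_IZR in *. apply Rabs_le. split; nra. }
  apply Rabs_le_between in Hd.
  assert (n <= nt)%Z.
  { apply IZR_lt_1. apply (Rmult_lt_reg_l (2 * PI)); lra. }
  assert (nt <= n)%Z.
  { apply IZR_lt_1. apply (Rmult_lt_reg_l (2 * PI)); lra. }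
  lia. }
assert (n = 0)%Z by lia. subst nt. subst n.
split.
- intros x k Hx Hk. apply (P1 x Hx). assert (L := P2 x Hx). unfold passed in *. lra.
- intros x k Hx Hk. apply (T1 x Hx) in Hk. assert (L := T2 x Hx). unfold passed in *. lra.
Qed.

Lemma phi_low_unbounded (nu M : R) : 0 <= nu -> exists x, nu < x /\ M <= phi_low nu x.
Proof.
intros Hnu. destruct (is_lim_eventually _ _ (is_lim_phi_low nu Hnu) 1) as [X HX]; [lra |].
set (x := Rmax (Rmax X nu) (M + 1 + omega nu - PI / 2) + 1).
assert (Hx : X < x /\ nu < x /\ M + 1 + omega nu - PI / 2 < x).
{ assert (H : Rmax (Rmax X nu) (M + 1 + omega nu - PI / 2) < x) by (unfold x; lra).
  repeat match goal with H : Rmax _ _ < _ |- _ => apply Rmax_Rlt in H; destruct H end.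
  repeat split; assumption. }
exists x. split; [lra |]. destruct Hx as (H1 & _ & H3).
specialize (HX x H1). apply Rabs_def2 in HX. lra.
Qed.

(** * Counting the zeros *)

Lemma ensemble_ext (U : Type) (A B : Ensemble U) : (forall x, A x <-> B x) -> A = B.
Proof.
intros H. apply Extensionality_Ensembles. split; intros x; apply H.
Qed.

Lemma cardinal_image (U : Type) (g : nat -> U) (n : nat) :
  (forall i j, (i < n)%nat -> (j < n)%nat -> g i = g j -> i = j) ->
  cardinal U (fun y => exists i, (i < n)%nat /\ y = g i) n.
Proof.
induction n as [| n IH]; intros Hg.
- rewrite (ensemble_ext U _ (Empty_set U)); [constructor |].
  intros x. split; [intros (i & Hi & _); lia | intros []].
- rewrite (ensemble_ext U _ (Add U (fun y => exists i, (i < n)%nat /\ y = g i) (g n))).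
  + apply card_add.
    * apply IH. intros i j Hi Hj. apply Hg; lia.
    * intros (i & Hi & E). apply Hg in E; lia.
  + intros x. split.
    * intros (i & Hi & ->). destruct (Nat.eq_dec i n) as [-> | Hn].
      -- apply Union_intror. constructor.
      -- apply Union_introl. exists i. split; [lia | reflexivity].
    * intros [y (i & Hi & ->) | y []]; [exists i | exists n]; (split; [lia | reflexivity]).
Qed.

Section Counting.
Variables (nu : R) (th : R -> R).
Hypothesis Hnu : 0 <= nu.
Hypothesis Cth : forall x, nu < x -> continuity_pt th x.
Hypothesis Ath : forall x, nu < x -> is_angle (bessel_theta nu x) (bessel_J nu x) (th x).
Hypothesis Mth : forall x y, nu < x < y -> th x < th y.
Hypothesis Lth : forall x, nu < x -> PI * (IZR (start_index nu) - / 2) < th x.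
Hypothesis Nth : exists x, nu < x /\ th x < PI * (IZR (start_index nu) + / 2).
Hypothesis Uth : forall M, exists x, nu < x /\ M <= th x.

Let level (i : nat) : R := PI * (IZR (start_index nu + Z.of_nat i) + / 2).

(** The positive zeros of [J_nu'], counted from [0]: the angle passes them in order. *)
Definition crit (i : nat) : R := epsilon (inhabits 0) (fun x => nu < x /\ th x = level i).

Lemma crit_spec (i : nat) : nu < crit i /\ th (crit i) = level i.
Proof.
unfold crit. apply epsilon_spec. assert (HPI := PI_RGT_0).
destruct Nth as (x0 & Hx0 & H0). destruct (Uth (level i + 1)) as (x1 & Hx1 & H1).
assert (Hl : th x0 < level i).
{ apply Rlt_le_trans with (1 := H0). unfold level. apply Rmult_le_compat_l; [lra |].
  assert (IZR (start_index nu) <= IZR (start_index nu + Z.of_nat i)) by (apply IZR_le; lia). lra. }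
assert (H01 : x0 < x1).
{ destruct (Rtotal_order x0 x1) as [L | [E | L]]; [exact L | subst; lra |].
  assert (G := Mth x1 x0 ltac:(lra)). lra. }
destruct (Ranalysis5.IVT_interv (fun x => th x - level i) x0 x1) as (z & Hz & E); try lra.
- intros a Ha. apply continuity_pt_minus; [apply Cth; lra | now apply continuity_pt_const].
- exists z. split; lra.
Qed.

Lemma th_le_iff (x y : R) : nu < x -> nu < y -> (th x <= th y <-> x <= y).
Proof.
intros Hx Hy. split; intros H.
- destruct (Rle_lt_dec x y) as [L | L]; [exact L |]. assert (G := Mth y x ltac:(lra)). lra.
- destruct H as [H | ->]; [left; apply Mth; lra | right; reflexivity].
Qed.

Lemma level_le_iff (i j : nat) : level i <= level j <-> (i <= j)%nat.
Proof.
assert (HPI := PI_RGT_0). unfold level. split; intros H.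
- apply (Rmult_le_reg_l PI) in H; [| exact HPI].
  assert (G : IZR (start_index nu + Z.of_nat i) <= IZR (start_index nu + Z.of_nat j)) by lra.
  apply le_IZR in G. lia.
- apply Rmult_le_compat_l; [lra |].
  assert (IZR (start_index nu + Z.of_nat i) <= IZR (start_index nu + Z.of_nat j)) by (apply IZR_le; lia). lra.
Qed.

Lemma crit_le_iff (i j : nat) : crit i <= crit j <-> (i <= j)%nat.
Proof.
destruct (crit_spec i) as [I1 I2]. destruct (crit_spec j) as [J1 J2].
rewrite <- th_le_iff by assumption. rewrite I2, J2. apply level_le_iff.
Qed.

Lemma crit_inj (i j : nat) : crit i = crit j -> i = j.
Proof.
intros E. assert (i <= j)%nat by (apply crit_le_iff; lra).
assert (j <= i)%nat by (apply crit_le_iff; lra). lia.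
Qed.

Lemma dbessel_J_zero_iff (y : R) : 0 < y /\ dbessel_J nu y = 0 <-> exists i, y = crit i.
Proof.
assert (HPI := PI_RGT_0). split.
- intros [Hy H0]. rewrite dbessel_J_theta in H0 by assumption.
  assert (Ht : bessel_theta nu y = 0).
  { apply (Rmult_eq_reg_r (/ y)); [unfold Rdiv in H0; lra | apply Rinv_neq_0_compat; lra]. }
  assert (Hny : nu < y).
  { destruct (Rlt_le_dec nu y) as [L | L]; [exact L | exfalso].
    assert (G := bessel_increasing_part nu y). lra. }
  destruct (Ath y Hny) as [A1 _]. rewrite Ht in A1.
  assert (Hr : 0 < sqrt (0 ^ 2 + bessel_J nu y ^ 2)).
  { apply sqrt_lt_R0. assert (G := bessel_nonvanishing nu y Hnu Hy). rewrite Ht in G. exact G. }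
  assert (Hc : cos (th y) = 0).
  { symmetry in A1. apply Rmult_integral in A1. destruct A1; lra. }
  destruct (cos_eq_0_0 _ Hc) as [k Hk].
  assert (Hk0 : (start_index nu <= k)%Z).
  { apply IZR_lt_1. assert (G := Lth y Hny). rewrite Hk in G.
    apply (Rmult_lt_reg_l PI); lra. }
  exists (Z.to_nat (k - start_index nu)).
  destruct (crit_spec (Z.to_nat (k - start_index nu))) as [C1 C2].
  assert (E : th y = th (crit (Z.to_nat (k - start_index nu)))).
  { rewrite C2, Hk. unfold level. rewrite Z2Nat.id by lia.
    replace (start_index nu + (k - start_index nu))%Z with k by lia. lra. }
  apply Rle_antisym; apply th_le_iff; trivial; lra.
- intros [i ->]. destruct (crit_spec i) as [C1 C2]. assert (Hp : 0 < crit i) by lra.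
  split; [exact Hp |]. rewrite dbessel_J_theta by lra.
  destruct (Ath _ C1) as [A1 _].
  assert (Hc : cos (th (crit i)) = 0).
  { apply cos_eq_0_1. exists (start_index nu + Z.of_nat i)%Z. rewrite C2. unfold level. lra. }
  rewrite A1, Hc. field. lra.
Qed.

Lemma crit_is_kth (i : nat) : is_kth_positive_zero (dbessel_J nu) (S i) (crit i).
Proof.
destruct (proj2 (dbessel_J_zero_iff (crit i)) (ex_intro _ i eq_refl)) as [H1 H2].
split; [exact H1 |]. split; [exact H2 |].
rewrite (ensemble_ext R _ (fun y => exists j, (j < S i)%nat /\ y = crit j)).
- apply cardinal_image. intros j k _ _. apply crit_inj.
- intros y. split.
  + intros [Hy H0]. destruct (proj1 (dbessel_J_zero_iff y)) as [j ->]; [tauto |].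
    exists j. split; [| reflexivity].
    assert (j <= i)%nat by (apply crit_le_iff; lra). lia.
  + intros (j & Hj & ->).
    destruct (proj2 (dbessel_J_zero_iff (crit j)) (ex_intro _ j eq_refl)) as [G1 G2].
    split; [| exact G2]. split; [exact G1 |]. apply crit_le_iff. lia.
Qed.

Lemma kth_positive_zero_crit (i : nat) : kth_positive_zero (dbessel_J nu) (S i) = crit i.
Proof.
assert (H : is_kth_positive_zero (dbessel_J nu) (S i) (kth_positive_zero (dbessel_J nu) (S i))).
{ unfold kth_positive_zero. apply epsilon_spec. exists (crit i). apply crit_is_kth. }
set (x := kth_positive_zero _ _) in *. destruct H as (H1 & H2 & H3).
destruct (proj1 (dbessel_J_zero_iff x) (conj H1 H2)) as [j Ej]. rewrite Ej in *.
destruct (crit_is_kth j) as (_ & _ & G3).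
assert (E := cardinal_unicity _ _ _ H3 _ G3). f_equal. lia.
Qed.

Lemma jprime_crit (i : nat) : jprime nu (Z.to_nat (start_index nu) + S i) = crit i.
Proof.
rewrite <- kth_positive_zero_crit. unfold jprime, start_index.
destruct (Req_EM_T nu 0) as [-> | N]; reflexivity.
Qed.

Lemma jprime_initial (k : nat) : (1 <= k <= Z.to_nat (start_index nu))%nat -> jprime nu k = 0.
Proof.
unfold jprime, start_index. destruct (Req_EM_T nu 0) as [E | N]; simpl; intros Hk; [| lia].
replace k with 1%nat by lia. reflexivity.
Qed.

Lemma counting_function (lam : R) : nu < lam ->
  exists N : nat, is_counting_jprime nu lam N /\
    forall k, passed k (th lam) <-> (k <= Z.of_nat N)%Z.
Proof.
intros Hlam. assert (HPI := PI_RGT_0).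
set (K := Zfloor (th lam / PI + / 2)).
assert (B := Zfloor_bound (th lam / PI + / 2)). fold K in B.
assert (E : th lam = th lam / PI * PI) by (field; lra).
assert (HK : forall k, passed k (th lam) <-> (k <= K)%Z).
{ intros k. unfold passed. split; intros H.
  - apply IZR_lt_1. rewrite E in H. apply (Rmult_lt_reg_l PI); [exact HPI |]. nra.
  - assert (IZR k <= IZR K) by now apply IZR_le. rewrite E. nra. }
assert (Hi : (0 <= start_index nu <= K)%Z).
{ split; [apply start_index_bounds |]. apply HK. unfold passed. apply Rlt_le, Lth, Hlam. }
exists (Z.to_nat K). split.
- unfold is_counting_jprime.
  rewrite (ensemble_ext nat (fun k => (1 <= k)%nat /\ jprime nu k <= lam)
    (fun k => exists i, (i < Z.to_nat K)%nat /\ k = S i)).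
  + apply cardinal_image. intros i j _ _. lia.
  + intros k. split.
    * intros [Hk Hj]. exists (k - 1)%nat. split; [| lia].
      destruct (Nat.le_gt_cases k (Z.to_nat (start_index nu))) as [L | L]; [lia |].
      replace k with (Z.to_nat (start_index nu) + S (k - S (Z.to_nat (start_index nu))))%nat in Hj by lia.
      rewrite jprime_crit in Hj.
      set (i := (k - S (Z.to_nat (start_index nu)))%nat) in *.
      destruct (crit_spec i) as [C1 C2].
      apply th_le_iff in Hj; [| exact C1 | exact Hlam]. rewrite C2 in Hj.
      assert (G : passed (start_index nu + Z.of_nat i + 1) (th lam)).
      { unfold passed, level in *. rewrite plus_IZR. lra. }
      apply HK in G. lia.
    * intros (k' & Hk' & ->). split; [lia |].
      destruct (Nat.le_gt_cases (S k') (Z.to_nat (start_index nu))) as [L | L].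
      -- rewrite jprime_initial by lia. lra.
      -- replace (S k') with (Z.to_nat (start_index nu) + S (k' - Z.to_nat (start_index nu)))%nat by lia.
         rewrite jprime_crit. set (i := (k' - Z.to_nat (start_index nu))%nat).
         destruct (crit_spec i) as [C1 C2]. apply th_le_iff; [exact C1 | exact Hlam |].
         rewrite C2.
         assert (G : passed (start_index nu + Z.of_nat i + 1) (th lam)) by (apply HK; lia).
         unfold passed, level in *. rewrite plus_IZR in G. lra.
- intros k. rewrite HK, Z2Nat.id by lia. reflexivity.
Qed.
End Counting.

Lemma passed_iff_floor (k : Z) (t : R) : passed k t <-> IZR k <= 1 / PI * t + 1 / 2.
Proof.
assert (HPI := PI_RGT_0). unfold passed.
replace (1 / PI * t + 1 / 2) with ((t + PI / 2) / PI) by (field; lra).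
split; intros H.
- apply (Rmult_le_reg_l PI); [exact HPI |].
  replace (PI * ((t + PI / 2) / PI)) with (t + PI / 2) by (field; lra). lra.
- apply (Rmult_le_compat_l PI) in H; [| lra].
  replace (PI * ((t + PI / 2) / PI)) with (t + PI / 2) in H by (field; lra). lra.
Qed.

Theorem corollary1p13 (nu lam : R) (hnu : 0 <= nu) (hlam : nu < lam) :
  exists N : nat,
    is_counting_jprime nu lam N /\
    (Zfloor (1 / PI * phi_low nu lam + 1 / 2) <= Z.of_nat N)%Z /\
    (Z.of_nat N <= Zfloor (1 / PI * phi_tilde_tilde nu lam + 1 / 2))%Z.
Proof.
destruct (bessel_angle nu hnu) as (th & Cth & Ath & Mth & Lth & Nth).
destruct (bessel_angle_enclosure nu th hnu Cth Ath Lth Nth) as [Hlow Hup].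
assert (HPI := PI_RGT_0).
assert (Uth : forall M, exists x, nu < x /\ M <= th x).
{ intros M. set (k := up (M / PI + 1)).
  assert (Hk : M / PI + 1 < IZR k) by apply archimed.
  destruct (phi_low_unbounded nu (PI * (IZR k - / 2)) hnu) as (x & Hx & H).
  exists x. split; [exact Hx |]. apply Hlow in H; [| exact Hx]. unfold passed in H.
  apply Rle_trans with (2 := H).
  replace M with (PI * (M / PI)) at 1 by (field; lra). apply Rmult_le_compat_l; lra. }
destruct (counting_function nu th hnu Cth Ath Mth Lth Nth Uth lam hlam) as (N & HN & HK).
destruct (x_star_spec nu hnu) as [Hstar _].
assert (HNp : passed (Z.of_nat N) (th lam)) by (apply HK; lia).
exists N. split; [exact HN |]. split.
- apply HK, Hlow; [exact hlam |]. apply passed_iff_floor, Zfloor_bound.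
- apply Zfloor_lub, passed_iff_floor.
  (* The enclosure holds beyond [x_star]; at [x_star] itself it follows by continuity,
     the angle being increasing. *)
  assert (Hcl : forall y, lam <= y -> x_star nu <= y -> passed (Z.of_nat N) (phi_tilde nu y)).
  { intros y H1 H2. unfold passed.
    destruct (Rle_lt_dec (PI * (IZR (Z.of_nat N) - / 2)) (phi_tilde nu y)) as [L | L]; [exact L | exfalso].
    assert (C := is_derive_continuity_pt _ _ _ (is_derive_phi_tilde nu y ltac:(lra))).
    destruct (C (PI * (IZR (Z.of_nat N) - / 2) - phi_tilde nu y)) as (e & He & H); [lra |].
    assert (G : Rabs (phi_tilde nu (y + e / 2) - phi_tilde nu y) <
      PI * (IZR (Z.of_nat N) - / 2) - phi_tilde nu y).
    { apply (H (y + e / 2)). split; [split; [exact I | lra] |].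
      simpl. unfold R_dist. rewrite Rabs_pos_eq; lra. }
    apply Rabs_def2 in G.
    assert (P : passed (Z.of_nat N) (phi_tilde nu (y + e / 2))).
    { apply Hup; [lra |]. eapply passed_le; [| exact HNp]. left. apply Mth. lra. }
    unfold passed in P. lra. }
  unfold phi_tilde_tilde. destruct (Rlt_dec lam (x_star nu)) as [L | L].
  + apply Hcl; lra.
  + apply Hcl; lra.
Qed.
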